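(* Assume the $\tau$-periodic system described in the context is exponentially stable and let $Y_N$ be a finite-dimensional subspace of $Y$ such that $Y_N\subset\operatorname{ran}(\mathcal{P})$. Choose $Z=\mathbb{C}^r$ with $r=\dim Y_N$, $$G_1=I\in\mathbb{C}^{r\times r},\quad K=\varepsilon K_0,\quad\text{and}\quad G_2=G_{20}Q_N\in\mathcal{L}(Y,Z),$$ where $Q_N$ is a (bounded) projection of $Y$ onto $Y_N$, $G_{20}\in\mathcal{L}(Y_N,Z)$ is boundedly invertible, and $K_0\in\mathcal{L}(\mathbb{C}^r,U)$ is such that $\sigma(G_2\mathcal{P}K_0)\subset\mathbb{C}_-$. Then there exists $\varepsilon^*>0$ such that for all $0<\varepsilon\le\varepsilon^*$ the dynamic feedback controller with parameters $(G_1,G_2,K)$ solves the output regulation problem approximately for all $\tau$-periodic reference and disturbance signals $y_{ref}\in Y$ and $w_{dist}\in U_d$, in the following sense: the closed-loop system is exponentially stable, and for all $x_0\in X$ and $z_0\in Z$ $$\lim_{n\to\infty}\|y(n\tau+\cdot)-y_{ref}(\cdot)\|_Y=\big\|(I-Q_N)\left[\mathcal{P}Kz+\mathcal{P}_dw_{dist}-y_{ref}\right]\big\|_Y,$$ where $z\in Z$ is the unique solution of $Q_N\mathcal{P}Kz=Q_Ny_{ref}-Q_N\mathcal{P}_dw_{dist}$. Moreover, the controller is robust with respect to perturbations of the system parameters for which the perturbed closed-loop system is exponentially stable: if the parameters $(A(t),B(t),B_d(t),C(t),D(t))$ are perturbed to $(\tilde A(t),\tilde B(t),\tilde B_d(t),\tilde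 C(t),\tilde D(t))$ so that the perturbed closed-loop system is exponentially stable, and if $1\in\rho(U_{\tilde A}(\tau,0))$, then the asymptotic regulation error is of the same form for the perturbed parameters, i.e., for all $\tau$-periodic signals $y_{ref}\in Y$, $w_{dist}\in U_d$ and all $x_0\in X$, $z_0\in Z$, $$\lim_{n\to\infty}\|y(n\tau+\cdot)-y_{ref}(\cdot)\|_Y=\big\|(I-Q_N)[\tilde{\mathcal{P}}Kz+\tilde{\mathcal{P}}_dw_{dist}-y_{ref}]\big\|_Y,$$ where $z\in Z$ is the unique solution of $Q_N\tilde{\mathcal{P}}Kz=Q_Ny_{ref}-Q_N\tilde{\mathcal{P}}_dw_{dist}$.
   Context: Let $\tau>0$, let $X$ be a Banach space (the state space) and let $U_0$, $U_{d0}$, $Y_0$ be Hilbert spaces. Denote $U=L^2(0,\tau;U_0)$, $U_d=L^2(0,\tau;U_{d0})$, $Y=L^2(0,\tau;Y_0)$, and $\mathbb{C}_-=\{\lambda\in\mathbb{C}:\operatorname{Re}\lambda<0\}$. Consider the system $$\dot x(t)=A(t)x(t)+B(t)u(t)+B_d(t)w_{dist}(t),\quad x(0)=x_0\in X,\qquad y(t)=C(t)x(t)+D(t)u(t),$$ where $A(\cdot),B(\cdot),B_d(\cdot),C(\cdot),D(\cdot)$ are $\tau$-periodic operator-valued functions with $B\in L^\infty(\mathbb{R},\mathcal{L}(U_0,X))$, $B_d\in L^\infty(\mathbb{R},\mathcal{L}(U_{d0},X))$, $C\in L^\infty(\mathbb{R},\mathcal{L}(X,Y_0))$, $D\in L^\infty(\mathbb{R},\mathcal{L}(U_0,Y_0))$.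 It is assumed that $A(\cdot)$ determines a strongly continuous evolution family $(U_A(t,s))_{t\ge s}\subset\mathcal{L}(X)$: $U_A(t,t)=I$, $U_A(t,r)U_A(r,s)=U_A(t,s)$ for $t\ge r\ge s$, $(t,s)\mapsto U_A(t,s)x$ is continuous for every $x\in X$, and $U_A(t+\tau,s+\tau)=U_A(t,s)$ by periodicity. The state of the system is the mild state $$x(t)=U_A(t,0)x_0+\int_0^tU_A(t,s)\big(B(s)u(s)+B_d(s)w_{dist}(s)\big)ds.$$ The system is exponentially stable if there exist $M,\omega>0$ such that $\|U_A(t,s)\|\le Me^{-\omega(t-s)}$ for all $t\ge s$. Whenever $1\in\rho(U_A(\tau,0))$ (in particular if the system is exponentially stable), denote $G_A(t,s)=U_A(t,0)(I-U_A(\tau,0))^{-1}U_A(\tau,s)$ and define $\mathcal{P}\in\mathcal{L}(U,Y)$ and $\mathcal{P}_d\in\mathcal{L}(U_d,Y)$ for $t\in[0,\tau]$ by $$(\mathcal{P}u)(t)=C(t)\int_0^\tau G_A(t,s)B(s)u(s)ds+C(t)\int_0^tU_A(t,s)B(s)u(s)ds+D(t)u(t),$$ $$(\mathcal{P}_dw)(t)=C(t)\int_0^\tau G_A(t,s)B_d(s)w(s)ds+C(t)\int_0^tU_A(t,s)B_d(s)w(s)ds.$$ The operators $\tilde{\mathcal{P}},\tilde{\mathcal{P}}_d$ are defined by the same formulas with the perturbed parameters and the perturbed evolution family $U_{\tilde A}(t,s)$. Perturbed parameters are assumed to be $\tau$-periodic and to satisfy the same boundedness assumptions and the same assumption on the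 existence of an evolution family as the nominal ones. A $\tau$-periodic signal is identified with its restriction to $[0,\tau]$, which is the meaning of $y_{ref}\in Y$ and $w_{dist}\in U_d$. Dynamic feedback controller: for a Banach space $Z$, $G_1\in\mathcal{L}(Z)$, $G_2\in\mathcal{L}(Y,Z)$, $K\in\mathcal{L}(Z,U)$, the controller is $$z_{n+1}=G_1z_n+G_2\big(y(n\tau+\cdot)-y_{ref}(\cdot)\big),\quad z_0\in Z,\qquad u(n\tau+\cdot)=Kz_n\ \text{ on } [0,\tau),\quad n\ge0.$$ The closed-loop system is called exponentially stable if there exist $M_0,M_1,\alpha_0,\alpha_1>0$ such that in the case $y_{ref}\equiv0$, $w_{dist}\equiv0$ one has $\|x(t)\|\le M_0e^{-\alpha_0t}(\|x_0\|+\|z_0\|)$ and $\|z_n\|\le M_1e^{-\alpha_1n}(\|x_0\|+\|z_0\|)$ for all $t\ge0$, $n\ge0$, $x_0\in X$, $z_0\in Z$. *)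

(* Defs.v *)
From HB Require Import structures.
From mathcomp Require Import all_boot all_order all_algebra.
From mathcomp Require Import complex sesquilinear ring_quotient.
From mathcomp Require Import all_classical all_reals all_analysis.
From mathcomp Require Import measurable_realfun.
Set Implicit Arguments.
Unset Strict Implicit.
Unset Printing Implicit Defensive.
Import Order.TTheory GRing.Theory Num.Theory.
Import numFieldNormedType.Exports.
Local Open Scope classical_set_scope.
Local Open Scope ring_scope.
Local Open Scope complex_scope.

Section real_norm.
Context {R : realType}.

(* In a [normedModType R[i]] the norm is R[i]-valued; [rnorm x] is the same
   number as an element of [R]. *)
Definition rnorm {E : normedModType R[i]} (x : E) : R := complex.Re `|x|.

Lemma rnormE {E : normedModType R[i]} (x : E) : `|x| = (rnorm x)%:C.
Proof. by rewrite /rnorm RRe_real. Qed.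

Lemma Renorm (a : R[i]) : (complex.Re `|a|)%:C = `|a|.
Proof. by rewrite RRe_real. Qed.

Lemma Renorm_ge0 (a : R[i]) : 0 <= complex.Re `|a|.
Proof. by have := normr_ge0 a; rewrite -Renorm lecR. Qed.

Lemma rnorm_ge0 {E : normedModType R[i]} (x : E) : 0 <= rnorm x.
Proof. by have := normr_ge0 x; rewrite rnormE lecR. Qed.

Lemma ler_rnormD {E : normedModType R[i]} (x y : E) :
  rnorm (x + y) <= rnorm x + rnorm y.
Proof. by rewrite -lecR rmorphD/= -!rnormE ler_normD. Qed.

Lemma rnormZ {E : normedModType R[i]} (a : R[i]) (x : E) :
  rnorm (a *: x) = complex.Re `|a| * rnorm x.
Proof.
by apply: (@complexI R); rewrite rmorphM/= -!rnormE normrZ; congr (_ * _).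
Qed.

Lemma rnorm0_eq0 {E : normedModType R[i]} (x : E) : rnorm x = 0 -> x = 0.
Proof. by move=> x0; apply/normr0_eq0; rewrite rnormE x0. Qed.

Lemma rnorm0 {E : normedModType R[i]} : rnorm (0 : E) = 0.
Proof. by rewrite /rnorm normr0. Qed.

End real_norm.

Section bounded_operators.
Context {R : realType}.
Implicit Types E F : normedModType R[i].

Definition bounded_op {E F} : {pred E -> F} := fun f =>
  `[< linear f /\ exists M : R, forall x, rnorm (f x) <= M * rnorm x >].

Lemma bounded_op_submod_closed E F : submod_closed (@bounded_op E F).
Proof.
split.
  apply/asboolP; split=> [a x y|]; first by rewrite /= scaler0 addr0.
  by exists 0 => x; rewrite mul0r [X in rnorm X](_ : _ = 0)// rnorm0.
move=> a f g /asboolP[lf [M fM]] /asboolP[lg [N gN]]; apply/asboolP; split.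
  move=> b x y /=; change (a *: f (b *: x + y) + g (b *: x + y) =
    b *: (a *: f x + g x) + (a *: f y + g y)).
  by rewrite lf lg !scalerDr !scalerA mulrC addrACA.
exists (complex.Re `|a| * M + N) => x.
change (rnorm (a *: f x + g x) <= (complex.Re `|a| * M + N) * rnorm x).
rewrite (le_trans (ler_rnormD _ _))// mulrDl lerD// rnormZ -mulrA.
by rewrite ler_wpM2l// Renorm_ge0.
Qed.

HB.instance Definition _ E F := GRing.isSubmodClosed.Build _ _
  (@bounded_op E F) (@bounded_op_submod_closed E F).

(* L(E, F), normed below by the operator norm. *)
Record bop E F := Bop { bop_fun :> E -> F ; bopP : bop_fun \in bounded_op }.

HB.instance Definition _ E F := [isSub for @bop_fun E F].
HB.instance Definition _ E F := [Choice of bop E F by <:].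
HB.instance Definition _ E F := [SubChoice_isSubLmodule of bop E F by <:].

Definition opnorm E F (f : bop E F) : R :=
  sup [set rnorm (f x) | x in [set x | rnorm x <= 1]].

Lemma bop_linear E F (f : bop E F) : linear f.
Proof. by have /asboolP[] := bopP f. Qed.

Lemma bop_bounded E F (f : bop E F) :
  exists2 M : R, 0 <= M & forall x, rnorm (f x) <= M * rnorm x.
Proof.
have /asboolP[_ [M fM]] := bopP f; exists `|M| => // x.
by rewrite (le_trans (fM x))// ler_wpM2r ?rnorm_ge0// ler_norm.
Qed.

HB.instance Definition _ E F (f : bop E F) :=
  GRing.isLinear.Build _ _ _ _ (bop_fun f) (bop_linear f).

Lemma opnorm_has_sup E F (f : bop E F) :
  has_sup [set rnorm (f x) | x in [set x | rnorm x <= 1]].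
Proof.
split; first by exists (rnorm (f 0)), 0 => //=; rewrite rnorm0.
have [M M0 fM] := bop_bounded f; exists M => _ [x /= x1 <-].
by rewrite (le_trans (fM x))// -[leRHS]mulr1 ler_wpM2l.
Qed.

Lemma opnorm_ge0 E F (f : bop E F) : 0 <= opnorm f.
Proof.
apply: (@le_trans _ _ (rnorm (f 0))); first exact: rnorm_ge0.
apply: sup_upper_bound; first exact: opnorm_has_sup.
by exists 0 => //=; rewrite rnorm0.
Qed.

Lemma ler_opnorm E F (f : bop E F) x : rnorm (f x) <= opnorm f * rnorm x.
Proof.
have [->|x0] := eqVneq x 0; first by rewrite linear0 !rnorm0 mulr0.
have nx0 : 0 < rnorm x.
  rewrite lt_def rnorm_ge0 andbT; apply: contra_neq x0; exact: rnorm0_eq0.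
rewrite -ler_pdivrMr//; apply: sup_upper_bound; first exact: opnorm_has_sup.
have nV : complex.Re `|((rnorm x)^-1)%:C| = (rnorm x)^-1.
  by rewrite ger0_norm ?lecR ?invr_ge0 ?rnorm_ge0.
exists (((rnorm x)^-1)%:C *: x) => /=; rewrite ?linearZ/= rnormZ nV.
  by rewrite mulVf// gt_eqF.
by rewrite mulrC.
Qed.

Lemma opnorm_le E F (f : bop E F) M :
  0 <= M -> (forall x, rnorm (f x) <= M * rnorm x) -> opnorm f <= M.
Proof.
move=> M0 fM; apply: ge_sup.
  by exists (rnorm (f 0)), 0 => //=; rewrite rnorm0.
move=> _ [x /= x1 <-]; rewrite (le_trans (fM x))//.
by rewrite -[leRHS]mulr1 ler_wpM2l.
Qed.

Lemma bop_opnormD E F (f g : bop E F) :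
  (opnorm (f + g))%:C <= (opnorm f)%:C + (opnorm g)%:C.
Proof.
rewrite -rmorphD/= lecR; apply: opnorm_le => [|x].
  by rewrite addr_ge0// opnorm_ge0.
change (rnorm (f x + g x) <= (opnorm f + opnorm g) * rnorm x).
by rewrite (le_trans (ler_rnormD _ _))// mulrDl lerD// ler_opnorm.
Qed.

Lemma bop_opnormZ_le E F (a : R[i]) (f : bop E F) :
  opnorm (a *: f) <= complex.Re `|a| * opnorm f.
Proof.
have a0 := Renorm_ge0 a.
apply: opnorm_le => [|x]; first by rewrite mulr_ge0// opnorm_ge0.
change (rnorm (a *: f x) <= complex.Re `|a| * opnorm f * rnorm x).
by rewrite rnormZ -mulrA ler_wpM2l// ler_opnorm.
Qed.

Lemma bop_opnormZ E F (a : R[i]) (f : bop E F) :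
  (opnorm (a *: f))%:C = `|a| * (opnorm f)%:C.
Proof.
have ReE := @Renorm R.
suff -> : opnorm (a *: f) = complex.Re `|a| * opnorm f.
  by rewrite rmorphM [X in X * _](ReE a).
apply/eqP; rewrite eq_le bop_opnormZ_le andTb.
have [->|a0] := eqVneq a 0; first by rewrite normr0 mul0r opnorm_ge0.
have ra0 : 0 < complex.Re `|a| by rewrite -ltcR ReE normr_gt0.
rewrite -ler_pdivlMl// -[X in opnorm X](scalerK a0).
rewrite (le_trans (bop_opnormZ_le _ _))// ler_wpM2r ?opnorm_ge0//.
by rewrite -lecR ReE normfV -[in leLHS]ReE rmorphV ?unitfE ?gt_eqF.
Qed.

Lemma bop_opnorm0_eq0 E F (f : bop E F) : (opnorm f)%:C = 0 :> R[i] -> f = 0.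
Proof.
move=> /(@complexI R) f0; apply/val_inj/funext => x; apply: rnorm0_eq0.
by apply/eqP; rewrite eq_le rnorm_ge0 andbT (le_trans (ler_opnorm f x))// f0 mul0r.
Qed.

HB.instance Definition _ E F := Lmodule_isNormed.Build R[i] (bop E F)
  (@bop_opnormD E F) (@bop_opnormZ E F) (@bop_opnorm0_eq0 E F).

Lemma bop_normE E F (f : bop E F) : `|f| = (opnorm f)%:C.
Proof. by []. Qed.

Lemma idop_bounded E : (@idfun E) \in bounded_op.
Proof.
by apply/asboolP; split; [|exists 1 => x; rewrite mul1r].
Qed.
Definition idop E : bop E E := Bop (@idop_bounded E).

Lemma compop_bounded E F G (g : bop F G) (f : bop E F) : g \o f \in bounded_op.
Proof.
apply/asboolP; split=> [a x y /=|]; first by rewrite !linearP.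
exists (opnorm g * opnorm f) => x /=.
rewrite (le_trans (ler_opnorm _ _))// -mulrA ler_wpM2l ?opnorm_ge0//.
exact: ler_opnorm.
Qed.
Definition compop E F G (g : bop F G) (f : bop E F) : bop E G :=
  Bop (compop_bounded g f).

(* [S] is a bounded two-sided inverse of l - T. *)
Definition resolvent_of E (T : E -> E) (l : R[i]) (S : bop E E) : Prop :=
  (forall x, S (l *: x - T x) = x) /\ (forall x, l *: S x - T (S x) = x).

Definition resolvent_set E (T : E -> E) : set R[i] :=
  [set l | exists S, resolvent_of T l S].

Definition spectrum E (T : E -> E) : set R[i] := ~` resolvent_set T.

Definition resolvent E (T : E -> E) (l : R[i]) : bop E E :=
  xget 0 [set S | resolvent_of T l S].

Definition boundedly_invertible E F (T : bop E F) : Prop :=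
  exists S : bop F E, cancel T S /\ cancel S T.

End bounded_operators.

Section subspaces.
Context {R : realType} (E : normedModType R[i]).

Record vsubspace := VSubspace {
  vsubspace_pred :> {pred E} ;
  vsubspaceP : submod_closed vsubspace_pred }.

HB.instance Definition _ (V : vsubspace) :=
  GRing.isSubmodClosed.Build _ _ (vsubspace_pred V) (vsubspaceP V).

Record vsub (V : vsubspace) := Vsub {
  vsub_val :> E ; vsub_valP : vsub_val \in V }.

HB.instance Definition _ V := [isSub for @vsub_val V].
HB.instance Definition _ V := [Choice of vsub V by <:].
HB.instance Definition _ V := [SubChoice_isSubLmodule of vsub V by <:].

Lemma vsub_normD V (x y : vsub V) :
  `|vsub_val (x + y)| <= `|vsub_val x| + `|vsub_val y|.
Proof. exact: ler_normD. Qed.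

Lemma vsub_normZ V (a : R[i]) (x : vsub V) :
  `|vsub_val (a *: x)| = `|a| * `|vsub_val x|.
Proof. exact: normrZ. Qed.

Lemma vsub_norm0_eq0 V (x : vsub V) : `|vsub_val x| = 0 -> x = 0.
Proof. by move=> /normr0_eq0 x0; exact: val_inj. Qed.

HB.instance Definition _ V := Lmodule_isNormed.Build R[i] (vsub V)
  (@vsub_normD V) (@vsub_normZ V) (@vsub_norm0_eq0 V).

Lemma vsub_normE V (x : vsub V) : `|x| = `|vsub_val x|.
Proof. by []. Qed.

End subspaces.

Definition has_dim {R : realType} (E : normedModType R[i]) (r : nat) : Prop :=
  exists b : 'I_r -> E, forall x : E,
    exists! c : {ffun 'I_r -> R[i]}, x = \sum_(i < r) c i *: b i.

(* The norm of the Banach space [H] comes from an inner product. *)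
Definition is_hilbert {R : realType} (H : completeNormedModType R[i]) : Prop :=
  exists dot : {dot H for (@Num.conj_op R[i])},
    forall x : H, `|x| ^+ 2 = dot x x.

Section lower_integral.
Context {d} {T : measurableType d} {R : realType}.
Variable mu : {measure set T -> \bar R}.
Import HBNNSimple.

Lemma ge0_ae_le_integralT (f g : T -> \bar R) :
  (forall t, 0 <= f t)%E -> (forall t, 0 <= g t)%E ->
  {ae mu, forall t, (f t <= g t)%E} ->
  (\int[mu]_t f t <= \int[mu]_t g t)%E.
Proof.
move=> f0 g0 [N [mN muN fgN]]; rewrite [leLHS]ge0_integralTE//.
apply: ge_ereal_sup => _ [h /= hf <-].
pose k := proj_nnsfun h (measurableC mN).
rewrite -integralT_nnsfun (@ge0_ae_eq_integral _ _ _ _ _ _ (EFin \o k))//=.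
- rewrite -[X in (X <= _)%E]/(\int[mu]_t (k t)%:E)%E integralT_nnsfun [leRHS]ge0_integralTE//; apply: ereal_sup_ubound.
  exists k => // t; rewrite /k -mrestrict patchE.
  case: ifPn => [|_]; last exact: g0.
  rewrite inE => Nt; rewrite (le_trans (hf t))//.
  by apply: contrapT => nfg; apply: Nt; exact: fgN.
- exact/measurable_EFinP/measurable_funTS.
- exact/measurable_EFinP/measurable_funTS.
- by move=> t _; rewrite lee_fin; exact: fun_ge0.
- by move=> t _; rewrite lee_fin (@fun_ge0 _ _ k).
- exists N; split => // t /= /not_implyP[_].
  apply: contra_notP => Nt; congr (_%:E).
  have /(congr1 (fun u : T -> R => u t)) := mrestrict h (measurableC mN).
  by rewrite patchE mem_set.
Qed.

Lemma ae_le_Lnorm (p : R) (f g : T -> R) : (0 <= p) ->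
  {ae mu, forall t, `|f t| <= `|g t|} ->
  ('N[mu]_p%:E[EFin \o f] <= 'N[mu]_p%:E[EFin \o g])%E.
Proof.
move=> p0 fg; rewrite unlock /Lnorm.
have h : (\int[mu]_x `|(EFin \o f) x| `^ p <= \int[mu]_x `|(EFin \o g) x| `^ p)%E.
  apply: ge0_ae_le_integralT => [t|t|]; try exact: poweR_ge0.
  by apply: filterS fg => t fgt /=; rewrite lee_fin ge0_ler_powR.
have I (k : T -> R) : (\int[mu]_x `|(EFin \o k) x| `^ p)%E \in `[0%E, +oo%E].
  by rewrite in_itv/= leey andbT; apply: integral_ge0 => t _; rewrite lee_fin powR_ge0.
by apply: (gt0_ler_poweR _ (I f) (I g) h); rewrite invr_ge0.
Qed.

End lower_integral.

Section strong_measurability.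
Context {R : realType}.
Implicit Types E F : normedModType R[i].
Local Notation mu := (@lebesgue_measure R).

(* Bochner measurability with respect to the Lebesgue measure; simple functions
   have measurable level sets and converge in norm, almost everywhere on [D].
   For [E = bop F G] the convergence is in operator norm. *)
Definition simple_function {E} (s : R -> E) : Prop :=
  finite_set (range s) /\ forall c, measurable (s @^-1` [set c]).

Definition strongly_measurable {E} (D : set R) (f : R -> E) : Prop :=
  exists2 s : nat -> R -> E, (forall n, simple_function (s n)) &
    {ae mu, forall t, D t -> s n t @[n --> \oo] --> f t}.

Lemma simple_function_preimage {E} (s : R -> E) (A : set E) :
  simple_function s -> measurable (s @^-1` A).
Proof.
move=> [fs ms].
have -> : s @^-1` A = \bigcup_(c in range s `&` A) (s @^-1` [set c]).
  apply/seteqP; split=> [t At|t [c [_ Ac]] /= ->//].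
  by exists (s t) => //; split => //; exists t.
by apply: fin_bigcup_measurable => //; exact: finite_setIl.
Qed.

Lemma simple_function_cst {E} (c : E) : simple_function (fun=> c : E).
Proof.
split; last by move=> d; rewrite preimage_cst; case: ifP.
by apply: (@sub_finite_set _ _ [set c]) => [_ [_ _ <-]|].
Qed.

Lemma simple_functionP {E} a (s t : R -> E) : simple_function s ->
  simple_function t -> simple_function (fun x => a *: s x + t x).
Proof.
move=> [fs ms] [ft mt]; split.
  apply: (@sub_finite_set _ _
    [set a *: p.1 + p.2 | p in range s `*` range t]).
    by move=> _ [x _ <-]; exists (s x, t x) => //=; split; exists x.
  by apply: finite_image; exact: finite_setX.
move=> c; rewrite (_ : _ @^-1` _ =
    \bigcup_(u in range s) (s @^-1` [set u] `&` t @^-1` [set c - a *: u])).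
  by apply: fin_bigcup_measurable => // u _; exact: measurableI.
apply/seteqP; split=> x /=.
  by move=> <-; exists (s x); [exists x|split => //=; rewrite addrAC subrr add0r].
by move=> [_ [y _ <-] [/= -> ->]]; rewrite addrC subrK.
Qed.

Lemma strongly_measurable0 {E} D : strongly_measurable D (0 : R -> E).
Proof.
exists (fun _ _ => 0); first by move=> n; exact: simple_function_cst.
by apply: aeW => t _; exact: cvg_cst.
Qed.

Lemma strongly_measurableP {E} D a (f g : R -> E) : strongly_measurable D f ->
  strongly_measurable D g -> strongly_measurable D (a *: f + g).
Proof.
move=> [s ss sf] [t st tg]; exists (fun n x => a *: s n x + t n x).
  by move=> n; exact: simple_functionP.
apply: (@filterS2 _ _ (ae_filter_ringOfSetsType mu)) sf tg => x sf tg Dx.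
by apply: cvgD; [apply: cvgZr; exact: sf|exact: tg].
Qed.

Lemma rnorm_cvg {E} (u : nat -> E) (l : E) :
  u n @[n --> \oo] --> l -> rnorm (u n) @[n --> \oo] --> rnorm l.
Proof.
move=> /cvgrPdist_lt ul; apply/cvgrPdist_lt => e e0.
have e0' : 0 < e%:C by rewrite ltcR.
apply: filterS (ul _ e0') => n; rewrite rnormE ltcR; apply: le_lt_trans.
have := ler_dist_dist l (u n).
by rewrite !rnormE -rmorphB/= normc_def/= expr0n/= addr0 sqrtr_sqr lecR.
Qed.

Lemma strongly_measurable_rnorm {E} D (f : R -> E) : measurable D ->
  strongly_measurable D f ->
  exists2 n : R -> R, measurable_fun setT n &
    {ae mu, forall t, ((rnorm \o f) \_ D) t = n t}.
Proof.
move=> mD [s ss [N [mN muN Nsf]]].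
pose m k := (rnorm \o s k) \_ (D `\` N).
exists (fun t => ((rnorm \o f) \_ (D `\` N)) t).
  apply: (@measurable_fun_cvg _ _ _ setT m) => [k|t _].
    apply/(measurable_restrictT _ _).1; first exact: measurableD.
    apply: measurable_funTS => _ Y mY; rewrite setTI.
    by rewrite comp_preimage; exact: simple_function_preimage.
  rewrite /m patchE; case: ifPn => tDN.
    under eq_fun do rewrite patchE tDN.
    apply: rnorm_cvg; move: tDN; rewrite inE => -[Dt Nt].
    by apply: contrapT => nsf; apply: Nt; apply: Nsf => /= /(_ Dt).
  by under eq_fun do rewrite patchE (negbTE tDN); exact: cvg_cst.
exists N; split => // t /=; apply: contra_notP => Nt; rewrite !patchE.
congr (if _ then _ else _); apply/idP/idP; rewrite !inE; first by split.
by case.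
Qed.

End strong_measurability.

Section square_integrable.
Context {R : realType}.
Variables (tau : R) (E : normedModType R[i]).
Local Notation mu := (@lebesgue_measure R).
Local Notation J := (`]0%R, tau[%classic : set R).
Local Notation ae := (almost_everywhere mu).

(* L^2(0, tau; E): elements are represented by functions on all of [R], of which
   only the restriction to ]0, tau[ matters. [L2_size f] is the L^2(0, tau) norm
   of the scalar function t |-> ||f t||. *)
Definition L2_size (f : R -> E) : \bar R :=
  'N[mu]_(2%R%:E)[EFin \o ((rnorm \o f) \_ J)]%E.

Definition square_integrable : {pred R -> E} := fun f =>
  `[< strongly_measurable J f /\ (L2_size f < +oo)%E >].

Let mJ : measurable J. Proof. exact: measurable_itv. Qed.

Lemma L2_size_ge0 f : (0 <= L2_size f)%E. Proof. exact: Lnorm_ge0. Qed.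

Lemma L2_size_ae f g : {ae mu, forall t, J t -> f t = g t} ->
  L2_size f = L2_size g.
Proof.
move=> fg; apply/eqP; rewrite eq_le; apply/andP; split;
  apply: ae_le_Lnorm => //; apply: (@filterS _ _ (ae_filter_ringOfSetsType mu)) fg => t fgt;
  by rewrite !patchE; case: ifPn => //; rewrite inE /= => /fgt ->.
Qed.

Lemma L2_sizeE f (n : R -> R) : {ae mu, forall t, ((rnorm \o f) \_ J) t = n t} ->
  L2_size f = ('N[mu]_(2%R%:E)[EFin \o n])%E.
Proof.
move=> fn; apply/eqP; rewrite eq_le; apply/andP; split;
  by apply: ae_le_Lnorm => //; apply: (@filterS _ _ (ae_filter_ringOfSetsType mu)) fn => t ->.
Qed.

Lemma L2_sizeD f g : strongly_measurable J f -> strongly_measurable J g ->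
  (L2_size (f + g)%R <= L2_size f + L2_size g)%E.
Proof.
move=> /(strongly_measurable_rnorm mJ)[m mm fm].
move=> /(strongly_measurable_rnorm mJ)[n mn gn].
rewrite (L2_sizeE fm) (L2_sizeE gn); apply: le_trans; last first.
  by apply: eminkowski => //; rewrite lee_fin ler1n.
apply: ae_le_Lnorm => //.
apply: (@filterS2 _ _ (ae_filter_ringOfSetsType mu)) fm gn => t fmt gnt.
rewrite [X in _ <= `|X|]/= -fmt -gnt !patchE; case: ifPn => _; last by rewrite addr0.
rewrite !ger0_norm ?addr_ge0// ?rnorm_ge0//; exact: ler_rnormD.
Qed.

Lemma L2_sizeZ a f : strongly_measurable J f ->
  L2_size (a *: f) = ((complex.Re `|a|)%:E * L2_size f)%E.
Proof.
move=> /(strongly_measurable_rnorm mJ)[n mn fn].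
have a0 := Renorm_ge0 a; set b := complex.Re `|a| in a0 *.
rewrite (L2_sizeE fn) (@L2_sizeE _ (fun t => b * n t)); last first.
  apply: (@filterS _ _ (ae_filter_ringOfSetsType mu)) fn => t <-.
  rewrite !patchE; case: ifPn => _; last by rewrite mulr0.
  exact: rnormZ.
rewrite unlock /Lnorm; under eq_integral.
  move=> t _; rewrite /= normrM powRM// EFinM; over.
rewrite /= ge0_integralZl_EFin//=; last first.
  apply/measurable_EFinP; apply: (@measurableT_comp _ _ _ _ _ _ (@powR R ^~ 2)) => //.
  exact: measurableT_comp.
rewrite poweRM ?lee_fin ?powR_ge0//; last first.
  by apply: integral_ge0 => t _; rewrite lee_fin powR_ge0.
by rewrite poweR_EFin -powRrM mulfV// powRr1// ger0_norm.
Qed.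

Lemma square_integrable_submod_closed : submod_closed square_integrable.
Proof.
split.
  apply/asboolP; split; first exact: strongly_measurable0.
  rewrite (@L2_sizeE _ (fun=> 0)); first by rewrite Lnorm0.
  by apply: aeW => t; rewrite patchE/= rnorm0 if_same.
move=> a f g /asboolP[mf fy] /asboolP[mg gy]; apply/asboolP; split.
  exact: strongly_measurableP.
have maf : strongly_measurable J (a *: f).
  rewrite -[a *: f]addr0; apply: strongly_measurableP => //.
  exact: strongly_measurable0.
rewrite (le_lt_trans (L2_sizeD maf mg))// lte_add_pinfty//.
by rewrite L2_sizeZ// lte_mul_pinfty// ?lee_fin ?Renorm_ge0.
Qed.

HB.instance Definition _ := GRing.isSubmodClosed.Build _ _
  square_integrable square_integrable_submod_closed.

Record L2fun := MkL2fun {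
  L2_fun :> R -> E ;
  L2_funP : L2_fun \in square_integrable }.

HB.instance Definition _ := [isSub for L2_fun].
HB.instance Definition _ := [Choice of L2fun by <:].
HB.instance Definition _ := [SubChoice_isSubLmodule of L2fun by <:].

Definition L2_null : {pred L2fun} := fun f =>
  `[< {ae mu, forall t, J t -> f t = 0} >].

Lemma L2_null_zmod_closed : zmod_closed L2_null.
Proof.
split; first by apply/asboolP/aeW.
move=> f g /asboolP f0 /asboolP g0; apply/asboolP.
apply: (@filterS2 _ _ (ae_filter_ringOfSetsType mu)) f0 g0 => t ft gt Jt.
change (f t - g t = 0).
by rewrite ft// gt// subr0.
Qed.

HB.instance Definition _ := GRing.isZmodClosed.Build _
  L2_null L2_null_zmod_closed.

(* Classes of square integrable functions modulo equality a.e. on ]0, tau[. *)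
Definition L2 : Type := (Quotient.quot L2_null).
HB.instance Definition _ := GRing.Zmodule.on L2.
HB.instance Definition _ := EqQuotient.on L2.

Local Open Scope quotient_scope.

Lemma L2_eqP (f g : L2fun) :
  reflect {ae mu, forall t, J t -> f t = g t} (\pi_L2 f == \pi_L2 g).
Proof.
rewrite -[_ == _]/(f == g %[mod (Quotient.quot L2_null)]) -Quotient.idealrBE.
apply: (iffP idP) => [/asboolP|] fg; last apply/asboolP; move: fg;
  apply: (@filterS _ _ (ae_filter_ringOfSetsType mu)) => t fg /fg.
  by move=> /eqP; rewrite [X in X == _](_ : _ = f t - g t)// subr_eq0 => /eqP.
by move=> fgt; change (f t - g t = 0); rewrite fgt subrr.
Qed.

Lemma repr_L2 (f : L2fun) : {ae mu, forall t, J t -> repr (\pi_L2 f) t = f t}.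
Proof. by apply/L2_eqP; apply/eqP; exact: reprK. Qed.

Definition L2_scale (a : R[i]) (u : L2) : L2 := \pi_L2 (a *: repr u).

Lemma pi_L2Z a (f : L2fun) : L2_scale a (\pi_L2 f) = \pi_L2 (a *: f).
Proof.
apply/eqP/L2_eqP; apply: (@filterS _ _ (ae_filter_ringOfSetsType mu)) (repr_L2 f).
by move=> t ft Jt; change (a *: repr (\pi_L2 f) t = a *: f t); rewrite ft.
Qed.

Lemma pi_L2D (f g : L2fun) : \pi_L2 (f + g) = \pi_L2 f + \pi_L2 g.
Proof. exact: (Quotient.pi_add L2_null f g). Qed.

Lemma L2_pi (u : L2) : exists f : L2fun, u = \pi_L2 f.
Proof. by exists (repr u); rewrite reprK. Qed.

Lemma L2_scalerA a b u : L2_scale a (L2_scale b u) = L2_scale (a * b) u.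
Proof. by have [f ->] := L2_pi u; rewrite !pi_L2Z scalerA. Qed.
Lemma L2_scale1r : left_id 1 L2_scale.
Proof. by move=> u; have [f ->] := L2_pi u; rewrite pi_L2Z scale1r. Qed.
Lemma L2_scalerDr : right_distributive L2_scale +%R.
Proof.
move=> a u v; have [f ->] := L2_pi u; have [g ->] := L2_pi v.
by rewrite -pi_L2D !pi_L2Z scalerDr pi_L2D.
Qed.
Lemma L2_scalerDl u : {morph L2_scale^~ u : a b / a + b}.
Proof.
by move=> a b; have [f ->] := L2_pi u; rewrite !pi_L2Z scalerDl pi_L2D.
Qed.

HB.instance Definition _ := GRing.Zmodule_isLmodule.Build R[i] L2
  L2_scalerA L2_scale1r L2_scalerDr L2_scalerDl.

Definition L2_norm (u : L2) : R := fine (L2_size (repr u)).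

Lemma L2_size_pi (f : L2fun) : L2_size (repr (\pi_L2 f)) = L2_size f.
Proof. by apply: L2_size_ae; exact: repr_L2. Qed.

Lemma L2_funsm (f : L2fun) : strongly_measurable J f.
Proof. by have /asboolP[] := L2_funP f. Qed.

Lemma L2_size_fin_num (f : L2fun) : L2_size f \is a fin_num.
Proof. by have /asboolP[_] := L2_funP f; rewrite ge0_fin_numE// L2_size_ge0. Qed.

Lemma L2_normD (u v : L2) : (L2_norm (u + v))%:C <= (L2_norm u)%:C + (L2_norm v)%:C.
Proof.
have [f ->] := L2_pi u; have [g ->] := L2_pi v.
rewrite -rmorphD/= lecR -pi_L2D /L2_norm !L2_size_pi.
rewrite -fineD ?L2_size_fin_num// fine_le ?fin_numD ?L2_size_fin_num//.
by apply: L2_sizeD; exact: L2_funsm.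
Qed.

Lemma L2_normZ a (u : L2) : (L2_norm (a *: u))%:C = `|a| * (L2_norm u)%:C.
Proof.
have [f ->] := L2_pi u.
rewrite -[_ *: _]/(L2_scale _ _) pi_L2Z /L2_norm !L2_size_pi.
rewrite [L2_size _](_ : _ = L2_size (a *: L2_fun f)) // L2_sizeZ; last exact: L2_funsm.
by rewrite fineM ?L2_size_fin_num// rmorphM [X in X * _](Renorm a).
Qed.

Lemma L2_norm0_eq0 (u : L2) : (L2_norm u)%:C = 0 :> R[i] -> u = 0.
Proof.
move=> /(@complexI R) u0.
have z : (0 : L2) = \pi_L2 (0 : L2fun) 
  by apply: (addIr (\pi_L2 0)); rewrite add0r -pi_L2D addr0.
rewrite z; have [f uf] := L2_pi u; rewrite uf; apply/eqP/L2_eqP.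
have {u0} : L2_size f = 0%E.
  by rewrite -[LHS]fineK ?L2_size_fin_num// -L2_size_pi -uf [fine _]u0.
have [n mn un] := strongly_measurable_rnorm mJ (L2_funsm f).
rewrite (L2_sizeE un) => /Lnorm_eq0_eq0 n0.
have {}n0 : {ae mu, forall t, n t = 0}.
  have : measurable_fun setT (EFin \o n) by exact/measurable_EFinP.
  have p0 : (0 < 2%R%:E :> \bar R)%E by rewrite lte_fin.
  by move=> /n0 /(_ p0); apply: (@filterS _ _ (ae_filter_ringOfSetsType mu)) => t /(_ I) [].
apply: (@filterS2 _ _ (ae_filter_ringOfSetsType mu)) un n0 => t unt nt Jt.
by apply: rnorm0_eq0; move: unt; rewrite nt patchE mem_set.
Qed.

HB.instance Definition _ := Lmodule_isNormed.Build R[i] L2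
  L2_normD L2_normZ L2_norm0_eq0.

Lemma L2_normE (u : L2) : `|u| = (L2_norm u)%:C.
Proof. by []. Qed.

End square_integrable.

Section signals.
Context {R : realType}.
Implicit Types E : normedModType R[i].
Local Notation mu := (@lebesgue_measure R).

Definition essentially_bounded {E} (f : R -> E) : Prop :=
  exists M : R, {ae mu, forall t, rnorm (f t) <= M}.

Definition Linfty {E} (f : R -> E) : Prop :=
  strongly_measurable setT f /\ essentially_bounded f.

(* A representative of the class [u]. *)
Definition L2_val (tau : R) E (u : L2 tau E) : R -> E := L2_fun (repr u).

(* The class of [f] if [f] is square integrable on ]0, tau[, and 0 otherwise. *)
Definition toL2 (tau : R) E (f : R -> E) : L2 tau E :=
  (\pi_(L2 tau E) (insubd (0 : L2fun tau E) f))%qT.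

Definition simple_integral {E} (a b : R) (s : R -> E) : E :=
  \sum_(c \in range s) (fine (mu (`]a, b[ `&` s @^-1` [set c])))%:C *: c.

Definition is_bochner_integral {E} (a b : R) (f : R -> E) (v : E) : Prop :=
  strongly_measurable `]a, b[ f /\
  exists s : nat -> R -> E,
    [/\ forall n, simple_function (s n),
        (\int[mu]_(t in `]a, b[) (rnorm (f t - s n t))%:E)%E @[n --> \oo]
          --> 0%E &
        simple_integral a b (s n) @[n --> \oo] --> v].

(* 0 when [f] is not Bochner integrable on ]a, b[. *)
Definition bochner_integral {E} (a b : R) (f : R -> E) : E :=
  xget 0 [set v | is_bochner_integral a b f v].

Lemma strongly_measurable_ext {E} (D : set R) (f g : R -> E) :
  (forall t, D t -> f t = g t) ->
  strongly_measurable D f -> strongly_measurable D g.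
Proof.
move=> fg [s ss sf]; exists s => //.
apply: (@filterS _ _ (ae_filter_ringOfSetsType mu)) sf => t sf Dt.
by rewrite -fg//; exact: sf.
Qed.

Lemma bochner_integral_ext {E} (a b : R) (f g : R -> E) :
  (forall t, a < t < b -> f t = g t) ->
  bochner_integral a b f = bochner_integral a b g.
Proof.
move=> fg; congr (xget 0 _); apply/seteqP.
have H (h k : R -> E) : (forall t, a < t < b -> h t = k t) ->
    is_bochner_integral a b h `<=` is_bochner_integral a b k.
  move=> hk v [mh [s [ss sh sv]]]; split.
    by apply: strongly_measurable_ext mh => t; rewrite /= in_itv/= => /hk.
  exists s; split => //; apply: cvg_trans sh; apply: near_eq_cvg.
  apply: nearW => n; apply: eq_integral => t.
  by rewrite inE/= in_itv/= => /hk ->.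
by split; apply: H => // t abt; rewrite fg.
Qed.

Lemma toL2_ext (tau : R) E (f g : R -> E) : (forall t, 0 < t < tau -> f t = g t) ->
  toL2 tau f = toL2 tau g.
Proof.
move=> fg; apply/eqP/L2_eqP; apply: aeW => t /[dup] Jt.
rewrite /= in_itv/= => /fg fgt.
have fg' s : (`]0, tau[%classic : set R) s -> f s = g s.
  by rewrite /= in_itv/= => /fg.
have fgJ : (f \in square_integrable tau (E:=E)) = (g \in square_integrable tau (E:=E)).
  have fgN : L2_size tau f = L2_size tau g by apply: L2_size_ae; exact: aeW.
  apply/asboolP/asboolP; rewrite fgN => -[mf fy]; split => //.
    by apply: strongly_measurable_ext mf.
  by apply: strongly_measurable_ext mf => s /fg' ->.
rewrite /insubd; case: insubP => [u fJ uf|fJ]; case: insubP => [v gJ vg|gJ] //=.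
- move: uf vg => /= -> ->; exact: fgt.
- by move: gJ; rewrite -fgJ fJ.
- by move: fJ; rewrite fgJ gJ.
Qed.

End signals.
Coercion L2_val : L2 >-> Funclass.

Section periodic_systems.
Context {R : realType}.

(* The (in general unbounded) operators A(t) enter only through the evolution
   family [evol] that they determine. *)
Record periodic_system (tau : R)
    (X U0 Ud0 Y0 : completeNormedModType R[i]) := PeriodicSystem {
  evol : R -> R -> bop X X ;
  opB : R -> bop U0 X ;
  opBd : R -> bop Ud0 X ;
  opC : R -> bop X Y0 ;
  opD : R -> bop U0 Y0 ;
  evol_id : forall t, evol t t = idop X ;
  evol_comp : forall t r s, s <= r -> r <= t ->
    compop (evol t r) (evol r s) = evol t s ;
  evol_continuous : forall x,
    {within [set p : R * R | p.2 <= p.1],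
      continuous (fun p => evol p.1 p.2 x)} ;
  evol_periodic : forall t s, s <= t -> evol (t + tau) (s + tau) = evol t s ;
  opB_periodic : forall t, opB (t + tau) = opB t ;
  opBd_periodic : forall t, opBd (t + tau) = opBd t ;
  opC_periodic : forall t, opC (t + tau) = opC t ;
  opD_periodic : forall t, opD (t + tau) = opD t ;
  opB_Linfty : Linfty opB ;
  opBd_Linfty : Linfty opBd ;
  opC_Linfty : Linfty opC ;
  opD_Linfty : Linfty opD }.

Section one_system.
Context {tau : R} {X U0 Ud0 Y0 : completeNormedModType R[i]}.
Variable S : periodic_system tau X U0 Ud0 Y0.

Definition exponentially_stable : Prop :=
  exists M omega : R, [/\ 0 < M, 0 < omega & forall t s, s <= t ->
    rnorm (evol S t s) <= M * expR (- omega * (t - s))].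

Definition mild_state (x0 : X) (u : R -> U0) (w : R -> Ud0) (t : R) : X :=
  evol S t 0 x0 + bochner_integral 0 t
    (fun s => evol S t s (opB S s (u s) + opBd S s (w s))).

Definition output (x0 : X) (u : R -> U0) (w : R -> Ud0) (t : R) : Y0 :=
  opC S t (mild_state x0 u w t) + opD S t (u t).

(* Meaningful when 1 is in the resolvent set of [evol S tau 0]. *)
Definition periodic_green (t s : R) : bop X X :=
  compop (evol S t 0) (compop (resolvent (evol S tau 0) 1) (evol S tau s)).

Definition opP (u : L2 tau U0) : L2 tau Y0 := toL2 tau (fun t =>
  opC S t (bochner_integral 0 tau
             (fun s => periodic_green t s (opB S s (u s))))
  + opC S t (bochner_integral 0 t (fun s => evol S t s (opB S s (u s))))
  + opD S t (u t)).

Definition opPd (w : L2 tau Ud0) : L2 tau Y0 := toL2 tau (fun t =>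
  opC S t (bochner_integral 0 tau
             (fun s => periodic_green t s (opBd S s (w s))))
  + opC S t (bochner_integral 0 t (fun s => evol S t s (opBd S s (w s))))).

End one_system.

Record controller (tau : R) (U0 Y0 : normedModType R[i])
    (Z : normedModType R[i]) := Controller {
  G1 : bop Z Z ;
  G2 : bop (L2 tau Y0) Z ;
  opK : bop Z (L2 tau U0) }.

(* For t >= 0 and tau > 0: t = period_index t * tau + phase t with
   0 <= phase t < tau. *)
Definition period_index (tau t : R) : nat := `|Num.floor (t / tau)|%N.
Definition phase (tau t : R) : R := t - (period_index tau t)%:R * tau.

Definition periodic_extension (tau : R) (E : normedModType R[i])
    (w : L2 tau E) (t : R) : E := w (phase tau t).

Definition control_input (tau : R) (U0 Y0 Z : normedModType R[i])
    (c : controller tau U0 Y0 Z) (z : nat -> Z) (t : R) : U0 :=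
  L2_val (opK c (z (period_index tau t))) (phase tau t).

Section closed_loop.
Context {tau : R} {X U0 Ud0 Y0 : completeNormedModType R[i]}.
Context {Z : normedModType R[i]}.
Variables (S : periodic_system tau X U0 Ud0 Y0) (c : controller tau U0 Y0 Z).
Implicit Types (yref : L2 tau Y0) (w : L2 tau Ud0) (z : nat -> Z).

Definition closed_loop_state x0 w z : R -> X :=
  mild_state S x0 (control_input c z) (periodic_extension w).

(* y(n tau + .) - yref as an element of L^2(0, tau; Y0). *)
Definition regulation_error yref x0 w z (n : nat) : L2 tau Y0 :=
  toL2 tau (fun t => output S x0 (control_input c z) (periodic_extension w)
                       (n%:R * tau + t)) - yref.

(* The input, state and output are determined by the controller states [z], so
   a closed-loop trajectory is a sequence [z] that satisfies the controller
   equation; it exists by [closed_loop_exists]. *)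
Definition closed_loop yref w x0 (z0 : Z) z : Prop :=
  z 0%N = z0 /\
  forall n, z n.+1 = G1 c (z n) + G2 c (regulation_error yref x0 w z n).

Lemma period_indexE n t : 0 < t < tau -> period_index tau (n%:R * tau + t) = n.
Proof.
move=> /andP[t0 ttau]; have tau0 := lt_trans t0 ttau.
rewrite /period_index mulrDl mulfK ?gt_eqF//.
suff -> : Num.floor (n%:R + t / tau) = n%:Z by [].
apply: floor_def; rewrite lerDl divr_ge0 ?ltW//= intrD ltrD2l.
by rewrite ltr_pdivrMr// mul1r.
Qed.

Lemma period_index_le n t : 0 < t -> t < n.+1%:R * tau ->
  (period_index tau t <= n)%N.
Proof.
move=> t0 tn; have tau0 : 0 < tau.
  by rewrite -(pmulr_rgt0 _ (ltr0Sn R n)) (lt_trans t0 tn).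
have f0 : 0 <= Num.floor (t / tau) by rewrite floor_ge0 divr_ge0 ?ltW.
rewrite /period_index -ltnS -ltz_nat gez0_abs//.
by rewrite floor_lt_int ltr_pdivrMr.
Qed.

Lemma regulation_error_causal yref x0 w z z' n :
  (forall k, (k <= n)%N -> z k = z' k) ->
  regulation_error yref x0 w z n = regulation_error yref x0 w z' n.
Proof.
move=> zz'; congr (_ - _); apply: toL2_ext => t tin.
have uu' s : 0 < s -> s < n.+1%:R * tau ->
    control_input c z s = control_input c z' s.
  by move=> s0 sn; rewrite /control_input zz'// period_index_le.
have /andP[t0 ttau] := tin.
have tpos : 0 < n%:R * tau + t.
  by rewrite ltr_wpDl// mulr_ge0// ltW// (lt_trans t0).
have tlt : n%:R * tau + t < n.+1%:R * tau.
  by rewrite -natr1 mulrDl mul1r ltrD2l.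
have ut := uu' _ tpos tlt.
set t' := n%:R * tau + t in tpos tlt ut *.
have xt : mild_state S x0 (control_input c z) (periodic_extension w) t' =
    mild_state S x0 (control_input c z') (periodic_extension w) t'.
  apply: (f_equal (fun v => evol S t' 0 x0 + v)).
  apply: bochner_integral_ext => s /andP[s0 st].
  by rewrite (uu' s s0 (lt_trans st tlt)).
by rewrite /output xt ut.
Qed.

Lemma closed_loop_exists yref w x0 (z0 : Z) : exists z, closed_loop yref w x0 z0 z.
Proof.
pose step n z k := if (k <= n)%N then z k
  else G1 c (z n) + G2 c (regulation_error yref x0 w z n).
pose h := fix h n := if n is m.+1 then step m (h m) else fun=> z0.
have hS n m k : (k <= n)%N -> (n <= m)%N -> h m k = h n k.
  move=> kn; elim: m => [|m IH]; first by rewrite leqn0 => /eqP ->.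
  rewrite leq_eqVlt ltnS => /predU1P[->//|nm] /=.
  by rewrite /step (leq_trans kn nm) IH.
exists (fun n => h n n); split => // n.
rewrite [LHS]/= /step ltnn; congr (_ + G2 c _).
by apply: regulation_error_causal => k kn; rewrite (hS k n).
Qed.

Definition closed_loop_exponentially_stable : Prop :=
  exists M0 M1 alpha0 alpha1 : R,
    [/\ 0 < M0, 0 < M1, 0 < alpha0, 0 < alpha1 &
    forall (x0 : X) (z0 : Z) z, closed_loop 0 0 x0 z0 z ->
      (forall t, 0 <= t -> rnorm (closed_loop_state x0 0 z t) <=
         M0 * expR (- alpha0 * t) * (rnorm x0 + rnorm z0)) /\
      (forall n : nat, rnorm (z n) <=
         M1 * expR (- alpha1 * n%:R) * (rnorm x0 + rnorm z0))].

Definition approximately_regulates (YN : vsubspace (L2 tau Y0))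
    (QN : bop (L2 tau Y0) (vsub YN)) : Prop :=
  forall yref w, exists zinf : Z,
    unique (fun v => QN (opP S (opK c v)) = QN yref - QN (opPd S w)) zinf /\
    forall (x0 : X) (z0 : Z) z, closed_loop yref w x0 z0 z ->
      let e := opP S (opK c zinf) + opPd S w - yref in
      rnorm (regulation_error yref x0 w z n) @[n --> \oo]
        --> rnorm (e - vsub_val (QN e)).

End closed_loop.
End periodic_systems.

(* Main.v *)
From HB Require Import structures.
Require Import Defs.
From mathcomp Require Import all_boot all_order all_algebra.
From mathcomp Require Import complex spectral finmap.
From mathcomp Require Import all_classical all_reals all_analysis.
From mathcomp Require Import measurable_realfun.
From mathcomp Require Import ring lra.

(** The closed loop is observed at the times n tau. By linearity and periodicity
the sampled state x_n and the regulation error e_n over the n-th period satisfy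
   x_{n+1} = T x_n + Phi K z_n + Phi_d w,   e_n = F x_n + Theta K z_n + Theta_d w - yref,
with T = U_A(tau, 0); the right-hand sides are [period_state] and
[period_output], and [closed_loop_stateS] and [regulation_errorE] are these two
equations. If 1 is in the resolvent set of T, then an input (u, w) that is
repeated in every period has the stationary sampled state
(I - T)^-1 (Phi u + Phi_d w), and the output in this stationary regime is P u + P_d w ([period_output_periodic_state]): the Green
function in the definition of P is this resolvent, written as a kernel.

Regulation ([regulation_of_stability]). As G_1 = I, the controller rests exactly
when Q_N e = 0, so an equilibrium of the closed loop is a solution z of
Q_N P K z = Q_N yref - Q_N P_d w. Such a z exists and is unique because
G_20 Q_N P K is an injective square matrix: a vector v in its kernel gives a
stationary trajectory of the closed loop without external signals, and stability
forces v = 0 ([gain_injective]). Subtracting the equilibrium from an arbitrary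
trajectory leaves a trajectory without external signals, which decays; hence the
error tends to the error e of the equilibrium, and e = (I - Q_N) e. This argument
uses the system only through the stability of the closed loop and the condition
on T, so it serves for the nominal and for the perturbed parameters.

Stability for small epsilon ([small_gain_stability]). Put
H = (I - T)^-1 Phi K_0, N = G_2 P K_0, G = G_2 F. In the variable
xi = x - epsilon H z, which measures the distance of the state from the
stationary state that belongs to the present controller state, the loop is
   xi_{n+1} = (T - epsilon H G) xi_n - epsilon^2 H N z_n,
   z_{n+1} = (I + epsilon N) z_n + G xi_n.
The powers of T decay, so T is a strict contraction in an equivalent norm
([adapted_seminorm]). The matrix N is Hurwitz, so a Schur triangularization gives
a norm in which |I + epsilon N| <= 1 - d epsilon ([hurwitz_seminorm]). The
perturbation fed back into xi has size epsilon^2, the decay of z has size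
epsilon, so a weighted sum of the two norms decays for small epsilon
([coupled_decay]). Between the sampling times the state is controlled by the
uniform bound on U_A(t, s) over one period.

The sampled equations rest on the Bochner integral: existence for strongly
measurable functions of finite L1 size, linearity, bounded operators, splitting
of intervals and translation. The integrands U_A(t, s) v(s) and the state are
strongly measurable because U_A is strongly continuous
([strongly_measurable_right_continuous]), and U_A(t, s) is bounded uniformly on
compact triangles by the uniform boundedness principle, proved here by a gliding
hump. *)

Set Implicit Arguments.
Unset Strict Implicit.
Unset Printing Implicit Defensive.
Import Order.TTheory GRing.Theory Num.Theory.
Import numFieldNormedType.Exports.
Local Open Scope classical_set_scope.
Local Open Scope ring_scope.
Local Open Scope complex_scope.

(** * The real-valued norm *)

Section real_valued_norm.
Context {R : realType}.
Implicit Types E F : normedModType R[i].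

Lemma rnormN E (x : E) : rnorm (- x) = rnorm x.
Proof. by rewrite /rnorm normrN. Qed.

Lemma rnorm_distC E (x y : E) : rnorm (x - y) = rnorm (y - x).
Proof. by rewrite /rnorm distrC. Qed.

Lemma ler_rnormB E (x y : E) : rnorm (x - y) <= rnorm x + rnorm y.
Proof. by rewrite -(rnormN y) ler_rnormD. Qed.

Lemma ler_rnorm_distD E (y x z : E) : rnorm (x - z) <= rnorm (x - y) + rnorm (y - z).
Proof. by apply: le_trans (ler_rnormD _ _); rewrite addrA subrK. Qed.

Lemma ler_rnorm_dist E (y x : E) : rnorm x <= rnorm (x - y) + rnorm y.
Proof. by apply: le_trans (ler_rnormD _ _); rewrite subrK. Qed.

Lemma ler_rnorm_sum E (I : Type) (s : seq I) (P : pred I) (F : I -> E) :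
  rnorm (\sum_(i <- s | P i) F i) <= \sum_(i <- s | P i) rnorm (F i).
Proof.
elim/big_ind2 : _ => //; first by rewrite rnorm0.
move=> x a y b xa yb; exact: le_trans (ler_rnormD _ _) (lerD xa yb).
Qed.

Lemma rnormZr E (a : R) (x : E) : rnorm (a%:C *: x) = `|a| * rnorm x.
Proof.
by rewrite rnormZ; congr (_ * _); rewrite normc_def/= expr0n/= addr0 sqrtr_sqr.
Qed.

Lemma rnorm_eq0 E (x : E) : (rnorm x == 0) = (x == 0).
Proof.
apply/eqP/eqP => [|->]; last exact: rnorm0.
exact: rnorm0_eq0.
Qed.

Lemma rnorm_cvgP E (u : nat -> E) (l : E) :
  (u n @[n --> \oo] --> l) <-> (rnorm (u n - l) @[n --> \oo] --> (0 : R)).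
Proof.
split=> [ul|/cvgrPdist_lt ul].
  rewrite -(@rnorm0 _ E) -(subrr l); apply: rnorm_cvg; apply: cvgB => //; exact: cvg_cst.
apply/cvgrPdist_lt => e e0.
have er : e = (complex.Re e)%:C.
  by rewrite RRe_real// ger0_real// ltW.
have e0' : 0 < complex.Re e by rewrite -ltcR -er.
apply: filterS (ul _ e0') => n.
rewrite sub0r normrN ger0_norm ?rnorm_ge0// => h.
by rewrite distrC rnormE er ltcR.
Qed.

Lemma rnorm_cvg_squeeze E (e : nat -> R) (u : nat -> E) (l : E) :
  (forall n, rnorm (u n - l) <= e n) -> e n @[n --> \oo] --> 0 ->
  u n @[n --> \oo] --> l.
Proof.
move=> ue e0; apply/rnorm_cvgP.
apply: (@squeeze_cvgr _ _ _ _ (fun=> 0) e) => //; last exact: cvg_cst.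
by apply: nearW => n; rewrite rnorm_ge0 ue.
Qed.

Lemma cvg0_rnorm E (u : nat -> E) :
  u n @[n --> \oo] --> 0 <-> rnorm (u n) @[n --> \oo] --> 0.
Proof.
have -> : (fun n => rnorm (u n)) = (fun n => rnorm (u n - 0)).
  by apply/funext => n; rewrite subr0.
exact: rnorm_cvgP.
Qed.

Lemma rnorm_cvg_unique E (u : nat -> E) (l l' : E) :
  u n @[n --> \oo] --> l -> u n @[n --> \oo] --> l' -> l = l'.
Proof. by move=> h h'; exact: (cvg_unique _ h h'). Qed.

Lemma cvg_rnorm_le E (u : nat -> E) (l : E) (M : R) :
  u n @[n --> \oo] --> l -> (forall n, rnorm (u n) <= M) -> rnorm l <= M.
Proof.
move=> /rnorm_cvg ul uM; rewrite -(cvg_lim _ ul)//.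
by apply: limr_le; [apply: cvgP ul|exact: nearW].
Qed.

Lemma rnorm_complete (E : completeNormedModType R[i]) (u : nat -> E) :
  (forall e : R, 0 < e -> exists N, forall n, (N <= n)%N -> rnorm (u n - u N) < e) ->
  exists l : E, u n @[n --> \oo] --> l.
Proof.
move=> cu; suff /cvg_ex : cvg (u n @[n --> \oo]) by [].
apply/cauchy_cvgP/cauchy_exP => eps eps0.
have er : eps = (complex.Re eps)%:C.
  by rewrite RRe_real// ger0_real// ltW.
have eps0' : 0 < complex.Re eps by rewrite -ltcR -er.
have [N HN] := cu _ eps0'.
exists (u N), N => // n /= Nn.
by rewrite -ball_normE /ball_/= distrC rnormE er ltcR HN.
Qed.

Lemma rnorm_cvg_squeezee E (e : nat -> \bar R) (u : nat -> E) (l : E) :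
  (forall n, ((rnorm (u n - l))%:E <= e n)%E) -> e n @[n --> \oo] --> 0%E ->
  u n @[n --> \oo] --> l.
Proof.
move=> ue e0; apply/rnorm_cvgP.
have : (rnorm (u n - l))%:E @[n --> \oo] --> 0%:E.
  apply: (@squeeze_cvge _ _ _ _ (fun=> 0%E) _ e) => //; last exact: cvg_cst.
  by apply: nearW => n; rewrite lee_fin rnorm_ge0 ue.
by move=> /fine_cvgP[_].
Qed.

Lemma cvg_seq_ext (T : topologicalType) (u v : nat -> T) (l : T) :
  (forall n, u n = v n) -> u n @[n --> \oo] --> l -> v n @[n --> \oo] --> l.
Proof. by move=> /funext ->. Qed.

Lemma bop0 E F (T : bop E F) : T 0 = 0. Proof. exact: linear0. Qed.
Lemma bopD E F (T : bop E F) x y : T (x + y) = T x + T y. Proof. exact: linearD. Qed.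
Lemma bopB E F (T : bop E F) x y : T (x - y) = T x - T y. Proof. exact: linearB. Qed.
Lemma bopZ E F (T : bop E F) a x : T (a *: x) = a *: T x.
Proof. by rewrite linearZ. Qed.
Lemma bopP1 E F (T : bop E F) a x y : T (a *: x + y) = a *: T x + T y.
Proof. exact: linearP. Qed.

(** A convergent sequence x n is bounded, so the convergence of T n in operator
norm gives T n (x n) - S (x n) --> 0. *)
Lemma bop_rnorm_cvg E F (T : nat -> bop E F) (S : bop E F) (x : nat -> E) y :
  T n @[n --> \oo] --> S -> x n @[n --> \oo] --> y ->
  T n (x n) @[n --> \oo] --> S y.
Proof.
move=> TS xy; have [M xM] : exists M, forall n, rnorm (x n) <= M.
  have /cvg_seq_bounded [M [_ HM]] : cvg (rnorm (x n) @[n --> \oo]).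
    by apply: cvgP; exact: rnorm_cvg xy.
  exists (M + 1) => n.
  by apply: le_trans (HM (M + 1) _ n I); rewrite ?ltrDl//= ler_norm.
apply: (@rnorm_cvg_squeeze _ (fun n => rnorm (T n - S) * M + opnorm S * rnorm (x n - y))).
  move=> n; apply: le_trans (ler_rnorm_distD (S (x n)) _ _) _; apply: lerD.
    apply: le_trans (ler_opnorm (T n - S) (x n)) _.
    by rewrite ler_wpM2l// opnorm_ge0.
  by rewrite -linearB ler_opnorm.
rewrite -[0 in X in _ --> X]addr0; apply: cvgD.
  rewrite -[0 in X in _ --> X](mul0r M); apply: cvgM; last exact: cvg_cst.
  exact/rnorm_cvgP.
rewrite -[0 in X in _ --> X](mulr0 (opnorm S)); apply: cvgM; first exact: cvg_cst.
exact/rnorm_cvgP.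
Qed.

Lemma bop_cvg E F (S : bop E F) (x : nat -> E) y :
  x n @[n --> \oo] --> y -> S (x n) @[n --> \oo] --> S y.
Proof. by apply: bop_rnorm_cvg; exact: cvg_cst. Qed.

End real_valued_norm.

(** * Almost everywhere statements and translations *)

Section almost_everywhere_lebesgue.
Context {R : realType}.
Local Notation mu := (@lebesgue_measure R).

Lemma ae_imply (P Q : R -> Prop) : (forall t, P t -> Q t) ->
  {ae mu, forall t, P t} -> {ae mu, forall t, Q t}.
Proof. by move=> PQ; apply: (@filterS _ _ (ae_filter_ringOfSetsType mu)). Qed.

Lemma ae_imply2 (P1 P2 Q : R -> Prop) : (forall t, P1 t -> P2 t -> Q t) ->
  {ae mu, forall t, P1 t} -> {ae mu, forall t, P2 t} -> {ae mu, forall t, Q t}.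
Proof. by move=> PQ; apply: (@filterS2 _ _ (ae_filter_ringOfSetsType mu)). Qed.

Lemma ae_forall_nat (P : nat -> R -> Prop) :
  (forall n, {ae mu, forall t, P n t}) -> {ae mu, forall t, forall n, P n t}.
Proof.
move=> /negligible_bigcup; apply: negligibleS => t /existsNP[n Pn].
by exists n.
Qed.

Lemma measurable_shift (a : R) : measurable_fun setT (fun t : R => a + t).
Proof. exact: measurable_funD. Qed.

(** The image of the measure under a translation agrees with the measure on the
half-open intervals, and these determine it. *)
Lemma lebesgue_measure_shift (a : R) (A : set R) : measurable A ->
  mu ((fun t => a + t) @^-1` A) = mu A.
Proof.
move=> mA; rewrite -[LHS]/(pushforward mu (fun t : R => (a + t : measurableTypeR R)) A).
apply/esym; apply: (lebesgue_measure_unique _ mA) => [|ms _ [[b c] /= _ <-]].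
  exact: measurable_shift.
rewrite /pushforward; have -> : (fun t => a + t) @^-1` `]b, c] = `]b - a, c - a]%classic.
  by apply/seteqP; split => t /=; rewrite !in_itv/= ltrBlDl lerBrDl.
rewrite !lebesgue_measure_itv/= !lte_fin ltrD2r; case: ifP => // _.
by congr (_%:E); rewrite opprB addrA subrK.
Qed.

Lemma ae_shift (a : R) (P : R -> Prop) :
  {ae mu, forall t, P t} -> {ae mu, forall t, P (a + t)}.
Proof.
move=> [N [mN N0 PN]]; exists ((fun t => a + t) @^-1` N); split.
- by rewrite -[X in measurable X]setTI; exact: measurable_shift.
- by rewrite lebesgue_measure_shift.
- by move=> t /= Pt; exact: PN.
Qed.

Lemma ae_neq (a : R) : {ae mu, forall t, t != a}.
Proof.
exists [set a]; split; [exact: measurable_set1|exact: lebesgue_measure_set1|].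
by move=> t /= /negP; rewrite negbK => /eqP.
Qed.

Lemma ge0_integral_shift (a : R) (f : R -> \bar R) :
  measurable_fun setT f -> (forall t, 0 <= f t)%E ->
  (\int[mu]_t f (a + t)%R = \int[mu]_t f t)%E.
Proof.
move=> mf f0.
have ms : measurable_fun setT (fun t : measurableTypeR R => (a + t : measurableTypeR R)).
  exact: measurable_shift.
transitivity (\int[pushforward mu (fun t : measurableTypeR R => (a + t)%R : measurableTypeR R)]_t f t)%E.
  by rewrite ge0_integral_pushforward.
by apply: eq_measure_integral => A mA _; exact: lebesgue_measure_shift.
Qed.

End almost_everywhere_lebesgue.

(** * Maps with finitely many values *)

Section simple_maps.
Context {R : realType}.

(** Values in an arbitrary type: simple functions into different spaces, cell
indices and truth values are paired first and turned into vectors afterwards. *)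
Definition simple_map {A : Type} (s : R -> A) : Prop :=
  finite_set (range s) /\ forall c, measurable (s @^-1` [set c]).

Lemma simple_map_cst (A : Type) (c : A) : simple_map (fun=> c).
Proof.
split; last by move=> d; rewrite preimage_cst; case: ifP.
by apply: (@sub_finite_set _ _ [set c]) => [_ [_ _ <-]|].
Qed.

Lemma simple_map_preimage (A : Type) (s : R -> A) (B : set A) :
  simple_map s -> measurable (s @^-1` B).
Proof.
move=> [fs ms].
have -> : s @^-1` B = \bigcup_(c in range s `&` B) (s @^-1` [set c]).
  apply/seteqP; split=> [t At|t [c [_ Ac]] /= ->//].
  by exists (s t) => //; split => //; exists t.
by apply: fin_bigcup_measurable => //; exact: finite_setIl.
Qed.

Lemma simple_map_comp (A B : Type) (s : R -> A) (h : A -> B) :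
  simple_map s -> simple_map (h \o s).
Proof.
move=> ss; split; last first.
  by move=> c; rewrite comp_preimage; exact: simple_map_preimage.
rewrite -(image_comp s h); apply: finite_image; exact: ss.1.
Qed.

Lemma simple_map_pair (A B : Type) (s : R -> A) (t : R -> B) :
  simple_map s -> simple_map t -> simple_map (fun x => (s x, t x)).
Proof.
move=> [fs ms] [ft mt]; split.
  apply: (@sub_finite_set _ _ (range s `*` range t)); last exact: finite_setX.
  by move=> _ [x _ <-]; split => /=; exists x.
move=> [a b]; rewrite (_ : _ @^-1` _ = s @^-1` [set a] `&` t @^-1` [set b]).
  exact: measurableI.
by apply/seteqP; split=> x /= => [[-> ->]|[-> ->]].
Qed.

Lemma simple_map_indicator (D : set R) : measurable D ->
  simple_map (fun t => `[< D t >]).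
Proof.
move=> mD; split; first exact: finite_finset.
move=> [|].
  by rewrite (_ : _ @^-1` _ = D)//; apply/seteqP; split=> t /= => [/asboolP|/asboolP].
rewrite (_ : _ @^-1` _ = ~` D); first exact: measurableC.
by apply/seteqP; split=> t /= => [/asboolPn|/asboolPn/negbTE].
Qed.

Lemma simple_map_shift (A : Type) (a : R) (s : R -> A) :
  simple_map s -> simple_map (fun t => s (a + t)).
Proof.
move=> [fs ms]; split.
  by apply: sub_finite_set fs => _ [t _ <-]; exists (a + t).
move=> c; rewrite (_ : _ @^-1` _ = (fun t => a + t) @^-1` (s @^-1` [set c]))//.
by rewrite -[X in measurable X]setTI; exact: measurable_shift.
Qed.

(** The index k.+1 stands for the cell [k / n.+1, (k+1) / n.+1[; the index 0
collects the points outside ]0, b[. *)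
Definition grid_index (b : R) (n : nat) (t : R) : nat :=
  if 0 < t < b then (Num.truncn (t * n.+1%:R)).+1 else 0%N.

(** The right end point of a cell, cut at b. Right end points are strictly
larger than the points of the cell, so only continuity from the right is needed
where the grid is used. *)
Definition grid_point (b : R) (n k : nat) : R :=
  if k is 0%N then b else Num.min b (k%:R / n.+1%:R).

Definition grid (b : R) (n : nat) (t : R) : R := grid_point b n (grid_index b n t).

Lemma simple_map_grid_index b n : simple_map (grid_index b n).
Proof.
split.
  apply: (@sub_finite_set _ _ `I_(Num.truncn (b * n.+1%:R)).+2); last exact: finite_II.
  move=> _ [t _ <-]; rewrite /grid_index /=; case: ifP => // /andP[t0 tb].
  rewrite !ltnS le_truncn// ler_pM2r ?ltr0n// ltW//.
move=> [|m].
  rewrite (_ : _ @^-1` _ = ~` `]0, b[); first by apply: measurableC; exact: measurable_itv.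
  apply/seteqP; split=> t /=; rewrite /grid_index in_itv/=; first by case: ifP.
  by move=> /negP/negbTE ->.
rewrite (_ : _ @^-1` _ = `]0, b[ `&` `[m%:R / n.+1%:R, m.+1%:R / n.+1%:R[).
  by apply: measurableI; exact: measurable_itv.
apply/seteqP; split=> t /=; rewrite /grid_index !in_itv/= ler_pdivrMr ?ltr0n// ltr_pdivlMr ?ltr0n//.
  case: ifPn => // /andP[t0 tb] [<-]; split=> //.
  by rewrite truncn_itv// mulr_ge0// ltW.
move=> [/[dup] tb -> h]; congr _.+1; apply/truncn_def; exact: h.
Qed.

Lemma grid_gt b n t : 0 < t < b -> t < grid b n t.
Proof.
move=> /[dup] tb /andP[t0 tb']; rewrite /grid /grid_index tb /grid_point lt_min tb'/=.
by rewrite ltr_pdivlMr ?ltr0n// truncnS_gt.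
Qed.

Lemma grid_le b n t : grid b n t <= b.
Proof. by rewrite /grid /grid_point; case: grid_index => // k; rewrite ge_min lexx. Qed.

Lemma grid_cvg b t : 0 < t < b -> grid b n t @[n --> \oo] --> t.
Proof.
move=> tb; have t0 : 0 < t by case/andP: tb.
apply: (@squeeze_cvgr _ _ _ _ (fun=> t) (fun n => t + n.+1%:R^-1)).
- apply: nearW => n; rewrite ltW ?grid_gt//= /grid /grid_index tb /grid_point ge_min.
  apply/orP; right; rewrite ler_pdivrMr ?ltr0n// mulrDl mulVf ?pnatr_eq0//.
  by rewrite -natr1 lerD2r truncn_le mulr_ge0// ltW.
- exact: cvg_cst.
- rewrite -[X in _ --> X]addr0; apply: cvgD; first exact: cvg_cst.
  exact: cvg_harmonic.
Qed.

End simple_maps.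

(** * Strong measurability *)

Section strong_measurability_closure.
Context {R : realType}.
Implicit Types (D : set R).
Local Notation mu := (@lebesgue_measure R).

(** It suffices to approximate by functions of finitely many simple data; h n may
combine a simple function with the index of a grid cell. *)
Lemma strongly_measurable_lim (E : normedModType R[i]) (A : Type) D (f : R -> E)
    (s : nat -> R -> A) (h : nat -> A -> E) :
  (forall n, simple_map (s n)) ->
  {ae mu, forall t, D t -> h n (s n t) @[n --> \oo] --> f t} ->
  strongly_measurable D f.
Proof.
move=> ss sf; exists (fun n => h n \o s n) => // n.
exact: simple_map_comp.
Qed.

Lemma strongly_measurable_ae (E : normedModType R[i]) D (f g : R -> E) :
  {ae mu, forall t, D t -> f t = g t} ->
  strongly_measurable D f -> strongly_measurable D g.
Proof.
move=> fg [s ss sf]; exists s => //.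
by apply: ae_imply2 sf fg => t sf fg Dt; rewrite -fg//; exact: sf.
Qed.

Lemma strongly_measurable_sub (E : normedModType R[i]) D D' (f : R -> E) :
  {ae mu, forall t, D' t -> D t} ->
  strongly_measurable D f -> strongly_measurable D' f.
Proof.
move=> D'D [s ss sf]; exists s => //.
by apply: ae_imply2 sf D'D => t sf D'D /D'D.
Qed.

Lemma strongly_measurable_cst (E : normedModType R[i]) D (c : E) :
  strongly_measurable D (fun=> c).
Proof.
exists (fun n t => c); first by move=> n; exact: simple_function_cst.
by apply: aeW => t _; exact: cvg_cst.
Qed.

Lemma strongly_measurableD (E : normedModType R[i]) D (f g : R -> E) :
  strongly_measurable D f -> strongly_measurable D g ->
  strongly_measurable D (fun t => f t + g t).
Proof.
move=> mf mg; have := strongly_measurableP 1 mf mg.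
by apply: strongly_measurable_ext => t _ /=; rewrite -[RHS]/(f t + g t) -[in RHS](scale1r (f t)).
Qed.

Lemma strongly_measurableZ (E : normedModType R[i]) D a (f : R -> E) :
  strongly_measurable D f -> strongly_measurable D (fun t => a *: f t).
Proof.
move=> mf; have := strongly_measurableP a mf (@strongly_measurable0 R E D).
by apply: strongly_measurable_ext => t _; rewrite -[LHS]/(a *: f t + 0) addr0.
Qed.

Lemma strongly_measurable_bop (E F : normedModType R[i]) D
    (T : R -> bop E F) (f : R -> E) :
  strongly_measurable D T -> strongly_measurable D f ->
  strongly_measurable D (fun t => T t (f t)).
Proof.
move=> [S sS ST] [s ss sf].
apply: (@strongly_measurable_lim _ _ _ _ (fun n t => (S n t, s n t))
  (fun _ p => p.1 p.2)).
  by move=> n; exact: (simple_map_pair (sS n) (ss n)).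
apply: ae_imply2 ST sf => t ST sf Dt /=.
by apply: bop_rnorm_cvg; [exact: ST|exact: sf].
Qed.

(** The grid points to the right of t converge to t, and f is a limit of simple
functions, so H (grid point) (simple value) is a simple approximation of
H t (f t). Continuity of H is asked along sequences in both arguments at
once, which U_A satisfies although it is continuous in the strong topology
only. *)
Lemma strongly_measurable_right_continuous (A E : normedModType R[i]) (b : R)
    (H : R -> A -> E) (f : R -> A) :
  strongly_measurable `]0, b[ f ->
  (forall t (u : nat -> R) (x : nat -> A), 0 < t < b -> (forall n, t < u n <= b) ->
    u n @[n --> \oo] --> t -> x n @[n --> \oo] --> f t ->
    H (u n) (x n) @[n --> \oo] --> H t (f t)) ->
  strongly_measurable `]0, b[ (fun t => H t (f t)).
Proof.
move=> [s ss sf] Hc.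
apply: (@strongly_measurable_lim _ _ _ _ (fun n t => (grid_index b n t, s n t))
  (fun n p => H (grid_point b n p.1) p.2)).
  by move=> n; exact: (simple_map_pair (simple_map_grid_index b n) (ss n)).
apply: ae_imply sf => t sf /[dup] Dt; rewrite /= in_itv/= => tb.
apply: Hc => //; last exact: sf.
  by move=> n; rewrite grid_gt ?grid_le.
exact: grid_cvg.
Qed.

Lemma strongly_measurable_shift (E : normedModType R[i]) (a : R) D (f : R -> E) :
  strongly_measurable D f ->
  strongly_measurable (fun t => D (a + t)) (fun t => f (a + t)).
Proof.
move=> [s ss sf]; exists (fun n t => s n (a + t)).
  by move=> n; exact: (simple_map_shift a (ss n)).
exact: (ae_shift a sf).
Qed.

Lemma strongly_measurableU (E : normedModType R[i]) D D' (f : R -> E) :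
  measurable D -> strongly_measurable D f -> strongly_measurable D' f ->
  strongly_measurable (D `|` D') f.
Proof.
move=> mD [s ss sf] [s' ss' sf'].
apply: (@strongly_measurable_lim _ _ _ _ (fun n t => (`[< D t >], (s n t, s' n t)))
  (fun _ p => if p.1 then p.2.1 else p.2.2)).
  move=> n; apply: (simple_map_pair (simple_map_indicator mD)).
  exact: (simple_map_pair (ss n) (ss' n)).
apply: ae_imply2 sf sf' => t sf sf' DD'; case: asboolP => Dt /=; first exact: sf.
by case: DD' => // D't; exact: sf'.
Qed.

End strong_measurability_closure.

(** * The integral of the norm *)

Section norm_integral.
Context {R : realType}.
Implicit Types (D : set R) (E F G : normedModType R[i]).
Local Notation mu := (@lebesgue_measure R).

(** Also meaningful when f is not measurable; the strong measurability of f
makes the norm measurable only up to a null set. *)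
Definition L1size {E} D (f : R -> E) : \bar R := (\int[mu]_(t in D) (rnorm (f t))%:E)%E.

Lemma L1size_ge0 E D (f : R -> E) : (0 <= L1size D f)%E.
Proof. by apply: integral_ge0 => t _; rewrite lee_fin rnorm_ge0. Qed.

Lemma L1size_le_integral E D (f : R -> E) (g : R -> \bar R) :
  (forall t, 0 <= g t)%E ->
  {ae mu, forall t, D t -> ((rnorm (f t))%:E <= g t)%E} ->
  (L1size D f <= \int[mu]_t g t)%E.
Proof.
move=> g0 fg; rewrite /L1size integral_mkcond; apply: ge0_ae_le_integralT => // [t|].
  by rewrite patchE; case: ifP => // _; rewrite lee_fin rnorm_ge0.
by apply: ae_imply fg => t fg; rewrite patchE; case: ifPn => //; rewrite inE.
Qed.

Lemma L1sizeE E D (f : R -> E) (n : R -> R) : (forall t, 0 <= n t) ->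
  {ae mu, forall t, ((rnorm \o f) \_ D) t = n t} ->
  L1size D f = (\int[mu]_t (n t)%:E)%E.
Proof.
move=> n0 fn; rewrite /L1size integral_mkcond.
have pE t : (((fun t => (rnorm (f t))%:E) \_ D) t = (((rnorm \o f) \_ D) t)%:E)%E.
  by rewrite !patchE; case: ifP.
apply/eqP; rewrite eq_le; apply/andP; split; apply: ge0_ae_le_integralT => //.
- by move=> t; rewrite pE lee_fin patchE; case: ifP => // _; exact: rnorm_ge0.
- by apply: ae_imply fn => t fn; rewrite pE fn.
- by move=> t; rewrite pE lee_fin patchE; case: ifP => // _; exact: rnorm_ge0.
- by apply: ae_imply fn => t fn; rewrite pE fn.
Qed.

(** The measurable nonnegative representative of the norm, through which the
theorems on Lebesgue integrals become applicable to [L1size]. *)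
Lemma strongly_measurable_rnorm_ge0 E D (f : R -> E) : measurable D ->
  strongly_measurable D f -> exists n : R -> R,
    [/\ measurable_fun setT n, (forall t, 0 <= n t),
     {ae mu, forall t, ((rnorm \o f) \_ D) t = n t} &
     L1size D f = (\int[mu]_t (n t)%:E)%E].
Proof.
move=> mD mf; have [n mn fn] := strongly_measurable_rnorm mD mf.
have fn' : {ae mu, forall t, ((rnorm \o f) \_ D) t = `|n t|}.
  apply: ae_imply fn => t fn; rewrite -fn patchE.
  by case: ifP; rewrite ?normr0// ger0_norm// rnorm_ge0.
exists (fun t => `|n t|); split => //.
- exact: measurableT_comp.
- exact: L1sizeE.
Qed.

Lemma L1size_le E F D (f : R -> E) (g : R -> F) :
  {ae mu, forall t, D t -> rnorm (f t) <= rnorm (g t)} ->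
  (L1size D f <= L1size D g)%E.
Proof.
move=> fg; rewrite /L1size integral_mkcond [leRHS]integral_mkcond.
apply: ge0_ae_le_integralT => [t|t|].
- by rewrite patchE; case: ifP => // _; rewrite lee_fin rnorm_ge0.
- by rewrite patchE; case: ifP => // _; rewrite lee_fin rnorm_ge0.
- apply: ae_imply fg => t fg; rewrite !patchE; case: ifPn => //.
  by rewrite inE lee_fin => /fg.
Qed.

Lemma L1size_ae E D (f g : R -> E) :
  {ae mu, forall t, D t -> f t = g t} -> L1size D f = L1size D g.
Proof.
move=> fg; apply/eqP; rewrite eq_le; apply/andP; split; apply: L1size_le;
  by apply: ae_imply fg => t fg /fg ->.
Qed.

Lemma L1size_subset E D D' (f : R -> E) :
  {ae mu, forall t, D t -> D' t} -> (L1size D f <= L1size D' f)%E.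
Proof.
move=> DD'; rewrite /L1size integral_mkcond [leRHS]integral_mkcond.
apply: ge0_ae_le_integralT => [t|t|].
- by rewrite patchE; case: ifP => // _; rewrite lee_fin rnorm_ge0.
- by rewrite patchE; case: ifP => // _; rewrite lee_fin rnorm_ge0.
- apply: ae_imply DD' => t DD'; rewrite !patchE; case: ifPn.
    by rewrite inE => /DD' D't; rewrite mem_set.
  by move=> _; case: ifP => // _; rewrite lee_fin rnorm_ge0.
Qed.

Lemma L1size_leD E F G D (f : R -> E) (g : R -> F) (h : R -> G) : measurable D ->
  strongly_measurable D g -> strongly_measurable D h ->
  {ae mu, forall t, D t -> rnorm (f t) <= rnorm (g t) + rnorm (h t)} ->
  (L1size D f <= L1size D g + L1size D h)%E.
Proof.
move=> mD /(strongly_measurable_rnorm_ge0 mD)[m [mm m0 gm ->]].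
move=> /(strongly_measurable_rnorm_ge0 mD)[n [mn n0 hn ->]] fgh.
rewrite -ge0_integralD//; last 4 first.
- by move=> t _; rewrite lee_fin.
- exact/measurable_EFinP.
- by move=> t _; rewrite lee_fin.
- exact/measurable_EFinP.
apply: L1size_le_integral => [t|]; first by rewrite adde_ge0// lee_fin.
apply: (ae_imply2 _ (ae_imply2 (fun t x y => conj x y) gm hn) fgh) => t [{}gm {}hn] {}fgh.
move=> Dt; rewrite -EFinD lee_fin -gm -hn !patchE mem_set//=; exact: fgh.
Qed.

Lemma L1size_leZ E F D (f : R -> E) (g : R -> F) (c : R) : measurable D ->
  strongly_measurable D g -> 0 <= c ->
  {ae mu, forall t, D t -> rnorm (f t) <= c * rnorm (g t)} ->
  (L1size D f <= c%:E * L1size D g)%E.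
Proof.
move=> mD /(strongly_measurable_rnorm_ge0 mD)[m [mm m0 gm ->]] c0 fg.
rewrite -ge0_integralZl_EFin//; last 2 first.
- by move=> t _; rewrite lee_fin.
- exact/measurable_EFinP.
apply: L1size_le_integral => [t|]; first by rewrite mule_ge0// lee_fin.
apply: (ae_imply2 _ gm fg) => t {}gm {}fg Dt.
rewrite -EFinM lee_fin -gm patchE mem_set//=; exact: fg.
Qed.

Lemma L1size_cst E D (c : E) : measurable D ->
  L1size D (fun=> c) = ((rnorm c)%:E * mu D)%E.
Proof. by move=> mD; rewrite /L1size integral_cst. Qed.

Lemma L1size_shift E (a : R) D (f : R -> E) : measurable D ->
  strongly_measurable D f ->
  L1size (fun t => D (a + t)) (fun t => f (a + t)) = L1size D f.
Proof.
move=> mD /(strongly_measurable_rnorm_ge0 mD)[m [mm m0 fm ->]].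
rewrite -(ge0_integral_shift a); last 2 first.
- exact/measurable_EFinP.
- by move=> t; rewrite lee_fin.
apply: L1sizeE => //; apply: ae_imply (ae_shift a fm) => t <-; rewrite !patchE.
by congr (if _ then _ else _); apply/idP/idP; rewrite !inE.
Qed.

Lemma L1sizeU E D D' (f : R -> E) : measurable D -> measurable D' ->
  strongly_measurable D f -> strongly_measurable D' f ->
  (L1size (D `|` D') f <= L1size D f + L1size D' f)%E.
Proof.
move=> mD mD' /(strongly_measurable_rnorm_ge0 mD)[m [mm m0 fm ->]].
move=> /(strongly_measurable_rnorm_ge0 mD')[n [mn n0 fn ->]].
rewrite -ge0_integralD//; last 4 first.
- by move=> t _; rewrite lee_fin.
- exact/measurable_EFinP.
- by move=> t _; rewrite lee_fin.
- exact/measurable_EFinP.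
apply: L1size_le_integral => [t|]; first by rewrite adde_ge0// lee_fin.
apply: (ae_imply2 _ fm fn) => t {}fm {}fn; rewrite -EFinD lee_fin => -[tD|tD].
  by rewrite -[leLHS]addr0 lerD// -fm patchE mem_set.
by rewrite -[leLHS]add0r lerD// -fn patchE mem_set.
Qed.

Definition bochner_integrable {E} D (f : R -> E) : Prop :=
  strongly_measurable D f /\ (L1size D f < +oo)%E.

Lemma bochner_integrable_le E F D (f : R -> E) (g : R -> F) (c : R) : measurable D ->
  strongly_measurable D f -> bochner_integrable D g -> 0 <= c ->
  {ae mu, forall t, D t -> rnorm (f t) <= c * rnorm (g t)} ->
  bochner_integrable D f.
Proof.
move=> mD mf [mg gy] c0 fg; split=> //.
apply: le_lt_trans (L1size_leZ mD mg c0 fg) _.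
by rewrite lte_mul_pinfty// lee_fin.
Qed.

Lemma bochner_integrable_ae E D (f g : R -> E) :
  {ae mu, forall t, D t -> f t = g t} ->
  bochner_integrable D f -> bochner_integrable D g.
Proof.
move=> fg [mf fy]; split; last by rewrite -(L1size_ae fg).
exact: strongly_measurable_ae fg mf.
Qed.

Lemma bochner_integrable_sub E D D' (f : R -> E) :
  {ae mu, forall t, D' t -> D t} ->
  bochner_integrable D f -> bochner_integrable D' f.
Proof.
move=> DD' [mf fy]; split; first exact: strongly_measurable_sub mf.
exact: le_lt_trans (L1size_subset f DD') fy.
Qed.

Lemma bochner_integrableU E D D' (f : R -> E) : measurable D -> measurable D' ->
  bochner_integrable D f -> bochner_integrable D' f ->
  bochner_integrable (D `|` D') f.
Proof.
move=> mD mD' [mf fy] [mf' fy']; split; first exact: strongly_measurableU.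
by apply: le_lt_trans (L1sizeU mD mD' mf mf') _; exact: lte_add_pinfty.
Qed.

Lemma bochner_integrableD E D (f g : R -> E) : measurable D ->
  bochner_integrable D f -> bochner_integrable D g ->
  bochner_integrable D (fun t => f t + g t).
Proof.
move=> mD [mf fy] [mg gy]; split; first exact: strongly_measurableD.
apply: le_lt_trans (L1size_leD mD mf mg _) _; last exact: lte_add_pinfty.
by apply: aeW => t _; exact: ler_rnormD.
Qed.

Lemma bochner_integrable_shift E (a : R) D (f : R -> E) : measurable D ->
  bochner_integrable D f ->
  bochner_integrable (fun t => D (a + t)) (fun t => f (a + t)).
Proof.
move=> mD [mf fy]; split; first exact: strongly_measurable_shift.
by rewrite L1size_shift.
Qed.

End norm_integral.

(** * The integral of simple functions *)

Section integral_of_simple_functions.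
Context {R : realType}.
Implicit Types (D A : set R) (E F : normedModType R[i]).
Local Notation mu := (@lebesgue_measure R).

Definition mass D A : R := fine (mu (D `&` A)).

Lemma mass_ge0 D A : 0 <= mass D A.
Proof. by rewrite /mass fine_ge0. Qed.

Lemma mass_fin D A : measurable D -> measurable A -> (mu D < +oo)%E ->
  mu (D `&` A) = (mass D A)%:E.
Proof.
move=> mD mA Dy; rewrite /mass fineK// ge0_fin_numE//.
by apply: le_lt_trans Dy; apply: le_measure; rewrite ?inE//; exact: measurableI.
Qed.

(** Additivity over the fibres of p, by which integrals of simple functions with
different partitions are compared. *)
Lemma mass_fibers (T : choiceType) D A (p : R -> T) : measurable D -> measurable A ->
  (mu D < +oo)%E -> simple_map p ->
  mass D A = \sum_(k <- fset_set (range p)) mass D (A `&` p @^-1` [set k]).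
Proof.
move=> mD mA Dy [fp mp]; apply: EFin_inj.
rewrite -mass_fin// -sumEFin.
under eq_bigr => k _ do rewrite -(mass_fin mD (measurableI _ _ mA (mp k)) Dy).
rewrite -measure_fbigsetU/=.
- rewrite -bigcup_fset; congr (mu _); apply/seteqP; split=> [t [Dt At]|t [k _ [Dt [At _]]]] => //.
  by exists (p t) => //=; rewrite in_fset_set// inE; exists t.
- by move=> k _; apply: measurableI => //; apply: measurableI => //; exact: mp.
- by move=> i j _ _ [t [[_ [_ /= <-]] [_ [_ /= <-]]]].
Qed.

Definition simple_int {E} D (s : R -> E) : E :=
  \sum_(c \in range s) (mass D (s @^-1` [set c]))%:C *: c.

(** The integral of a simple function may be computed over the fibres of any
simple map through which it factors. For two simple functions the pair is such a
map, and linearity becomes linearity of a finite sum. *)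
Lemma simple_int_comp (T : choiceType) E D (p : R -> T) (h : T -> E) :
  measurable D -> (mu D < +oo)%E -> simple_map p ->
  simple_int D (h \o p) =
  \sum_(k <- fset_set (range p)) (mass D (p @^-1` [set k]))%:C *: h k.
Proof.
move=> mD Dy sp; have shp := simple_map_comp h sp.
rewrite /simple_int fsbig_finite; last exact: shp.1.
transitivity (\sum_(c <- fset_set (range (h \o p))) \sum_(k <- fset_set (range p))
    if h k == c then (mass D (p @^-1` [set k]))%:C *: h k else 0).
  apply: eq_bigr => c _; rewrite (mass_fibers mD (shp.2 c) Dy sp) rmorph_sum scaler_suml.
  apply: eq_bigr => k _; case: eqP => [hk|hk].
    rewrite -hk; congr ((mass D _)%:C *: _).
    by apply/seteqP; split=> t /= => [[]|->].
  rewrite /mass (_ : _ `&` _ = set0) ?measure0 ?scale0r//.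
  by apply/seteqP; split=> t //= -[_ [/= hpt pk]]; apply: hk; rewrite -hpt pk.
rewrite exchange_big/=; apply: eq_big_seq => k.
rewrite in_fset_set; last exact: sp.1.
rewrite inE => -[t _ pt].
rewrite (bigD1_seq (h k))/=; last 2 first.
- by rewrite in_fset_set ?inE; [exists t => //=; rewrite pt|exact: shp.1].
- exact: fset_uniq.
by rewrite eqxx big1 ?addr0// => c /negbTE; rewrite eq_sym => ->.
Qed.

Lemma simple_intP E D a (s t : R -> E) : measurable D -> (mu D < +oo)%E ->
  simple_map s -> simple_map t ->
  simple_int D (fun x => a *: s x + t x) = a *: simple_int D s + simple_int D t.
Proof.
move=> mD Dy ss st; have sp := simple_map_pair ss st.
rewrite (simple_int_comp (fun p => a *: p.1 + p.2) mD Dy sp).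
rewrite (simple_int_comp fst mD Dy sp) (simple_int_comp snd mD Dy sp).
rewrite scaler_sumr -big_split/=; apply: eq_bigr => k _.
by rewrite scalerDr !scalerA mulrC.
Qed.

Lemma simple_intB E D (s t : R -> E) : measurable D -> (mu D < +oo)%E ->
  simple_map s -> simple_map t ->
  simple_int D s - simple_int D t = simple_int D (fun x => s x - t x).
Proof.
move=> mD Dy ss st; rewrite addrC -scaleN1r -simple_intP//; congr simple_int.
by apply/funext => x; rewrite scaleN1r addrC.
Qed.

Lemma simple_int_bop E F D (T : bop E F) (s : R -> E) : measurable D ->
  (mu D < +oo)%E -> simple_map s ->
  simple_int D (fun x => T (s x)) = T (simple_int D s).
Proof.
move=> mD Dy ss; rewrite (simple_int_comp T mD Dy ss) (simple_int_comp id mD Dy ss).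
by rewrite linear_sum; apply: eq_bigr => k _; rewrite linearZ.
Qed.

Lemma rnorm_simple_int E D (s : R -> E) : measurable D -> (mu D < +oo)%E ->
  simple_map s -> ((rnorm (simple_int D s))%:E <= L1size D s)%E.
Proof.
move=> mD Dy ss; rewrite /simple_int fsbig_finite; last exact: ss.1.
apply: (@le_trans _ _ (\sum_(c <- fset_set (range s)) (mass D (s @^-1` [set c]) * rnorm c)%:E)%E).
  rewrite sumEFin lee_fin (le_trans (ler_rnorm_sum _ _ _))// ler_sum// => c _.
  by rewrite rnormZr ger0_norm ?mass_ge0.
have mDs c : measurable (D `&` s @^-1` [set c]) by apply: measurableI => //; exact: ss.2.
have Ds : D = \big[setU/set0]_(c <- fset_set (range s)) (D `&` s @^-1` [set c]).
  rewrite -bigcup_fset; apply/seteqP; split=> [t Dt|t [k _ []]] => //.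
  by exists (s t) => //=; rewrite in_fset_set ?inE; [exists t|exact: ss.1].
rewrite /L1size {2}Ds ge0_integral_bigsetU//=.
- apply: lee_sum => c _; rewrite EFinM -mass_fin//; last exact: ss.2.
  rewrite muleC -integral_cst; last exact: mDs.
  rewrite le_eqVlt; apply/orP; left; apply/eqP.
  by apply: eq_integral => t; rewrite inE => -[_ /= ->].
- by move=> i j _ _ [t [[_ /= <-] [_ /= <-]]].
- apply/measurable_EFinP; apply: measurable_funTS => _ Y mY; rewrite setTI.
  rewrite (_ : _ @^-1` Y = s @^-1` [set c | Y (rnorm c)])//; exact: simple_map_preimage.
- by move=> t _; rewrite lee_fin rnorm_ge0.
Qed.

Lemma simple_intU E D D' (s : R -> E) : measurable D -> measurable D' ->
  (mu D < +oo)%E -> (mu D' < +oo)%E -> D `&` D' = set0 -> simple_map s ->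
  simple_int (D `|` D') s = simple_int D s + simple_int D' s.
Proof.
move=> mD mD' Dy Dy' DD' ss; rewrite /simple_int !fsbig_finite; try exact: ss.1.
rewrite -big_split/=; apply: eq_bigr => c _; rewrite -scalerDl -rmorphD/=.
have mc := ss.2 c.
have h : mu ((D `|` D') `&` s @^-1` [set c]) =
    (mu (D `&` s @^-1` [set c]) + mu (D' `&` s @^-1` [set c]))%E.
  rewrite setIUl measureU//; try exact: measurableI.
  by rewrite setIACA DD' set0I.
by rewrite [in LHS]/mass h (mass_fin mD mc Dy) (mass_fin mD' mc Dy').
Qed.

Lemma simple_int_null E D (s : R -> E) : measurable D -> mu D = 0%E ->
  simple_map s -> simple_int D s = 0.
Proof.
move=> mD D0 ss; rewrite /simple_int fsbig_finite; last exact: ss.1.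
rewrite big1// => c _; rewrite /mass (_ : mu _ = 0%E) ?scale0r//.
apply/eqP; rewrite eq_le measure_ge0 andbT -D0.
by apply: le_measure; rewrite ?inE//; apply: measurableI => //; exact: ss.2.
Qed.

Lemma simple_int_shift E (a : R) D (s : R -> E) : measurable D -> simple_map s ->
  simple_int (fun t => D (a + t)) (fun t => s (a + t)) = simple_int D s.
Proof.
move=> mD ss; rewrite /simple_int.
have -> : range (fun t => s (a + t)) = range s.
  apply/seteqP; split=> [_ [t _ <-]|_ [t _ <-]]; first by exists (a + t).
  by exists (t - a) => //; rewrite addrC subrK.
apply: eq_fsbigr => c _; congr (_%:C *: _); rewrite /mass; congr fine.
rewrite -[RHS](lebesgue_measure_shift a)//; apply: measurableI => //; exact: ss.2.
Qed.

End integral_of_simple_functions.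

(** * The Bochner integral *)

Section bochner_limits.
Context {R : realType}.
Implicit Types (D : set R) (E F : normedModType R[i]).
Local Notation mu := (@lebesgue_measure R).

(** The defining relation of the Bochner integral over any set, not only an
interval, because ]a, c[ is the union of ]a, b[, ]b, c[ and the null set {b}. *)
Definition bochner_limit {E} D (f : R -> E) (v : E) : Prop :=
  strongly_measurable D f /\ exists s : nat -> R -> E,
    [/\ forall n, simple_function (s n),
        L1size D (fun t => (f t - s n t)%R) @[n --> \oo] --> 0%E &
        simple_int D (s n) @[n --> \oo] --> v].

Lemma simple_function_strongly_measurable E D (s : R -> E) :
  simple_function s -> strongly_measurable D s.
Proof. by move=> ss; exists (fun=> s) => //; apply: aeW => t _; exact: cvg_cst. Qed.

Lemma strongly_measurableB E D (f g : R -> E) :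
  strongly_measurable D f -> strongly_measurable D g ->
  strongly_measurable D (fun t => f t - g t).
Proof.
move=> mf mg; apply: strongly_measurable_ext (strongly_measurableD mf (strongly_measurableZ (-1) mg)).
by move=> t _ /=; rewrite scaleN1r.
Qed.

(** The estimate behind both the existence and the uniqueness of the integral. *)
Lemma simple_int_dist E D (f : R -> E) (s t : R -> E) : measurable D -> (mu D < +oo)%E ->
  strongly_measurable D f -> simple_function s -> simple_function t ->
  ((rnorm (simple_int D s - simple_int D t))%:E <=
    L1size D (fun x => (f x - s x)%R) + L1size D (fun x => (f x - t x)%R))%E.
Proof.
move=> mD Dy mf ss st; rewrite simple_intB//.
have sst : simple_map (fun x => s x - t x).
  exact: (simple_map_comp (fun p => p.1 - p.2) (simple_map_pair ss st)).
apply: le_trans (rnorm_simple_int mD Dy sst) _.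
apply: L1size_leD => //.
- by apply: strongly_measurableB => //; exact: simple_function_strongly_measurable.
- by apply: strongly_measurableB => //; exact: simple_function_strongly_measurable.
- by apply: aeW => x _; rewrite (rnorm_distC (f x) (s x)); exact: ler_rnorm_distD.
Qed.

(** Every approximating sequence computes the same integral, by
[simple_int_dist]. *)
Lemma bochner_limit_cvg E D (f : R -> E) v (s : nat -> R -> E) : measurable D ->
  (mu D < +oo)%E -> bochner_limit D f v -> (forall n, simple_function (s n)) ->
  L1size D (fun t => (f t - s n t)%R) @[n --> \oo] --> 0%E ->
  simple_int D (s n) @[n --> \oo] --> v.
Proof.
move=> mD Dy [mf [t [st ft tv]]] ss fs.
have h : (simple_int D (s n) - simple_int D (t n)) @[n --> \oo] --> (0 : E).
  apply: (@rnorm_cvg_squeezee _ _ (fun n => L1size D (fun x => (f x - s n x)%R) +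
      L1size D (fun x => (f x - t n x)%R))%E).
    by move=> n; rewrite subr0; exact: simple_int_dist.
  by rewrite -[X in _ --> X]adde0; apply: cvgeD.
rewrite -[v]add0r; apply: cvg_seq_ext (cvgD h tv) => n.
by rewrite /= subrK.
Qed.

Lemma bochner_limit_unique E D (f : R -> E) v v' : measurable D ->
  (mu D < +oo)%E -> bochner_limit D f v -> bochner_limit D f v' -> v = v'.
Proof.
move=> mD Dy fv [mf [s [ss fs sv']]].
exact: rnorm_cvg_unique (bochner_limit_cvg mD Dy fv ss fs) sv'.
Qed.

Lemma bochner_limit_ae E D (f g : R -> E) v :
  {ae mu, forall t, D t -> f t = g t} ->
  bochner_limit D f v -> bochner_limit D g v.
Proof.
move=> fg [mf [s [ss fs sv]]]; split; first exact: strongly_measurable_ae fg mf.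
exists s; split => //; move: fs; rewrite (_ : (fun n => _) = fun n => L1size D (fun t => (g t - s n t)%R))//.
apply/funext => n; apply: L1size_ae.
by apply: ae_imply fg => t fg /fg ->.
Qed.

Lemma bochner_limitP E D a (f g : R -> E) v w : measurable D -> (mu D < +oo)%E ->
  bochner_limit D f v -> bochner_limit D g w ->
  bochner_limit D (fun t => a *: f t + g t) (a *: v + w).
Proof.
move=> mD Dy [mf [s [ss fs sv]]] [mg [t [st gt tw]]].
split; first exact: strongly_measurableP.
exists (fun n x => a *: s n x + t n x); split.
- by move=> n; exact: simple_functionP.
- have mfs n : strongly_measurable D (fun x => (f x - s n x)%R).
    by apply: strongly_measurableB => //; exact: simple_function_strongly_measurable.
  have mgt n : strongly_measurable D (fun x => (g x - t n x)%R).
    by apply: strongly_measurableB => //; exact: simple_function_strongly_measurable.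
  apply: (@squeeze_cvge _ _ _ _ (fun=> 0%E) _ (fun n =>
    ((complex.Re `|a|)%:E * L1size D (fun x => (f x - s n x)%R) +
      L1size D (fun x => (g x - t n x)%R))%E)); last 2 first.
  + exact: cvg_cst.
  + rewrite -[X in _ --> X]adde0 -[X in _ --> (X + _)%E](mule0 (complex.Re `|a|)%:E).
    apply: cvgeD => //; apply: cvgeZl => //.
  apply: nearW => n; rewrite L1size_ge0/=.
  apply: le_trans (L1size_leD mD (strongly_measurableZ a (mfs n)) (mgt n) _) _.
    apply: aeW => x _; apply: le_trans (ler_rnormD _ _).
    by rewrite opprD addrACA scalerBr.
  by apply: leeD => //; apply: L1size_leZ => //; [exact: Renorm_ge0|apply: aeW => x _; rewrite rnormZ].
- apply: cvg_seq_ext (fun n => esym (simple_intP a mD Dy (ss n) (st n))) _.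
  by apply: cvgD => //; apply: cvgZr.
Qed.

Lemma bochner_limit_bop E F D (T : bop E F) (f : R -> E) v : measurable D ->
  (mu D < +oo)%E -> bochner_limit D f v -> bochner_limit D (fun t => T (f t)) (T v).
Proof.
move=> mD Dy [mf [s [ss fs sv]]].
split; first by apply: strongly_measurable_bop => //; exact: strongly_measurable_cst.
exists (fun n x => T (s n x)); split.
- by move=> n; exact: (simple_map_comp T (ss n)).
- apply: (@squeeze_cvge _ _ _ _ (fun=> 0%E) _ (fun n =>
    ((opnorm T)%:E * L1size D (fun x => (f x - s n x)%R))%E)); last 2 first.
  + exact: cvg_cst.
  + by rewrite -[X in _ --> X](mule0 (opnorm T)%:E); apply: cvgeZl.
  apply: nearW => n; rewrite L1size_ge0/=; apply: L1size_leZ => //.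
  + by apply: strongly_measurableB => //; exact: simple_function_strongly_measurable.
  + exact: opnorm_ge0.
  + by apply: aeW => x _; rewrite -linearB; exact: ler_opnorm.
- apply: cvg_seq_ext (fun n => esym (simple_int_bop T mD Dy (ss n))) _; exact: bop_cvg.
Qed.

Lemma rnorm_bochner_limit E D (f : R -> E) v : measurable D -> (mu D < +oo)%E ->
  bochner_limit D f v -> ((rnorm v)%:E <= L1size D f)%E.
Proof.
move=> mD Dy [mf [s [ss fs sv]]].
have h n : ((rnorm (simple_int D (s n)))%:E <=
    L1size D f + L1size D (fun t => (f t - s n t)%R))%E.
  apply: le_trans (rnorm_simple_int mD Dy (ss n)) _; apply: L1size_leD => //.
    by apply: strongly_measurableB => //; exact: simple_function_strongly_measurable.
  apply: aeW => t _; rewrite addrC rnorm_distC; exact: ler_rnorm_dist.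
have hl : L1size D f + L1size D (fun t => (f t - s n t)%R) @[n --> \oo] --> (L1size D f + 0)%E.
  by apply: cvgeD => //; [rewrite fin_num_adde_defl|exact: cvg_cst].
rewrite -[leRHS]adde0 -(cvg_lim _ hl)// -(cvg_lim _ (_ : (rnorm (simple_int D (s n)))%:E @[n --> \oo] --> (rnorm v)%:E))//; last first.
  by apply: cvg_EFin; [exact: nearW|exact: rnorm_cvg].
apply: lee_lim; [|exact: cvgP hl|exact: nearW].
by apply: cvgP; apply: cvg_EFin; [exact: nearW|exact: rnorm_cvg sv].
Qed.

Lemma bochner_limitU E D D' (f : R -> E) v v' w : measurable D -> measurable D' ->
  (mu D < +oo)%E -> (mu D' < +oo)%E -> D `&` D' = set0 ->
  bochner_limit D f v -> bochner_limit D' f v' -> bochner_limit (D `|` D') f w ->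
  w = v + v'.
Proof.
move=> mD mD' Dy Dy' DD' fv fv' [mf [s [ss fs sw]]].
apply: rnorm_cvg_unique sw _.
apply: cvg_seq_ext (fun n => esym (simple_intU mD mD' Dy Dy' DD' (ss n))) _.
have sub A : A `<=` D `|` D' -> L1size A (fun t => (f t - s n t)%R) @[n --> \oo] --> 0%E.
  move=> sA; apply: (@squeeze_cvge _ _ _ _ (fun=> 0%E) _
    (fun n => L1size (D `|` D') (fun t => (f t - s n t)%R))) => //; last exact: cvg_cst.
  apply: nearW => n; rewrite L1size_ge0/=; apply: L1size_subset.
  by apply: aeW => t; exact: sA.
apply: cvgD.
  by apply: (bochner_limit_cvg mD Dy fv ss); apply: sub; exact: subsetUl.
by apply: (bochner_limit_cvg mD' Dy' fv' ss); apply: sub; exact: subsetUr.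
Qed.

Lemma bochner_limit_null E D (f : R -> E) : measurable D -> mu D = 0%E ->
  bochner_limit D f 0.
Proof.
move=> mD D0; have nD : {ae mu, forall t, ~ D t}.
  by exists D; split => // t /=; exact: contrapT.
split.
  apply: strongly_measurable_ae (strongly_measurable_cst D 0).
  by apply: ae_imply nD => t nD /nD.
exists (fun _ _ => 0); split => [n||]; first exact: simple_function_cst.
  rewrite [X in X @ _ --> _](_ : _ = fun=> 0%E); first exact: cvg_cst.
  apply/funext => n; rewrite (@L1size_ae _ _ _ _ (fun=> 0)) ?L1size_cst ?D0 ?mule0//.
  by apply: ae_imply nD => t nD /nD.
by apply: cvg_seq_ext (fun n => esym (simple_int_null mD D0 (simple_map_cst _))) _; exact: cvg_cst.
Qed.

Lemma bochner_limit_shift E (a : R) D (f : R -> E) v : measurable D ->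
  bochner_limit D f v ->
  bochner_limit (fun t => D (a + t)) (fun t => f (a + t)) v.
Proof.
move=> mD [mf [s [ss fs sv]]]; split; first exact: strongly_measurable_shift.
exists (fun n t => s n (a + t)); split.
- by move=> n; exact: (simple_map_shift a (ss n)).
- apply: cvg_seq_ext fs => n; rewrite -(L1size_shift a)//.
  by apply: strongly_measurableB => //; exact: simple_function_strongly_measurable.
- exact: cvg_seq_ext (fun n => esym (simple_int_shift a mD (ss n))) sv.
Qed.

End bochner_limits.

Section bochner_existence.
Context {R : realType} (E : completeNormedModType R[i]).
Implicit Types (D : set R).
Local Notation mu := (@lebesgue_measure R).

(** Strong measurability provides pointwise approximants without any control of
their size. Replacing them by 0 where their norm exceeds twice the norm of the
limit keeps the pointwise convergence and makes 3 |f| a dominating function. *)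
Lemma simple_approximation D (f : R -> E) : measurable D -> (mu D < +oo)%E ->
  bochner_integrable D f -> exists s : nat -> R -> E,
    (forall n, simple_function (s n)) /\
    L1size D (fun t => (f t - s n t)%R) @[n --> \oo] --> 0%E.
Proof.
move=> mD Dy [[s ss sf] fy].
have mf : strongly_measurable D f by exists s.
have [g [mg g0 fg Lf]] := strongly_measurable_rnorm_ge0 mD mf.
pose A n := [set t | rnorm (s n t) <= 2 * g t].
have mA n : measurable (A n).
  have mrs : measurable_fun setT (fun t => rnorm (s n t)).
    move=> _ Y mY; rewrite setTI.
    by rewrite (_ : _ @^-1` Y = s n @^-1` [set c | Y (rnorm c)])//; exact: simple_function_preimage.
  have -> : A n = [set: R] `&` [set t | (rnorm (s n t) <= 2 * g t)].
    by rewrite setTI.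
  apply: measurable_fun_le => //; exact: measurable_funM.
pose s' n t := if `[< A n t >] then s n t else 0.
have ss' n : simple_function (s' n).
  exact: (simple_map_comp (fun p : bool * E => if p.1 then p.2 else 0)
    (simple_map_pair (simple_map_indicator (mA n)) (ss n))).
exists s'; split => //.
have ms' n : strongly_measurable D (fun t => (f t - s' n t)%R).
  by apply: strongly_measurableB => //; exact: simple_function_strongly_measurable.
have [h Hh] := choice (fun n => strongly_measurable_rnorm_ge0 mD (ms' n)).
have LE n : L1size D (fun t => (f t - s' n t)%R) = (\int[mu]_t (h n t)%:E)%E.
  by have [] := Hh n.
rewrite (_ : (fun n => _) = fun n => (\int[mu]_t (h n t)%:E)%E); last exact/funext.
have ae1 : {ae mu, forall t, forall n, ((rnorm \o (fun t => (f t - s' n t)%R)) \_ D) t = h n t}.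
  by apply: ae_forall_nat => n; have [] := Hh n.
have -> : (0 = \int[mu]_(t in [set: R]) (fun=> 0) t)%E by rewrite integral0.
apply (@dominated_convergence _ _ _ mu setT measurableT (fun n t => (h n t)%:E)
  (fun=> 0%E) (fun t => (3 * g t)%:E)).
- by move=> n; apply/measurable_EFinP; have [] := Hh n.
- exact: measurable_cst.
- apply: (ae_imply2 _ (ae_imply2 (fun t x y => conj x y) ae1 fg) sf) => t [ht gt] {}sf _.
  rewrite (_ : (fun n => _) = fun n => (((rnorm \o (fun t => (f t - s' n t)%R)) \_ D) t)%:E); last first.
    by apply/funext => n; rewrite ht.
  apply: cvg_EFin; first exact: nearW.
  have [Dt|nDt] := pselect (D t); last first.
    rewrite (_ : (fun n => _) = fun=> 0); first exact: cvg_cst.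
    by apply/funext => n /=; rewrite patchE memNset.
  apply: (@cvg_seq_ext _ (fun n => rnorm (s' n t - f t))) => [n|].
    by rewrite /= patchE mem_set//= rnorm_distC.
  apply/rnorm_cvgP.
  have gE : g t = rnorm (f t) by rewrite -gt patchE mem_set.
  have [ft0|ft0] := eqVneq (f t) 0.
    rewrite (_ : (fun n => _) = fun=> 0); first by rewrite ft0; exact: cvg_cst.
    apply/funext => n; rewrite /s'; case: asboolP => //; rewrite /A/= gE ft0 rnorm0 mulr0.
    by move=> sn0; apply: rnorm0_eq0; apply/eqP; rewrite eq_le sn0 rnorm_ge0.
  have := sf Dt; apply: cvg_trans; apply: near_eq_cvg.
  have fpos : 0 < rnorm (f t) by rewrite lt_def rnorm_eq0 ft0 rnorm_ge0.
  have /cvgrPdist_lt /(_ _ fpos) := rnorm_cvg (sf Dt).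
  apply: filterS => n hn; rewrite /s'; case: asboolP => //; case.
  rewrite /A/= gE; move: hn; rewrite distrC ltr_distl => /andP[_] /ltW.
  by rewrite mulr_natl mulr2n.
- apply/integrableP; split.
    by apply/measurable_EFinP; exact: measurable_funM.
  under eq_integral => t _ do rewrite /= ger0_norm ?mulr_ge0//.
  under eq_integral => t _ do rewrite EFinM.
  rewrite ge0_integralZl_EFin//; last 2 first.
  + by move=> t _; rewrite lee_fin.
  + exact/measurable_EFinP.
  by rewrite -Lf lte_mul_pinfty.
- apply: (ae_imply2 _ ae1 fg) => t ht gt n _.
  have [_ h0 _ _] := Hh n.
  rewrite /= ger0_norm// lee_fin -ht patchE; case: ifPn => tD; last by rewrite mulr_ge0.
  have gE : g t = rnorm (f t) by rewrite -gt patchE tD.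
  rewrite /= (le_trans (ler_rnormB _ _))// gE.
  rewrite (_ : 3 = 1 + 2 :> R) ?natr1// mulrDl mul1r lerD2l /s'.
  case: asboolP; first by rewrite /A/= gE.
  by rewrite rnorm0 mulr_ge0// rnorm_ge0.
Qed.

(** The integrals of the approximants form a Cauchy sequence by
[simple_int_dist], and E is complete. *)
Lemma bochner_limit_exists D (f : R -> E) : measurable D -> (mu D < +oo)%E ->
  bochner_integrable D f -> exists v, bochner_limit D f v.
Proof.
move=> mD Dy fi; have [s [ss fs]] := simple_approximation mD Dy fi.
have [|v sv] := @rnorm_complete _ E (fun n => simple_int D (s n)); last first.
  by exists v; split; [exact: fi.1|exists s].
move=> e e0.
have /fine_cvgP[fsfin /cvgrPdist_lt /(_ _ (divr_gt0 e0 (ltr0Sn _ 1)))] := fs.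
move: fsfin => [N1 _ HN1] [N2 _ HN2]; exists (maxn N1 N2) => n Nn.
have h k : (maxn N1 N2 <= k)%N -> (L1size D (fun t => (f t - s k t)%R) < (e / 2)%:E)%E.
  rewrite geq_max => /andP[k1 k2].
  rewrite -(fineK (HN1 k k1)) lte_fin; have := HN2 k k2; rewrite /= sub0r normrN.
  exact: le_lt_trans (ler_norm _).
rewrite -lte_fin; apply: le_lt_trans (simple_int_dist mD Dy fi.1 (ss _) (ss _)) _.
by rewrite [e]splitr EFinD lteD ?h.
Qed.

End bochner_existence.

Section bochner_integral_theory.
Context {R : realType}.
Implicit Types (a b c : R) (E F : completeNormedModType R[i]).
Local Notation mu := (@lebesgue_measure R).
Local Notation J a b := (`]a, b[%classic : set R).

Lemma measurable_itvoo a b : measurable (J a b).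
Proof. exact: measurable_itv. Qed.

Lemma lebesgue_measure_itvoo_lty a b : (mu (J a b) < +oo)%E.
Proof. by rewrite lebesgue_measure_itv/=; case: ifP => // _; rewrite -EFinB ltry. Qed.

Local Hint Resolve measurable_itvoo lebesgue_measure_itvoo_lty : core.

Lemma bochner_integralP E a b (f : R -> E) : bochner_integrable (J a b) f ->
  bochner_limit (J a b) f (bochner_integral a b f).
Proof.
move=> /(bochner_limit_exists (measurable_itvoo a b) (lebesgue_measure_itvoo_lty a b))[v fv].
have : exists v, is_bochner_integral a b f v by exists v.
exact: (@xgetPex _ 0 [set v | is_bochner_integral a b f v]).
Qed.

Lemma bochner_limit_integral E a b (f : R -> E) v :
  bochner_limit (J a b) f v -> bochner_integral a b f = v.
Proof.
move=> fv; have fw : bochner_limit (J a b) f (bochner_integral a b f).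
  have : exists v, is_bochner_integral a b f v by exists v.
  exact: (@xgetPex _ 0 [set v | is_bochner_integral a b f v]).
exact: bochner_limit_unique fw fv.
Qed.

Lemma bochner_integral_ae E a b (f g : R -> E) : bochner_integrable (J a b) f ->
  {ae mu, forall t, J a b t -> f t = g t} ->
  bochner_integral a b f = bochner_integral a b g.
Proof.
move=> fi fg; apply/esym/bochner_limit_integral.
exact: bochner_limit_ae fg (bochner_integralP fi).
Qed.

Lemma bochner_integral_linear E a b (k : R[i]) (f g : R -> E) :
  bochner_integrable (J a b) f -> bochner_integrable (J a b) g ->
  bochner_integral a b (fun t => k *: f t + g t) =
  k *: bochner_integral a b f + bochner_integral a b g.
Proof.
move=> fi gi; apply: bochner_limit_integral.
by apply: bochner_limitP => //; exact: bochner_integralP.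
Qed.

Lemma bochner_integral_bop E F a b (T : bop E F) (f : R -> E) :
  bochner_integrable (J a b) f ->
  bochner_integral a b (fun t => T (f t)) = T (bochner_integral a b f).
Proof.
move=> fi; apply: bochner_limit_integral.
by apply: bochner_limit_bop => //; exact: bochner_integralP.
Qed.

Lemma rnorm_bochner_integral E a b (f : R -> E) : bochner_integrable (J a b) f ->
  ((rnorm (bochner_integral a b f))%:E <= L1size (J a b) f)%E.
Proof. by move=> fi; apply: rnorm_bochner_limit => //; exact: bochner_integralP. Qed.

Lemma bochner_integral_empty E a (f : R -> E) : bochner_integral a a f = 0.
Proof.
apply: bochner_limit_integral; apply: bochner_limit_null => //.
by rewrite set_itvoo0 measure0.
Qed.

(** The point b belongs to neither part; its contribution vanishes by
[bochner_limit_null]. *)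
Lemma bochner_integral_cat E a b c (f : R -> E) : a <= b <= c ->
  bochner_integrable (J a c) f ->
  bochner_integral a c f = bochner_integral a b f + bochner_integral b c f.
Proof.
move=> /andP[ab bc] fi.
pose N := [set b] `&` J a c.
have mN : measurable N by apply: measurableI => //; exact: measurable_set1.
have N0 : mu N = 0%E.
  apply/eqP; rewrite eq_le measure_ge0 andbT -(lebesgue_measure_set1 b).
  by apply: le_measure; rewrite ?inE//; exact: subIsetl.
have Ny : (mu N < +oo)%E by rewrite N0.
have bcN : J b c `&` N = set0.
  by apply/seteqP; split=> t //= -[]; rewrite in_itv/= => /andP[bt _] [/= tb]; rewrite tb ltxx in bt.
have JE : J a c = J a b `|` (J b c `|` N).
  apply/seteqP; split=> t /=; rewrite !in_itv/=.
    move=> /andP[at_ tc]; case: (ltgtP t b) => tb; [left|right;left|right;right] => //.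
    - by rewrite at_.
    - by split => //=; rewrite in_itv/= at_.
  move=> [/andP[at_ tb]|[/andP[bt tc]|[/= _]]].
  - by rewrite at_/= (lt_le_trans tb).
  - by rewrite tc (le_lt_trans ab).
  - by rewrite in_itv.
have dis : J a b `&` (J b c `|` N) = set0.
  apply/seteqP; split=> t //= [/=]; rewrite !in_itv/= => /andP[_ tb] [/andP[bt _]|[/= tb' _]].
    by have := lt_trans bt tb; rewrite ltxx.
  by rewrite tb' ltxx in tb.
have fiab : bochner_integrable (J a b) f.
  by apply: bochner_integrable_sub fi; apply: aeW => t; rewrite JE; left.
have fibc : bochner_integrable (J b c) f.
  by apply: bochner_integrable_sub fi; apply: aeW => t; rewrite JE; right; left.
have mbcN : measurable (J b c `|` N) by exact: measurableU.
have bcNy : (mu (J b c `|` N) < +oo)%E.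
  apply: le_lt_trans (lebesgue_measure_itvoo_lty a c); rewrite JE.
  apply: le_measure; [by rewrite inE| |exact: subsetUr].
  by rewrite inE -JE; exact: measurable_itvoo.
have fibcN : bochner_integrable (J b c `|` N) f.
  by apply: bochner_integrable_sub fi; apply: aeW => t; rewrite JE; right.
have [w fw] := bochner_limit_exists mbcN bcNy fibcN.
have := bochner_integralP fi; rewrite {1}JE => fac.
rewrite (bochner_limitU _ _ _ _ dis (bochner_integralP fiab) fw fac)//.
congr (_ + _); rewrite -[RHS]addr0.
exact: (bochner_limitU _ _ _ _ bcN (bochner_integralP fibc) (bochner_limit_null f mN N0) fw).
Qed.

Lemma itvoo_shift a b : (fun t => J a (a + b) (a + t)) = J 0 b.
Proof.
by apply/seteqP; split=> t /=; rewrite !in_itv/= ltrDl ltrD2l.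
Qed.

Lemma bochner_integral_shift E a b (f : R -> E) :
  bochner_integrable (J a (a + b)) f ->
  bochner_integral a (a + b) f = bochner_integral 0 b (fun t => f (a + t)).
Proof.
move=> fi; apply/esym/bochner_limit_integral; rewrite -(itvoo_shift a b).
by apply: bochner_limit_shift => //; exact: bochner_integralP.
Qed.

(** Absolute continuity of the integral on intervals that shrink to a point from
the right, by dominated convergence. *)
Lemma L1size_shrink (E : normedModType R[i]) a b (f : R -> E) t (u : nat -> R) :
  bochner_integrable (J a b) f -> a <= t -> (forall n, t < u n <= b) ->
  u n @[n --> \oo] --> t -> L1size (J t (u n)) f @[n --> \oo] --> 0%E.
Proof.
move=> [mf fy] at_ tu ut.
have [g [mg g0 fg Lf]] := strongly_measurable_rnorm_ge0 (measurable_itvoo a b) mf.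
pose h n s := g s * \1_(J t (u n)) s.
have mh n : measurable_fun setT (h n) by apply: measurable_funM => //; exact: measurable_indic.
have h0 n s : 0 <= h n s by rewrite mulr_ge0.
apply: (@squeeze_cvge _ _ _ _ (fun=> 0%E) _ (fun n => (\int[mu]_s (h n s)%:E)%E)).
- apply: nearW => n; rewrite L1size_ge0/=; apply: L1size_le_integral => [s|].
    by rewrite lee_fin.
  apply: ae_imply fg => s gs Js; rewrite lee_fin /h indicE mem_set// mulr1 -gs patchE.
  rewrite mem_set//=; move: Js; rewrite /= !in_itv/= => /andP[ts su].
  by rewrite (le_lt_trans at_ ts)/= (lt_le_trans su)//; have /andP[] := tu n.
- exact: cvg_cst.
have -> : (0 = \int[mu]_(s in [set: R]) (fun=> 0) s)%E by rewrite integral0.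
apply (@dominated_convergence _ _ _ mu setT measurableT (fun n s => (h n s)%:E)
  (fun=> 0%E) (fun s => (g s)%:E)).
- by move=> n; apply/measurable_EFinP; exact: mh.
- exact: measurable_cst.
- apply: aeW => s _; apply: cvg_EFin; first exact: nearW.
  have [st|ts] := leP s t.
    apply: (@cvg_seq_ext _ (fun=> 0)) => [n|]; last exact: cvg_cst.
    by rewrite /h/= indicE memNset ?mulr0//= in_itv/= ltNge st.
  have : 0 < s - t by rewrite subr_gt0.
  move/cvgrPdist_lt : ut => /[apply] utn.
  have : (0 : R) @[n --> \oo] --> (0 : R) by exact: cvg_cst.
  apply: cvg_trans; apply: near_eq_cvg; apply: filterS utn => n utn.
  rewrite /h/= indicE memNset ?mulr0//= in_itv/= => /andP[_ su].
  move: utn; rewrite ltNge => /negP; apply; rewrite distrC.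
  by apply: le_trans (ler_norm _); rewrite lerB// ltW.
- apply/integrableP; split; first exact/measurable_EFinP.
  by under eq_integral => s _ do rewrite /= ger0_norm//; rewrite -Lf.
- by apply: aeW => s n _; rewrite /= ger0_norm// lee_fin /h ler_piMr// indicE lern1 leq_b1.
Qed.

End bochner_integral_theory.

(** * Uniform boundedness *)

Section uniform_boundedness.
Context {R : realType}.

(** If z nearly attains the norm of T on the ball of radius r around 0, then
2 T z = T (x + z) - T (x - z), so one of the points x + z, x - z does it on the
ball around x. *)
Lemma rnorm_bop_ball (E F : normedModType R[i]) (T : bop E F) (x : E) (r : R) :
  0 < opnorm T -> 0 < r ->
  exists y, rnorm (y - x) <= r /\ 2 / 3 * r * opnorm T <= rnorm (T y).
Proof.
move=> T0 r0.
have [z [z1 zT]] : exists z, rnorm z <= 1 /\ 2 / 3 * opnorm T < rnorm (T z).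
  have h : 2 / 3 * opnorm T < opnorm T by lra.
  by have [_ [z /= z1 <-] zT] := sup_gt (opnorm_has_sup T).1 h; exists z.
pose xi : E := r%:C *: z.
have xir : rnorm xi <= r by rewrite rnormZr gtr0_norm// ger_pMr.
have Txi : 2 / 3 * r * opnorm T <= rnorm (T xi).
  by rewrite linearZ rnormZr gtr0_norm// mulrAC mulrC ler_pM2l// ltW.
have : rnorm (T xi) *+ 2 <= rnorm (T (x + xi)) + rnorm (T (x - xi)).
  have -> : rnorm (T xi) *+ 2 = rnorm (T (x + xi) - T (x - xi)).
    rewrite -linearB opprB addrC addrA subrK linearD.
    have -> : T xi + T xi = (1 + 1 : R)%:C *: T xi by rewrite rmorphD/= scalerDl !scale1r.
    by rewrite rnormZr ger0_norm// mulrDl mul1r mulr2n.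
  exact: ler_rnormB.
have [h1|h1] := leP (rnorm (T xi)) (rnorm (T (x + xi))) => h2.
  by exists (x + xi); rewrite addrAC subrr add0r; split => //; exact: le_trans h1.
exists (x - xi); rewrite addrAC subrr add0r rnormN; split => //.
by apply: le_trans Txi _; move: h1 h2; rewrite mulr2n; lra.
Qed.

(** If the norms were unbounded, choose operators T_n of norm larger than 4^n and
move x_n by at most 3^-n to a point x_{n+1} where T_n is at least
(2/3) 3^-n |T_n|. The limit l of the x_n is so close to x_{n+1} that
|T_n l| >= (1/6) (4/3)^n, against the pointwise bound at l. *)
Lemma uniform_boundedness (E : completeNormedModType R[i]) (F : normedModType R[i])
    (I : Type) (T : I -> bop E F) :
  (forall x, exists M, forall i, rnorm (T i x) <= M) ->
  exists2 M, 0 <= M & forall i x, rnorm (T i x) <= M * rnorm x.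
Proof.
move=> Tb; apply: contrapT => nTb.
have big n : exists i, 4 ^+ n < opnorm (T i).
  apply: contrapT => /forallNP h; apply: nTb; exists (4 ^+ n); first exact: exprn_ge0.
  move=> i x; apply: le_trans (ler_opnorm _ _) _; rewrite ler_wpM2r ?rnorm_ge0//.
  by rewrite leNgt; apply/negP; exact: h.
have [i iT] := choice big.
have Tpos n : 0 < opnorm (T (i n)) by apply: lt_trans (iT n); exact: exprn_gt0.
have r0 n : 0 < (3^-1 : R) ^+ n by apply: exprn_gt0; rewrite invr_gt0.
have [y Hy] := choice (fun p : nat * E => rnorm_bop_ball p.2 (Tpos p.1) (r0 p.1)).
pose x := fix x n := if n is m.+1 then y (m, x m) else 0.
have xS n : rnorm (x n.+1 - x n) <= 3^-1 ^+ n by have [] := Hy (n, x n).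
have Tx n : 2 / 3 * 3^-1 ^+ n * opnorm (T (i n)) <= rnorm (T (i n) (x n.+1)).
  by have [] := Hy (n, x n).
have xd n k : rnorm (x (n + k)%N - x n) <= 3 / 2 * (3^-1 ^+ n - 3^-1 ^+ (n + k)).
  elim: k => [|k IH]; first by rewrite addn0 !subrr rnorm0 mulr0.
  apply: le_trans (ler_rnorm_distD (x (n + k)%N) _ _) _.
  rewrite addnS; have := xS (n + k)%N; rewrite [_ ^+ _.+1]exprS.
  by move: IH; set a := 3^-1 ^+ (n + k); set b := 3^-1 ^+ n; lra.
have [l xl] : exists l : E, x n @[n --> \oo] --> l.
  apply: rnorm_complete => e e0.
  have : (3^-1 : R) ^+ n @[n --> \oo] --> 0.
    by apply: cvg_expr; rewrite ger0_norm ?invr_ge0// invf_lt1// ltr1n.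
  move=> /cvgrPdist_lt /(_ _ (divr_gt0 e0 (ltr0Sn _ 1)))[N _ HN].
  exists N => n Nn; rewrite -(subnKC Nn).
  apply: le_lt_trans (xd _ _) _.
  have := HN N (leqnn N); rewrite /= sub0r normrN gtr0_norm//.
  have := r0 (N + (n - N))%N.
  by set a := 3^-1 ^+ (N + _); set b := 3^-1 ^+ N; lra.
have ld n : rnorm (l - x n) <= 3 / 2 * 3^-1 ^+ n.
  have : x (k + n)%N - x n @[k --> \oo] --> l - x n.
    apply: cvgB; last exact: cvg_cst.
    have := xl; rewrite -(cvg_shiftn n); exact.
  move=> /cvg_rnorm_le; apply => k; rewrite addnC; apply: le_trans (xd _ _) _.
  by rewrite ler_wpM2l// gerBl ltW.
have [M HM] := Tb l.
have lM n : (4 / 3) ^+ n <= 6 * M.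
  have h1 := Tx n; have h2 := HM (i n); have h3 := ler_opnorm (T (i n)) (x n.+1 - l).
  have h4 : rnorm (T (i n) (x n.+1)) <= rnorm (T (i n) (x n.+1 - l)) + rnorm (T (i n) l).
    by rewrite linearB; exact: ler_rnorm_dist.
  have h5 : opnorm (T (i n)) * rnorm (x n.+1 - l) <= opnorm (T (i n)) * (3 / 2 * 3^-1 ^+ n.+1).
    by rewrite ler_wpM2l ?opnorm_ge0// rnorm_distC.
  have h6 : 3^-1 ^+ n * 4 ^+ n <= 3^-1 ^+ n * opnorm (T (i n)).
    by rewrite ler_wpM2l// ltW.
  rewrite exprMn mulrC; move: h1 h5 h6; rewrite [_ ^+ n.+1]exprS.
  have -> : opnorm (T (i n)) * (3 / 2 * (3^-1 * 3^-1 ^+ n)) =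
    1 / 2 * (3^-1 ^+ n * opnorm (T (i n))) by field.
  have -> : 2 / 3 * 3^-1 ^+ n * opnorm (T (i n)) =
    2 / 3 * (3^-1 ^+ n * opnorm (T (i n))) by ring.
  by move: h2 h3 h4; set a := _ * opnorm _; set b := _ * 4 ^+ n; lra.
have q : `|3 / 4 : R| < 1 by rewrite ger0_norm//; lra.
have /cvgrPdist_lt := cvg_expr q.
have M0 : 0 < 6 * M by apply: lt_le_trans (lM 0%N); rewrite expr0.
have iM0 : 0 < (6 * M)^-1 by rewrite invr_gt0.
move=> /(_ _ iM0)[N _ /(_ N (leqnn N))] /=; rewrite sub0r normrN ger0_norm; last first.
  by apply: exprn_ge0; lra.
rewrite ltNge => /negP; apply.
have e : (3 / 4 : R) ^+ N * (4 / 3) ^+ N = 1.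
  by rewrite -exprMn (_ : 3 / 4 * (4 / 3) = 1) ?expr1n//; field.
by rewrite -[leLHS]div1r ler_pdivrMr// -[leLHS]e ler_wpM2l ?lM.
Qed.

End uniform_boundedness.

(** * Bounds on compact sets *)

Section compact_bound.
Context {R : realType}.

Lemma continuous_rnorm (E : normedModType R[i]) : continuous (@rnorm R E).
Proof.
move=> x; apply/cvgrPdist_lt => e e0.
have e0' : 0 < e%:C by rewrite ltcR.
have /cvgrPdist_lt /(_ _ e0') : y @[y --> x] --> x by [].
apply: filterS => y; rewrite rnormE ltcR; apply: le_lt_trans.
have := ler_dist_dist x y.
by rewrite !rnormE -rmorphB/= normc_def/= expr0n/= addr0 sqrtr_sqr lecR.
Qed.

Lemma compact_triangle (T : R) :
  compact [set p : R * R | 0 <= p.2 /\ p.2 <= p.1 /\ p.1 <= T].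
Proof.
have cS : compact (`[0, T]%classic `*` `[0, T]%classic : set (R * R)).
  by apply: compact_setX; exact: segment_compact.
apply: (subclosed_compact _ cS).
  have -> : [set p : R * R | 0 <= p.2 /\ p.2 <= p.1 /\ p.1 <= T] =
      ((fun p : R * R => p.2) @^-1` [set x | 0 <= x]) `&`
      (((fun p : R * R => p.1 - p.2) @^-1` [set x | 0 <= x]) `&`
      ((fun p : R * R => p.1) @^-1` [set x | x <= T])).
    by apply/seteqP; split=> p /=; rewrite subr_ge0.
  apply: closedI; [|apply: closedI]; apply: preimage_closed;
    try exact: closed_ge; try exact: closed_le.
  - by move=> p _; exact: cvg_snd.
  - by move=> p _; apply: cvgB; [exact: cvg_fst|exact: cvg_snd].
  - by move=> p _; exact: cvg_fst.
move=> p /= [p2 [p12 p1]]; split => /=; rewrite in_itv/=.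
  by rewrite p1 (le_trans p2).
by rewrite p2 (le_trans p12).
Qed.

Lemma compact_rnorm_bounded (E : normedModType R[i]) (A : set (R * R)) (f : R * R -> E) :
  compact A -> {within A, continuous f} -> exists M, forall p, A p -> rnorm (f p) <= M.
Proof.
move=> cA cf.
have cf' : {within A, continuous (fun p => rnorm (f p))}.
  by move=> p; apply: continuous_comp; [exact: cf|exact: continuous_rnorm].
have /compact_bounded[M [_ HM]] := continuous_compact cf' cA.
exists (M + 1) => p Ap; apply: le_trans (ler_norm _) _.
by apply: (HM (M + 1)); [rewrite ltrDl|exists p].
Qed.

End compact_bound.

(** * Evolution families *)

Section evolution_family.
Context {R : realType} {tau : R} {X U0 Ud0 Y0 : completeNormedModType R[i]}.
Variable S : periodic_system tau X U0 Ud0 Y0.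
Local Notation mu := (@lebesgue_measure R).
Local Notation J a b := (`]a, b[%classic : set R).

Lemma evol_refl t x : evol S t t x = x.
Proof. by rewrite evol_id. Qed.

Lemma evol_compE t r s x : s <= r -> r <= t -> evol S t r (evol S r s x) = evol S t s x.
Proof. by move=> sr rt; rewrite -(evol_comp S sr rt). Qed.

(** Every orbit is continuous on the compact triangle 0 <= s <= t <= T, hence
bounded there; the uniform boundedness principle makes the bound uniform in x. *)
Lemma evol_bounded T : exists2 M, 0 <= M & forall s t, 0 <= s -> s <= t -> t <= T ->
  forall x, rnorm (evol S t s x) <= M * rnorm x.
Proof.
pose A := [set p : R * R | 0 <= p.2 /\ p.2 <= p.1 /\ p.1 <= T].
pose W (p : {p : R * R | A p}) := evol S (sval p).1 (sval p).2.
have [x|M M0 HM] := @uniform_boundedness R X X {p : R * R | A p} W; last first.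
  exists M => // s t s0 st tT x.
  have pA : A (t, s) by split.
  exact: (HM (exist _ (t, s) pA)).
have [M HM] := @compact_rnorm_bounded R X A (fun p => evol S p.1 p.2 x) (@compact_triangle R T)
  (continuous_subspaceW (fun p (h : A p) => h.2.1) (@evol_continuous _ _ _ _ _ _ S x)).
by exists M => -[p pA]; exact: HM.
Qed.

Lemma evol_cvg (t s : nat -> R) t' s' x : (forall n, s n <= t n) -> s' <= t' ->
  t n @[n --> \oo] --> t' -> s n @[n --> \oo] --> s' ->
  evol S (t n) (s n) x @[n --> \oo] --> evol S t' s' x.
Proof.
move=> st st' tt' ss'.
have /subspace_continuousP /(_ (t', s') st') h := @evol_continuous _ _ _ _ _ _ S x.
have ts : (t n, s n) @[n --> \oo] --> within [set p : R * R | p.2 <= p.1] (nbhs (t', s')).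
  move=> B; have : (t n, s n) @[n --> \oo] --> (t', s') by exact: (cvg_pair tt' ss').
  move=> hp hB; have hN : \forall n \near \oo, (s n <= t n -> B (t n, s n)) := hp _ hB.
  change (\forall n \near \oo, B (t n, s n)).
  by apply: filterS hN => n; apply; exact: st.
exact: (cvg_comp _ _ ts h).
Qed.

(** The uniform bound turns strong continuity in (t, s) into joint continuity in
(t, s, x) on bounded triangles. *)
Lemma evol_cvg2 (t s : nat -> R) t' s' (x : nat -> X) x' T :
  (forall n, [/\ 0 <= s n, s n <= t n & t n <= T]) -> s' <= t' ->
  t n @[n --> \oo] --> t' -> s n @[n --> \oo] --> s' -> x n @[n --> \oo] --> x' ->
  evol S (t n) (s n) (x n) @[n --> \oo] --> evol S t' s' x'.
Proof.
move=> st st' tt' ss' xx'; have [M M0 HM] := evol_bounded T.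
apply: (@rnorm_cvg_squeeze _ _ (fun n => M * rnorm (x n - x') +
    rnorm (evol S (t n) (s n) x' - evol S t' s' x'))).
  move=> n; apply: le_trans (ler_rnorm_distD (evol S (t n) (s n) x') _ _) _.
  by rewrite lerD2r -linearB; have [? ? ?] := st n; exact: HM.
rewrite -[0 in X in _ --> X]addr0; apply: cvgD.
  rewrite -[0 in X in _ --> X](mulr0 M); apply: cvgM; first exact: cvg_cst.
  exact/rnorm_cvgP.
by apply/rnorm_cvgP; apply: evol_cvg => // n; have [] := st n.
Qed.

Lemma evol_periodic_nat n t s : s <= t ->
  evol S (n%:R * tau + t) (n%:R * tau + s) = evol S t s.
Proof.
move=> st; elim: n => [|n IH]; first by rewrite !mul0r !add0r.
have h : n%:R * tau + s <= n%:R * tau + t by rewrite lerD2l.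
by rewrite -[in RHS]IH -(evol_periodic S h) -natr1 mulrDl mul1r !(addrAC _ tau).
Qed.

Lemma opB_periodic_nat n t : opB S (n%:R * tau + t) = opB S t.
Proof.
elim: n => [|n IH]; first by rewrite mul0r add0r.
by rewrite -natr1 mulrDl mul1r addrAC opB_periodic.
Qed.

Lemma opBd_periodic_nat n t : opBd S (n%:R * tau + t) = opBd S t.
Proof.
elim: n => [|n IH]; first by rewrite mul0r add0r.
by rewrite -natr1 mulrDl mul1r addrAC opBd_periodic.
Qed.

Lemma opC_periodic_nat n t : opC S (n%:R * tau + t) = opC S t.
Proof.
elim: n => [|n IH]; first by rewrite mul0r add0r.
by rewrite -natr1 mulrDl mul1r addrAC opC_periodic.
Qed.

Lemma opD_periodic_nat n t : opD S (n%:R * tau + t) = opD S t.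
Proof.
elim: n => [|n IH]; first by rewrite mul0r add0r.
by rewrite -natr1 mulrDl mul1r addrAC opD_periodic.
Qed.

(** The contribution of the source term v to the mild state at time t. *)
Definition forced (t : R) (v : R -> X) : X :=
  bochner_integral 0 t (fun s => evol S t s (v s)).

Lemma bochner_integrable_evol t v : bochner_integrable (J 0 t) v ->
  bochner_integrable (J 0 t) (fun s => evol S t s (v s)).
Proof.
move=> vi; have [M M0 HM] := evol_bounded t.
apply: (bochner_integrable_le (measurable_itvoo 0 t) _ vi M0); last first.
  apply: aeW => s; rewrite /= in_itv/= => /andP[s0 st].
  by apply: HM => //; exact: ltW.
apply: (strongly_measurable_right_continuous (H := fun s x => evol S t s x) vi.1).
move=> s u x /andP[s0 st] us ucvg xcvg.
apply: (@evol_cvg2 (fun=> t) u t s x (v s) t) => //; [|exact: ltW|exact: cvg_cst].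
move=> n; have /andP[su ut] := us n; split => //.
by apply: ltW; exact: lt_trans su.
Qed.

Lemma forced_linear t a v w : bochner_integrable (J 0 t) v ->
  bochner_integrable (J 0 t) w ->
  forced t (fun s => a *: v s + w s) = a *: forced t v + forced t w.
Proof.
move=> vi wi; rewrite /forced -bochner_integral_linear; try exact: bochner_integrable_evol.
by congr bochner_integral; apply/funext => s; rewrite linearP.
Qed.

Lemma forced_ae t v w : bochner_integrable (J 0 t) v ->
  {ae mu, forall s, J 0 t s -> v s = w s} -> forced t v = forced t w.
Proof.
move=> vi vw; apply: bochner_integral_ae; first exact: bochner_integrable_evol.
by apply: ae_imply vw => s vw /vw ->.
Qed.

Lemma forced_bounded T v : bochner_integrable (J 0 T) v ->
  exists2 M, 0 <= M & forall t, 0 <= t <= T -> rnorm (forced t v) <= M.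
Proof.
move=> vi; have [M M0 HM] := evol_bounded T.
have Lfin : L1size (J 0 T) v \is a fin_num.
  by rewrite ge0_fin_numE ?L1size_ge0//; exact: vi.2.
exists (M * fine (L1size (J 0 T) v)).
  by rewrite mulr_ge0// fine_ge0// L1size_ge0.
move=> t /andP[t0 tT].
have vit : bochner_integrable (J 0 t) v.
  apply: bochner_integrable_sub vi; apply: aeW => s; rewrite /= !in_itv/= => /andP[-> st].
  exact: lt_le_trans tT.
rewrite -lee_fin EFinM fineK//.
apply: le_trans (rnorm_bochner_integral (bochner_integrable_evol vit)) _.
apply: le_trans (L1size_leZ (measurable_itvoo 0 t) vit.1 M0 _) _.
  apply: aeW => s; rewrite /= in_itv/= => /andP[s0 st].
  by apply: HM => //; exact: ltW.
apply: lee_wpmul2l; first by rewrite lee_fin.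
apply: L1size_subset; apply: aeW => s; rewrite /= !in_itv/= => /andP[-> st].
exact: lt_le_trans tT.
Qed.

(** The mild state can be restarted at time t: U(t', s) = U(t', t) U(t, s) for
s <= t, and the bounded operator U(t', t) commutes with the integral. *)
Lemma forced_cat T v t t' : bochner_integrable (J 0 T) v -> 0 <= t -> t <= t' -> t' <= T ->
  forced t' v = evol S t' t (forced t v) +
    bochner_integral t t' (fun s => evol S t' s (v s)).
Proof.
move=> vi t0 tt' t'T.
have sub t1 : t1 <= T -> bochner_integrable (J 0 t1) v.
  move=> t1T; apply: bochner_integrable_sub vi; apply: aeW => s.
  by rewrite /= !in_itv/= => /andP[-> st]; exact: lt_le_trans t1T.
rewrite /forced (@bochner_integral_cat _ _ 0 t t') ?t0//; last first.
  by apply: bochner_integrable_evol; exact: sub.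
congr (_ + _); rewrite -bochner_integral_bop; last first.
  by apply: bochner_integrable_evol; apply: sub; exact: le_trans t'T.
apply: bochner_integral_ext => s /andP[s0 st].
by rewrite evol_compE// ltW.
Qed.

(** Restarting at t, the increment over [t, u] is U(u, t) - I applied to the
state at t, which tends to 0 by strong continuity, plus an integral over ]t, u[,
which tends to 0 by absolute continuity. So the forced state is continuous from
the right. *)
Lemma strongly_measurable_forced T v : bochner_integrable (J 0 T) v ->
  strongly_measurable (J 0 T) (fun t => forced t v).
Proof.
move=> vi; have [M M0 HM] := evol_bounded T.
apply: (strongly_measurable_right_continuous (H := fun t (_ : X) => forced t v)
  (strongly_measurable_cst (J 0 T) (0 : X))).
move=> t u _ /andP[t0 tT] ut ucvg _ /=.
have t0' := ltW t0.
apply: (@cvg_seq_ext _ (fun n => evol S (u n) t (forced t v) +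
    bochner_integral t (u n) (fun s => evol S (u n) s (v s)))) => [n|].
  by have /andP[tu uT] := ut n; rewrite -(forced_cat vi)// ltW.
rewrite -[X in _ --> X]addr0; apply: cvgD.
  rewrite -[X in _ --> X](evol_refl t); apply: (@evol_cvg u (fun=> t)) => //.
  by move=> n; have /andP[/ltW] := ut n.
  exact: cvg_cst.
apply: (@rnorm_cvg_squeezee _ _ (fun n => (M%:E * L1size (J t (u n)) v)%E)); last first.
  rewrite -[X in _ --> X](mule0 M%:E); apply: cvgeZl => //.
  exact: (L1size_shrink vi).
move=> n; have /andP[tu uT] := ut n; rewrite subr0.
have vin : bochner_integrable (J t (u n)) v.
  apply: bochner_integrable_sub vi; apply: aeW => s; rewrite /= !in_itv/= => /andP[ts su].
  by rewrite (lt_trans t0 ts) (lt_le_trans su uT).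
have vi0 : bochner_integrable (J 0 (u n)) v.
  apply: bochner_integrable_sub vi; apply: aeW => s; rewrite /= !in_itv/= => /andP[-> su].
  by rewrite (lt_le_trans su uT).
apply: le_trans (rnorm_bochner_integral _) _.
  apply: bochner_integrable_sub (bochner_integrable_evol vi0); apply: aeW => s.
  by rewrite /= !in_itv/= => /andP[ts ->]; rewrite (lt_trans t0 ts).
apply: (L1size_leZ (measurable_itvoo t (u n)) vin.1 M0).
apply: aeW => s; rewrite /= in_itv/= => /andP[ts su].
by apply: HM => //; apply: ltW => //; exact: lt_trans ts.
Qed.

(** Restarting at a multiple of tau is the same as starting at 0, because the
evolution family is periodic. *)
Lemma forced_shift n t v : 0 <= t -> bochner_integrable (J 0 (n%:R * tau + t)) v ->
  0 <= tau ->
  forced (n%:R * tau + t) v =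
  evol S t 0 (forced (n%:R * tau) v) + forced t (fun s => v (n%:R * tau + s)).
Proof.
move=> t0 vi tau0; have nt0 : 0 <= n%:R * tau by rewrite mulr_ge0.
have nt : n%:R * tau <= n%:R * tau + t by rewrite lerDl.
rewrite (forced_cat vi nt0 nt (lexx _)).
have -> : evol S (n%:R * tau + t) (n%:R * tau) = evol S t 0.
  by rewrite -[X in evol S _ X]addr0 evol_periodic_nat.
apply: (f_equal (fun v => _ + v)).
rewrite bochner_integral_shift.
  by apply: bochner_integral_ext => s /andP[s0 st]; rewrite evol_periodic_nat// ltW.
apply: bochner_integrable_sub (bochner_integrable_evol vi); apply: aeW => s.
by rewrite /= !in_itv/= => /andP[ts ->]; rewrite (le_lt_trans nt0 ts).
Qed.

End evolution_family.

(** * Square integrable signals *)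

Section square_integrable_signals.
Context {R : realType} {tau : R}.
Implicit Types E F : normedModType R[i].
Local Notation mu := (@lebesgue_measure R).
Local Notation J := (`]0, tau[%classic : set R).

Lemma square_integrableP E (f : R -> E) :
  f \in square_integrable tau (E := E) <->
  strongly_measurable J f /\ (L2_size tau f < +oo)%E.
Proof. by split=> /asboolP. Qed.

Lemma square_integrable_L2 E (u : L2 tau E) : (u : R -> E) \in square_integrable tau (E := E).
Proof. exact: L2_funP. Qed.

Lemma square_integrable_le E F (f : R -> E) (g : R -> F) (c : R) :
  strongly_measurable J f -> g \in square_integrable tau (E := F) -> 0 <= c ->
  {ae mu, forall t, J t -> rnorm (f t) <= c * rnorm (g t)} ->
  f \in square_integrable tau (E := E).
Proof.
move=> mf /square_integrableP[mg gy] c0 fg; apply/square_integrableP; split=> //.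
apply: (@le_lt_trans _ _ (L2_size tau (c%:C *: g))); last first.
  by rewrite L2_sizeZ// lte_mul_pinfty// ?lee_fin ?Renorm_ge0.
apply: ae_le_Lnorm => //; apply: ae_imply fg => t fg; rewrite !patchE.
case: ifPn => //; rewrite inE => Jt.
rewrite -[leRHS]/`|rnorm (c%:C *: g t)| !ger0_norm ?rnorm_ge0//.
by rewrite rnormZr ger0_norm// fg.
Qed.

Lemma square_integrableD E (f g : R -> E) :
  f \in square_integrable tau (E := E) -> g \in square_integrable tau (E := E) ->
  (fun t => f t + g t) \in square_integrable tau (E := E).
Proof.
move=> /square_integrableP[mf fy] /square_integrableP[mg gy].
apply/square_integrableP; split; first exact: strongly_measurableD.
by apply: le_lt_trans (L2_sizeD mf mg) _; rewrite lte_add_pinfty.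
Qed.

Lemma square_integrable_cst E (c : E) : (fun=> c) \in square_integrable tau (E := E).
Proof.
apply/square_integrableP; split; first exact: strongly_measurable_cst.
rewrite (@L2_sizeE _ _ _ _ (fun t => rnorm c * \1_J t)); last first.
  by apply: aeW => t; rewrite patchE indicE; case: ifP; rewrite ?mulr1 ?mulr0.
rewrite unlock /Lnorm /=.
have -> : (\int[mu]_x (`|rnorm c * \1_J x| `^ 2)%:E =
    \int[mu]_x ((rnorm c `^ 2)%:E * (\1_J x)%:E))%E.
  apply: eq_integral => t _; rewrite indicE -EFinM; congr (_%:E).
  case: (t \in J) => /=; first by rewrite !mulr1 ger0_norm ?rnorm_ge0.
  by rewrite !mulr0 normr0 powR0.
rewrite ge0_integralZl_EFin//; last 2 first.
- by apply/measurable_EFinP; exact: measurable_indic.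
- exact: powR_ge0.
rewrite integral_indic// setIT poweR_lty// lte_mul_pinfty ?lee_fin ?powR_ge0//.
exact: lebesgue_measure_itvoo_lty.
Qed.

(** Hoelder's inequality with the constant function 1 on a bounded interval. *)
Lemma L2_bochner_integrable E (f : R -> E) : f \in square_integrable tau (E := E) ->
  bochner_integrable J f.
Proof.
move=> /square_integrableP[mf fy]; split => //.
have mJ : measurable J by exact: measurable_itvoo.
have [n [mn n0 fn ->]] := strongly_measurable_rnorm_ge0 mJ mf.
have h : ('N[mu]_(2%R%:E)[EFin \o (\1_J : R -> R)])%E = L2_size tau (fun=> 1 : R[i]^o).
  rewrite (@L2_sizeE _ _ _ _ (\1_J))//.
  by apply: aeW => t; rewrite patchE indicE; case: ifP => //=; rewrite /rnorm normr1.
have h2 : ('N[mu]_(2%R%:E)[EFin \o (\1_J : R -> R)] < +oo)%E.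
  by rewrite h; have /square_integrableP[] := square_integrable_cst (1 : R[i]^o).
have := @hoelder _ _ _ mu n (\1_J) 2 2 mn (measurable_indic mJ).
move=> /(_ (ltr0Sn _ _) (ltr0Sn _ _)).
have -> : 2^-1 + 2^-1 = 1 :> R by lra.
move=> /(_ erefl).
rewrite -(L2_sizeE fn) Lnorm1 => hn.
apply: (@le_lt_trans _ _ (\int[mu]_t `|(EFin \o (n \* \1_J)%R) t|)%E).
  apply: ge0_ae_le_integralT => //.
  apply: ae_imply fn => t; rewrite patchE /= indicE; case: ifPn => tJ nt.
    by rewrite mulr1 lee_fin ler_norm.
  by rewrite -nt mulr0 normr0.
apply: le_lt_trans hn _.
by rewrite lte_mul_pinfty// ?Lnorm_ge0// ge0_fin_numE ?Lnorm_ge0// (L2_sizeE fn).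
Qed.

Lemma toL2_val E (f : R -> E) : f \in square_integrable tau (E := E) ->
  {ae mu, forall t, J t -> L2_val (toL2 tau f) t = f t}.
Proof.
move=> fs; have := repr_L2 (insubd (0 : L2fun tau E) f).
by rewrite /toL2 /L2_val /=; apply: ae_imply => t h Jt; rewrite h// insubdK.
Qed.

Lemma L2_eq E (u v : L2 tau E) : {ae mu, forall t, J t -> u t = v t} -> u = v.
Proof.
move=> uv; rewrite -[u]reprK -[v]reprK; by apply/eqP/L2_eqP; exact: uv.
Qed.

Lemma L2_valP E a (u v : L2 tau E) :
  {ae mu, forall t, J t -> L2_val (a *: u + v) t = a *: u t + v t}.
Proof.
have -> : a *: u + v = (\pi_(L2 tau E) (a *: repr u + repr v))%qT.
  by rewrite pi_L2D -pi_L2Z !reprK.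
exact: repr_L2.
Qed.

Lemma L2_val0 E : {ae mu, forall t, J t -> L2_val (0 : L2 tau E) t = 0}.
Proof.
have := L2_valP (-1) (0 : L2 tau E) 0; rewrite scaler0 addr0.
by apply: ae_imply => t h /h; rewrite scaleN1r addNr.
Qed.

Lemma toL2_ae E (f g : R -> E) : f \in square_integrable tau (E := E) ->
  {ae mu, forall t, J t -> f t = g t} -> toL2 tau f = toL2 tau g.
Proof.
move=> fs fg; have gs : g \in square_integrable tau (E := E).
  apply: (square_integrable_le _ fs ler01).
    by apply: strongly_measurable_ae fg _; case/square_integrableP : fs.
  by apply: ae_imply fg => t fg /fg ->; rewrite mul1r.
apply: L2_eq; have ae3 := ae_imply2 (fun t x y => conj x y) (toL2_val fs) (toL2_val gs).
by apply: ae_imply2 ae3 fg => t [hf hg] fg Jt; rewrite hf// hg// fg.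
Qed.

Lemma toL2_linear E a (f g : R -> E) : f \in square_integrable tau (E := E) ->
  g \in square_integrable tau (E := E) ->
  toL2 tau (fun t => a *: f t + g t) = a *: toL2 tau f + toL2 tau g.
Proof.
move=> fs gs; have fgs : (fun t => a *: f t + g t) \in square_integrable tau (E := E).
  apply: square_integrableD => //.
  have /square_integrableP[mf _] := fs.
  apply: (square_integrable_le _ fs (Renorm_ge0 a)).
    exact: strongly_measurableZ.
  by apply: aeW => t _; rewrite rnormZ.
apply: L2_eq; have ae3 := ae_imply2 (fun t x y => conj x y) (toL2_val fs) (toL2_val gs).
have ae4 := ae_imply2 (fun t x y => conj x y) (toL2_val fgs) (L2_valP a (toL2 tau f) (toL2 tau g)).
by apply: ae_imply2 ae3 ae4 => t [hf hg] [h1 h2] Jt; rewrite h1// h2// hf// hg.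
Qed.

Lemma rnorm_L2E E (u : L2 tau E) : (rnorm u)%:E = L2_size tau u.
Proof.
rewrite /rnorm L2_normE/= /L2_norm fineK//; exact: L2_size_fin_num.
Qed.

Lemma rnorm_toL2_le E (f : R -> E) (c : R) : f \in square_integrable tau (E := E) ->
  0 <= c -> (forall t, J t -> rnorm (f t) <= c) ->
  rnorm (toL2 tau f) <= c * fine (L2_size tau (fun=> 1 : R[i]^o)).
Proof.
move=> fs c0 fc; have /square_integrableP[m1 y1] := square_integrable_cst (1 : R[i]^o).
rewrite -lee_fin rnorm_L2E EFinM fineK; last by rewrite ge0_fin_numE ?L2_size_ge0.
rewrite (L2_size_ae (toL2_val fs)).
apply: (@le_trans _ _ (L2_size tau (c%:C *: (fun=> 1 : R[i]^o)))).
  apply: ae_le_Lnorm => //; apply: aeW => t; rewrite !patchE.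
  case: ifPn => //; rewrite inE => Jt.
  rewrite /= !ger0_norm ?rnorm_ge0// (rnormZr (E := R[i]^o) c 1) ger0_norm//.
  by rewrite /rnorm normr1/= mulr1 fc.
by rewrite L2_sizeZ// normc_def/= expr0n/= addr0 sqrtr_sqr ger0_norm.
Qed.

End square_integrable_signals.

(** * The system over one period *)

Section sampled_system.
Context {R : realType} {tau : R} {X U0 Ud0 Y0 : completeNormedModType R[i]}.
Variable S : periodic_system tau X U0 Ud0 Y0.
Local Notation mu := (@lebesgue_measure R).
Local Notation J := (`]0, tau[%classic : set R).

(** The inhomogeneity of the state equation. *)
Definition source (u : R -> U0) (w : R -> Ud0) (s : R) : X :=
  opB S s (u s) + opBd S s (w s).

Lemma Linfty_bochner_integrable (E F : normedModType R[i]) (B : R -> bop E F) (u : R -> E) :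
  Linfty B -> bochner_integrable J u -> bochner_integrable J (fun s => B s (u s)).
Proof.
move=> [mB [M BM]] ui.
apply: (bochner_integrable_le (measurable_itvoo 0 tau) _ ui (normr_ge0 M)).
  apply: strongly_measurable_bop; last exact: ui.1.
  by apply: strongly_measurable_sub mB; exact: aeW.
apply: ae_imply BM => t BM _; apply: le_trans (ler_opnorm _ _) _.
by rewrite ler_wpM2r ?rnorm_ge0// (le_trans BM)// ler_norm.
Qed.

Lemma source_integrable (u : L2 tau U0) (w : L2 tau Ud0) :
  bochner_integrable J (source u w).
Proof.
apply: (bochner_integrableD (measurable_itvoo 0 tau)).
  apply: (Linfty_bochner_integrable (opB_Linfty S)).
  by apply: L2_bochner_integrable; exact: square_integrable_L2.
apply: (Linfty_bochner_integrable (opBd_Linfty S)).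
by apply: L2_bochner_integrable; exact: square_integrable_L2.
Qed.

Lemma source_linear a (u u' : L2 tau U0) (w w' : L2 tau Ud0) :
  {ae mu, forall s, J s ->
    source (L2_val (a *: u + u')) (L2_val (a *: w + w')) s = a *: source u w s + source u' w' s}.
Proof.
apply: ae_imply2 (L2_valP a u u') (L2_valP a w w') => s hu hw Js.
by rewrite /source hu// hw// !linearP scalerDr addrACA.
Qed.

Lemma forced_source_linear t a (u u' : L2 tau U0) (w w' : L2 tau Ud0) : t <= tau ->
  forced S t (source (L2_val (a *: u + u')) (L2_val (a *: w + w'))) =
  a *: forced S t (source u w) + forced S t (source u' w').
Proof.
move=> tt.
have JJ s : `]0, t[%classic s -> J s.
  by rewrite /= !in_itv/= => /andP[-> st]; exact: lt_le_trans tt.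
have sub (v : R -> X) : bochner_integrable J v -> bochner_integrable `]0, t[ v.
  by apply: bochner_integrable_sub; exact: aeW.
rewrite -forced_linear; try by apply: sub; exact: source_integrable.
apply: forced_ae; first by apply: sub; exact: source_integrable.
by apply: ae_imply (source_linear a u u' w w') => s h /JJ; exact: h.
Qed.

(** The state at the end of a period that starts in the state x, under the control
u and the disturbance w. *)
Definition period_state (x : X) (u : L2 tau U0) (w : L2 tau Ud0) : X :=
  evol S tau 0 x + forced S tau (source u w).

Definition output_signal x (u : L2 tau U0) (w : L2 tau Ud0) (t : R) : Y0 :=
  opC S t (evol S t 0 x + forced S t (source u w)) + opD S t (u t).

Definition period_output x (u : L2 tau U0) (w : L2 tau Ud0) : L2 tau Y0 :=
  toL2 tau (output_signal x u w).

Lemma strongly_measurable_evol x : strongly_measurable J (fun t => evol S t 0 x).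
Proof.
apply: (strongly_measurable_right_continuous (H := fun t (_ : X) => evol S t 0 x)
  (strongly_measurable_cst J (0 : X))).
move=> t u _ /andP[t0 tT] ut ucvg _; apply: (@evol_cvg _ _ _ _ _ _ S u (fun=> 0)) => //.
- by move=> n; have /andP[tu _] := ut n; apply: ltW; exact: lt_trans tu.
- exact: ltW.
- exact: cvg_cst.
Qed.

Lemma Linfty_square_integrable (E F : normedModType R[i]) (B : R -> bop E F) (u : R -> E) :
  Linfty B -> u \in square_integrable tau (E := E) ->
  (fun s => B s (u s)) \in square_integrable tau (E := F).
Proof.
move=> [mB [M BM]] us; have /square_integrableP[mu_ _] := us.
apply: (square_integrable_le _ us (normr_ge0 M)).
  apply: strongly_measurable_bop => //.
  by apply: strongly_measurable_sub mB; exact: aeW.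
apply: ae_imply BM => t BM _; apply: le_trans (ler_opnorm _ _) _.
by rewrite ler_wpM2r ?rnorm_ge0// (le_trans BM)// ler_norm.
Qed.

Lemma square_integrable_bounded (E : normedModType R[i]) (f : R -> E) (c : R) :
  strongly_measurable J f -> 0 <= c -> (forall t, J t -> rnorm (f t) <= c) ->
  f \in square_integrable tau (E := E).
Proof.
move=> mf c0 fc; apply: (square_integrable_le mf (square_integrable_cst (1 : R[i]^o)) c0).
by apply: aeW => t /fc; rewrite /rnorm normr1/= mulr1.
Qed.

Lemma square_integrable_evol x : (fun t => evol S t 0 x) \in square_integrable tau (E := X).
Proof.
have [M M0 HM] := evol_bounded S tau.
apply: (@square_integrable_bounded _ _ (M * rnorm x)); first exact: strongly_measurable_evol.
  by rewrite mulr_ge0// rnorm_ge0.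
by move=> t; rewrite /= in_itv/= => /andP[t0 tt]; apply: HM => //; exact: ltW.
Qed.

Lemma square_integrable_forced v : bochner_integrable J v ->
  (fun t => forced S t v) \in square_integrable tau (E := X).
Proof.
move=> vi; have [M M0 HM] := forced_bounded S vi.
apply: (@square_integrable_bounded _ _ M) => //; first exact: strongly_measurable_forced.
by move=> t; rewrite /= in_itv/= => /andP[t0 tt]; apply: HM; rewrite !ltW.
Qed.

(** The state is bounded over one period and strongly measurable; multiplication
by essentially bounded operators preserves square integrability. *)
Lemma square_integrable_output x u w :
  output_signal x u w \in square_integrable tau (E := Y0).
Proof.
apply: square_integrableD.
  apply: (Linfty_square_integrable (opC_Linfty S)).
  apply: square_integrableD; first exact: square_integrable_evol.
  by apply: square_integrable_forced; exact: source_integrable.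
by apply: (Linfty_square_integrable (opD_Linfty S)); exact: square_integrable_L2.
Qed.

Lemma period_state_linear a x x' u u' w w' :
  period_state (a *: x + x') (a *: u + u') (a *: w + w') =
  a *: period_state x u w + period_state x' u' w'.
Proof.
by rewrite /period_state linearP forced_source_linear// scalerDr addrACA.
Qed.

Lemma period_output_linear a x x' u u' w w' :
  period_output (a *: x + x') (a *: u + u') (a *: w + w') =
  a *: period_output x u w + period_output x' u' w'.
Proof.
rewrite /period_output -toL2_linear; try exact: square_integrable_output.
apply: toL2_ae; first exact: square_integrable_output.
apply: ae_imply (L2_valP a u u') => t hu Jt; rewrite /output_signal hu//.
rewrite forced_source_linear; last first.
  by move: Jt; rewrite /= in_itv/= => /andP[_ /ltW].
rewrite (linearP (evol S t 0)) addrACA -scalerDr (linearP (opC S t)) (linearP (opD S t)).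
by rewrite addrACA -scalerDr.
Qed.

Lemma forced_source0 t : t <= tau ->
  forced S t (source (L2_val (0 : L2 tau U0)) (L2_val (0 : L2 tau Ud0))) = 0.
Proof.
move=> tt; have := forced_source_linear (-1) 0 0 0 0 tt.
by rewrite !scaler0 !add0r => ->; rewrite scaleN1r addNr.
Qed.

(** The bound on C(t) holds for almost every t only, so the output is first
changed to 0 on the exceptional null set. *)
Lemma period_output_bounded : exists2 M, 0 <= M &
  forall x, rnorm (period_output x 0 0) <= M * rnorm x.
Proof.
have [_ [MC CM]] := opC_Linfty S; have [M M0 HM] := evol_bounded S tau.
pose L := fine (L2_size tau (fun=> 1 : R[i]^o)).
have L0 : 0 <= L by rewrite fine_ge0// L2_size_ge0.
exists (`|MC| * M * L); first by rewrite !mulr_ge0.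
move=> x; pose f t := if `[< rnorm (opC S t) <= MC >] then opC S t (evol S t 0 x) else 0.
have ae0 : {ae mu, forall t, J t -> output_signal x 0 0 t = f t}.
  apply: ae_imply2 CM (@L2_val0 _ tau U0) => t CM hu Jt; rewrite /output_signal hu// linear0 addr0.
  rewrite /f asboolT//; congr (opC S t _); rewrite -[RHS]addr0; congr (_ + _).
  have tt : t <= tau by move: Jt; rewrite /= in_itv/= => /andP[_ /ltW].
  exact: forced_source0.
rewrite /period_output (toL2_ae (square_integrable_output x 0 0) ae0).
have fs : f \in square_integrable tau (E := Y0).
  apply: (square_integrable_le _ (square_integrable_output x 0 0) ler01).
    apply: strongly_measurable_ae ae0 _.
    by have /square_integrableP[] := square_integrable_output x 0 0.
  by apply: ae_imply ae0 => t h /h ->; rewrite mul1r.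
rewrite mulrAC; apply: rnorm_toL2_le => //.
  by rewrite !mulr_ge0 ?rnorm_ge0.
move=> t; rewrite /= in_itv/= => /andP[t0 tt]; rewrite /f; case: asboolP => [CMt|_]; last first.
  by rewrite rnorm0 !mulr_ge0 ?rnorm_ge0.
apply: le_trans (ler_opnorm _ _) _; rewrite -mulrA; apply: ler_pM.
- exact: opnorm_ge0.
- exact: rnorm_ge0.
- exact: le_trans CMt (ler_norm _).
- by apply: HM => //; exact: ltW.
Qed.

End sampled_system.

(** * The periodic regime *)

Section periodic_regime.
Context {R : realType} {tau : R} {X U0 Ud0 Y0 : completeNormedModType R[i]}.
Variable S : periodic_system tau X U0 Ud0 Y0.
Hypothesis res1 : resolvent_set (evol S tau 0) 1.
Local Notation mu := (@lebesgue_measure R).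
Local Notation J := (`]0, tau[%classic : set R).

Local Notation Res := (resolvent (evol S tau 0) 1).

Lemma resolvent1P : resolvent_of (evol S tau 0) 1 Res.
Proof. exact: (@xgetPex _ 0 [set T | resolvent_of (evol S tau 0) 1 T] res1). Qed.

(** The initial state of the tau-periodic solution. *)
Definition periodic_state (u : L2 tau U0) (w : L2 tau Ud0) : X :=
  Res (forced S tau (source S u w)).

(** The resolvent identity R - T R = I, that is, periodicity of the solution that
starts in [periodic_state]. *)
Lemma period_state_periodic_state u w :
  period_state S (periodic_state u w) u w = periodic_state u w.
Proof.
have [_ /(_ (forced S tau (source S u w)))] := resolvent1P; rewrite scale1r => h.
by rewrite /period_state -[in X in _ + X]h addrC subrK.
Qed.

Lemma periodic_state_linear a u u' w w' :
  periodic_state (a *: u + u') (a *: w + w') =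
  a *: periodic_state u w + periodic_state u' w'.
Proof. by rewrite /periodic_state forced_source_linear// linearP. Qed.

Lemma green_integral t v : bochner_integrable J v ->
  bochner_integral 0 tau (fun s => periodic_green S t s (v s)) =
  evol S t 0 (Res (forced S tau v)).
Proof.
move=> vi; rewrite /forced.
exact: (bochner_integral_bop (compop (evol S t 0) Res) (bochner_integrable_evol S vi)).
Qed.

Lemma source_ae0r u : {ae mu, forall t, J t -> source S u (L2_val (0 : L2 tau Ud0)) t = opB S t (u t)}.
Proof.
by apply: ae_imply (@L2_val0 _ tau Ud0) => t h Jt; rewrite /source h// linear0 addr0.
Qed.

Lemma source_ae0l w : {ae mu, forall t, J t -> source S (L2_val (0 : L2 tau U0)) w t = opBd S t (w t)}.
Proof.
by apply: ae_imply (@L2_val0 _ tau U0) => t h Jt; rewrite /source h// linear0 add0r.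
Qed.

(** Integrating the Green function over ]0, tau[ against a source gives
U(t, 0) (I - T)^-1 applied to the forced state at tau, which is the free response
to the initial state of the periodic solution ([green_integral]). *)
Lemma opP_period_output u : opP S u = period_output S (periodic_state u 0) u 0.
Proof.
have si := source_integrable S u 0.
have vi := bochner_integrable_ae (source_ae0r (L2_val u)) si.
apply/esym/toL2_ae; first exact: square_integrable_output.
apply: aeW => t Jt0; have /andP[t0 tt] : 0 < t < tau by move: Jt0; rewrite /= in_itv.
have Jt s : `]0, t[%classic s -> J s.
  by rewrite /= !in_itv/= => /andP[-> st]; exact: lt_trans tt.
have e : forced S t (source S u (L2_val (0 : L2 tau Ud0))) = forced S t (fun s => opB S s (u s)).
  apply: forced_ae; first by apply: bochner_integrable_sub si; apply: aeW => s; exact: Jt.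
  by apply: ae_imply (source_ae0r (L2_val u)) => s h /Jt; exact: h.
rewrite /output_signal linearD (green_integral t vi) /periodic_state e.
by rewrite (forced_ae S si (source_ae0r (L2_val u))).
Qed.

Lemma opPd_period_output w : opPd S w = period_output S (periodic_state 0 w) 0 w.
Proof.
have si := source_integrable S 0 w.
have vi := bochner_integrable_ae (source_ae0l (L2_val w)) si.
apply/esym/toL2_ae; first exact: square_integrable_output.
apply: ae_imply (@L2_val0 _ tau U0) => t hu Jt0.
have /andP[t0 tt] : 0 < t < tau by move: Jt0; rewrite /= in_itv.
have Jt s : `]0, t[%classic s -> J s.
  by rewrite /= !in_itv/= => /andP[-> st]; exact: lt_trans tt.
have e : forced S t (source S (L2_val (0 : L2 tau U0)) w) = forced S t (fun s => opBd S s (w s)).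
  apply: forced_ae; first by apply: bochner_integrable_sub si; apply: aeW => s; exact: Jt.
  by apply: ae_imply (source_ae0l (L2_val w)) => s h /Jt; exact: h.
rewrite /output_signal linearD (green_integral t vi) /periodic_state hu// linear0 addr0 e.
by rewrite (forced_ae S si (source_ae0l (L2_val w))).
Qed.

Lemma period_output_periodic_state u w :
  period_output S (periodic_state u w) u w = opP S u + opPd S w.
Proof.
rewrite opP_period_output opPd_period_output.
have := periodic_state_linear 1 u 0 0 w.
have := period_output_linear S 1 (periodic_state u 0) (periodic_state 0 w) u 0 0 w.
by rewrite !scale1r addr0 add0r => <- <-.
Qed.

Lemma opP_linear a u u' : opP S (a *: u + u') = a *: opP S u + opP S u'.
Proof.
rewrite !opP_period_output.
have := periodic_state_linear a u u' 0 0.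
have := period_output_linear S a (periodic_state u 0) (periodic_state u' 0) u u' 0 0.
by rewrite scaler0 addr0 => <- <-.
Qed.

End periodic_regime.

(** * The closed loop at the sampling times *)

Section closed_loop_samples.
Context {R : realType} {tau : R} {X U0 Ud0 Y0 : completeNormedModType R[i]}.
Context {Z : normedModType R[i]}.
Variables (S : periodic_system tau X U0 Ud0 Y0) (c : controller tau U0 Y0 Z).
Hypothesis tau0 : 0 < tau.
Variables (x0 : X) (w : L2 tau Ud0) (z : nat -> Z).

Let f := source S (control_input c z) (periodic_extension w).

Lemma source_sample n s : 0 < s < tau ->
  f (n%:R * tau + s) = source S (L2_val (opK c (z n))) w s.
Proof.
move=> st; have ph : phase tau (n%:R * tau + s) = s.
  by rewrite /phase period_indexE// addrAC subrr add0r.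
by rewrite /f /source opB_periodic_nat opBd_periodic_nat /control_input /periodic_extension
  ph period_indexE.
Qed.

Lemma source_integrable_period n :
  bochner_integrable `]n%:R * tau, n.+1%:R * tau[%classic f.
Proof.
have h : bochner_integrable `]0, tau[%classic (fun s => f (n%:R * tau + s)).
  apply: bochner_integrable_ae (source_integrable S (opK c (z n)) w).
  by apply: aeW => s; rewrite /= in_itv/= => st; rewrite source_sample.
have := bochner_integrable_shift (- (n%:R * tau)) (measurable_itvoo 0 tau) h.
have -> : (fun t => f (n%:R * tau + (- (n%:R * tau) + t))) = f.
  by apply/funext => t; rewrite addrA subrr add0r.
apply: bochner_integrable_sub; apply: aeW => t; rewrite /= !in_itv/= => /andP[nt tn].
by rewrite addrC subr_gt0 nt/= ltrBlDl -[X in _ + X]mul1r -mulrDl natr1.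
Qed.

Lemma source_integrable_samples n : bochner_integrable `]0, n%:R * tau[%classic f.
Proof.
elim: n => [|n IH].
  apply: bochner_integrable_sub (source_integrable_period 0); apply: aeW => t.
  by rewrite /= !in_itv/= mul0r => /andP[t0 /(lt_trans t0)]; rewrite ltxx.
have := bochner_integrableU (measurable_itvoo _ _) (measurable_itvoo _ _) IH (source_integrable_period n).
apply: bochner_integrable_sub; apply: ae_imply (ae_neq (n%:R * tau)) => t tn.
rewrite /= !in_itv/= => /andP[t0 tn1].
by move: tn; rewrite neq_lt => /orP[tn|tn]; [left; rewrite t0|right; rewrite tn].
Qed.

(** On the n-th period the control is the signal K z_n and the coefficients repeat
those of the first period, so the state is the mild state over the first period
that starts in the sample at n tau. *)
Lemma closed_loop_stateE n t : 0 <= t <= tau ->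
  closed_loop_state S c x0 w z (n%:R * tau + t) =
  evol S t 0 (closed_loop_state S c x0 w z (n%:R * tau)) +
  forced S t (source S (L2_val (opK c (z n))) w).
Proof.
move=> /andP[t0 tt]; have nt0 : 0 <= n%:R * tau by rewrite mulr_ge0// ltW.
have fi : bochner_integrable `]0, n%:R * tau + t[%classic f.
  apply: bochner_integrable_sub (source_integrable_samples n.+1); apply: aeW => s.
  rewrite /= !in_itv/= => /andP[-> st]; apply: lt_le_trans st _.
  by rewrite -natr1 mulrDl mul1r lerD2l.
have e T : closed_loop_state S c x0 w z T = evol S T 0 x0 + forced S T f by [].
rewrite !e (forced_shift S t0 fi (ltW tau0)) (linearD (evol S t 0)) addrA.
have -> : evol S (n%:R * tau + t) 0 x0 = evol S t 0 (evol S (n%:R * tau) 0 x0).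
  have -> : evol S t 0 = evol S (n%:R * tau + t) (n%:R * tau).
    by rewrite -[X in _ = evol S _ X]addr0 evol_periodic_nat.
  by apply/esym; apply: evol_compE => //; rewrite lerDl.
apply: (f_equal (fun v => _ + v)).
apply: bochner_integral_ext => s /andP[s0 st]; rewrite source_sample// s0.
exact: lt_le_trans tt.
Qed.

Lemma closed_loop_state0 : closed_loop_state S c x0 w z 0 = x0.
Proof. by rewrite /closed_loop_state /mild_state bochner_integral_empty addr0 evol_refl. Qed.

Lemma closed_loop_stateS n : closed_loop_state S c x0 w z (n.+1%:R * tau) =
  period_state S (closed_loop_state S c x0 w z (n%:R * tau)) (opK c (z n)) w.
Proof.
by rewrite -natr1 mulrDl mul1r closed_loop_stateE// lexx ltW.
Qed.

Lemma regulation_errorE yref n : regulation_error S c yref x0 w z n =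
  period_output S (closed_loop_state S c x0 w z (n%:R * tau)) (opK c (z n)) w - yref.
Proof.
congr (_ - _); apply: toL2_ext => t st; rewrite /output opC_periodic_nat opD_periodic_nat.
rewrite -/(closed_loop_state S c x0 w z _) closed_loop_stateE; last first.
  by case/andP: st => /ltW -> /ltW ->.
rewrite /output_signal; congr (_ + opD S t _).
rewrite /control_input period_indexE// /phase period_indexE//.
by rewrite addrAC subrr add0r.
Qed.

End closed_loop_samples.

(** * Seminorms and Hurwitz matrices *)

Section complex_modulus.
Context {R : realType}.
Implicit Types (a b : R[i]).

(** Complex scalars need a real-valued modulus wherever they are compared with
real seminorms. *)
Definition cabs a : R := complex.Re `|a|.

Lemma cabsE a : (cabs a)%:C = `|a|. Proof. exact: Renorm. Qed.
Lemma cabs_ge0 a : 0 <= cabs a. Proof. exact: Renorm_ge0. Qed.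
Lemma cabs0 : cabs 0 = 0. Proof. by rewrite /cabs normr0. Qed.
Lemma cabs1 : cabs 1 = 1. Proof. by rewrite /cabs normr1. Qed.
Lemma cabsN a : cabs (- a) = cabs a. Proof. by rewrite /cabs normrN. Qed.

Lemma cabsM a b : cabs (a * b) = cabs a * cabs b.
Proof. by apply: (@complexI R); rewrite rmorphM /= !cabsE normrM. Qed.

Lemma cabsD a b : cabs (a + b) <= cabs a + cabs b.
Proof. by rewrite -lecR rmorphD/= !cabsE ler_normD. Qed.

Lemma cabs_sum (I : Type) (s : seq I) (P : pred I) (F : I -> R[i]) :
  cabs (\sum_(i <- s | P i) F i) <= \sum_(i <- s | P i) cabs (F i).
Proof.
elim/big_ind2 : _ => //; first by rewrite cabs0.
move=> x a y b xa yb; exact: le_trans (cabsD _ _) (lerD xa yb).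
Qed.

Lemma cabs_real (x : R) : cabs x%:C = `|x|.
Proof. by rewrite /cabs normc_def/= expr0n/= addr0 sqrtr_sqr. Qed.

Lemma cabs_sqr a : cabs a ^+ 2 = complex.Re a ^+ 2 + complex.Im a ^+ 2.
Proof. by case: a => x y; rewrite /cabs normc_def/= sqr_sqrtr// addr_ge0// sqr_ge0. Qed.

(** |1 + e l|^2 = 1 + 2 e Re l + e^2 |l|^2, and the hypothesis on e lets half of
the linear term absorb the quadratic one. *)
Lemma cabs_euler (l : R[i]) (e : R) : complex.Re l < 0 -> 0 < e ->
  e * cabs l ^+ 2 <= - complex.Re l -> cabs (1 + e%:C * l) <= 1 + e * complex.Re l / 2.
Proof.
move=> l0 e0 el; set a := complex.Re l in l0 el *.
have ab : a ^+ 2 <= cabs l ^+ 2 by rewrite cabs_sqr lerDl sqr_ge0.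
have ea : e * - a <= 1.
  have h : e * a ^+ 2 <= - a by apply: le_trans el; rewrite ler_wpM2l// ltW.
  by rewrite -(@ler_pM2r _ (- a)) ?oppr_gt0// mul1r; move: h; rewrite expr2 mulrA; lra.
have b0 : 0 <= 1 + e * a / 2 by move: ea; rewrite mulrN; lra.
rewrite -(@ler_pXn2r _ 2) ?nnegrE ?cabs_ge0// cabs_sqr.
have -> : complex.Re (1 + e%:C * l) = 1 + e * a.
  by case: l @a {l0 el ab ea b0} => x y /=; rewrite mul0r subr0.
have -> : complex.Im (1 + e%:C * l) = e * complex.Im l.
  by case: l @a {l0 el ab ea b0} => x y /=; rewrite mul0r addr0 add0r.
have h : e ^+ 2 * cabs l ^+ 2 <= e * - a.
  by rewrite expr2 -mulrA ler_wpM2l// ltW.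
move: h; rewrite cabs_sqr -/a => h.
have h2 : 0 <= e ^+ 2 * a ^+ 2 by rewrite mulr_ge0// sqr_ge0.
have -> : (1 + e * a / 2) ^+ 2 = 1 + e * a + e ^+ 2 * a ^+ 2 / 4 by field.
have -> : (1 + e * a) ^+ 2 + (e * complex.Im l) ^+ 2 =
  1 + 2 * (e * a) + e ^+ 2 * (a ^+ 2 + complex.Im l ^+ 2) by ring.
by move: h; rewrite mulrN; lra.
Qed.

End complex_modulus.

Section linear_functions.
Context {R : realType} (U V : lmodType R[i]) (f : U -> V).
Hypothesis lf : linear f.

Let g : {linear U -> V} := HB.pack f (GRing.isLinear.Build _ _ _ _ _ lf).

Lemma linear_funZ a x : f (a *: x) = a *: f x.
Proof. by rewrite -[LHS]/(g (a *: x)) linearZ. Qed.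
Lemma linear_funD x y : f (x + y) = f x + f y. Proof. exact: (linearD g). Qed.
Lemma linear_funB x y : f (x - y) = f x - f y. Proof. exact: (linearB g). Qed.

End linear_functions.

Section seminorms.
Context {R : realType}.

Definition seminorm (V : lmodType R[i]) (p : V -> R) : Prop :=
  (forall x y, p (x + y) <= p x + p y) /\ (forall a x, p (a *: x) = cabs a * p x).

Lemma seminorm0 (V : lmodType R[i]) (p : V -> R) : seminorm p -> p 0 = 0.
Proof. by move=> [_ pZ]; rewrite -(scale0r 0) pZ cabs0 mul0r. Qed.

Lemma seminorm_ge0 (V : lmodType R[i]) (p : V -> R) x : seminorm p -> 0 <= p x.
Proof.
move=> sp; have [pD pZ] := sp.
have := pD x (- x); rewrite subrr (seminorm0 sp) -scaleN1r pZ cabsN cabs1 mul1r.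
by lra.
Qed.

Lemma seminormN (V : lmodType R[i]) (p : V -> R) x : seminorm p -> p (- x) = p x.
Proof. by move=> [_ pZ]; rewrite -scaleN1r pZ cabsN cabs1 mul1r. Qed.

Lemma seminorm_rnorm (V : lmodType R[i]) (E : normedModType R[i]) (f : V -> E) :
  linear f -> seminorm (fun x => rnorm (f x)).
Proof.
move=> lf; split=> [x y|a x].
  by rewrite linear_funD//; exact: ler_rnormD.
by rewrite linear_funZ// rnormZ.
Qed.

Lemma cabs_entry r (z : 'cV[R[i]]_r) i : cabs (z i 0) <= rnorm z.
Proof.
rewrite -lecR -rnormE cabsE [leRHS]/Num.Def.normr/= mx_normE.
have -> : `|z i 0| = (`|z i 0|%:nng)%:num by [].
by rewrite num_le; apply/bigmax_geP; right; exists (i, 0).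
Qed.

Lemma cV_sum_delta r (z : 'cV[R[i]]_r) : z = \sum_i z i 0 *: delta_mx i 0.
Proof.
rewrite [LHS]matrix_sum_delta; apply: eq_bigr => i _.
by rewrite big_ord1.
Qed.

Lemma seminorm_sum (V : lmodType R[i]) (p : V -> R) (I : finType) (F : I -> V) :
  seminorm p -> p (\sum_i F i) <= \sum_i p (F i).
Proof.
move=> sp; elim/big_ind2 : _ => //; first by rewrite (seminorm0 sp).
move=> x a y b xa yb; exact: le_trans (sp.1 _ _) (lerD xa yb).
Qed.

(** On C^r every seminorm is dominated by the norm, through the coordinates. So
a linear map defined on the controller state is bounded by its values at the unit
vectors. *)
Lemma seminorm_cV r (p : 'cV[R[i]]_r -> R) : seminorm p ->
  forall z, p z <= (\sum_i p (delta_mx i 0)) * rnorm z.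
Proof.
move=> sp z; rewrite {1}[z]cV_sum_delta mulr_suml.
apply: le_trans (seminorm_sum _ sp) _; apply: ler_sum => i _.
by rewrite sp.2 mulrC ler_wpM2l ?cabs_entry// seminorm_ge0.
Qed.

Lemma exists_pos_lower_bound (I : finType) (f : I -> R) : (forall i, 0 < f i) ->
  exists2 d, 0 < d & forall i, d <= f i.
Proof.
move=> f0; pose s := 1 + \sum_i (f i)^-1.
have s0 : 0 < s.
  by rewrite ltr_pwDl// sumr_ge0// => i _; rewrite invr_ge0 ltW.
exists s^-1 => [|i]; first by rewrite invr_gt0.
rewrite -[leRHS]invrK lef_pV2 ?posrE ?invr_gt0// /s (bigD1 i)//= addrCA lerDl.
by rewrite addr_ge0// sumr_ge0// => j _; rewrite invr_ge0 ltW.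
Qed.

End seminorms.

Section hurwitz_matrices.
Context {R : realType}.

Lemma trigonalization r (A : 'M[R[i]]_r) :
  exists2 P, P \in unitmx & is_trig_mx (P *m A *m invmx P).
Proof.
case: r A => [|r] A.
  by exists 1%:M; rewrite ?unitmx1//; apply/is_trig_mxP => -[].
have [P Pu] := Schur A (ltn0Sn r); rewrite /similar_to conjumx ?unitarymx_unit// => h.
by exists P => //; exact: unitarymx_unit.
Qed.

(** If l is a diagonal entry of the triangular matrix L, then l - L has
determinant 0, and l - A has a nonzero kernel vector and no left inverse. *)
Lemma spectrum_diag r (A P : 'M[R[i]]_r) i : P \in unitmx ->
  is_trig_mx (P *m A *m invmx P) ->
  spectrum (fun z : 'cV[R[i]]_r => A *m z) ((P *m A *m invmx P) i i).
Proof.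
move=> Pu tL; set L := _ *m _ in tL *.
have tLE (j k : 'I_r) : (j < k)%N -> L j k = 0 by move: j k; exact/is_trig_mxP.
set l := L i i => -[S [SA _]].
have dE j k : (l%:M - L) j k = l *+ (j == k) - L j k.
  by rewrite [LHS]mxE [X in X + _]mxE [X in _ + X]mxE.
have dL : \det (l%:M - L) = 0.
  have tlL : is_trig_mx (l%:M - L).
    apply/is_trig_mxP => j k jk; rewrite dE tLE//.
    by rewrite -val_eqE/= ltn_eqF// mulr0n subr0.
  by rewrite (det_trig tlL) (bigD1 i)//= dE eqxx subrr mul0r.
have : \det (l%:M - L)^T == 0 by rewrite det_tr dL.
move=> /det0P[v v0 vL].
have Lv : (l%:M - L) *m v^T = 0 by rewrite -[LHS]trmxK trmx_mul trmxK vL trmx0.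
pose x := invmx P *m v^T.
have Ax : l *: x - A *m x = 0.
  have := congr1 (mulmx (invmx P)) Lv; rewrite mulmx0 mulmxBl mul_scalar_mx mulmxBr.
rewrite -scalemxAr -/x => <-; congr (_ - _).
by rewrite /L -!mulmxA (mulKmx Pu).
have := SA x; rewrite Ax linear0 => x0.
by move: v0; rewrite -[v]trmxK -(mulKVmx Pu v^T) -/x -x0 mulmx0 trmx0 eqxx.
Qed.

Lemma linear_cV_matrix r (N : 'cV[R[i]]_r -> 'cV[R[i]]_r) : linear N ->
  exists A : 'M[R[i]]_r, forall z, N z = A *m z.
Proof.
move=> lN; pose g : {linear 'cV[R[i]]_r -> 'cV[R[i]]_r} :=
  HB.pack N (GRing.isLinear.Build _ _ _ _ _ lN).
exists (\matrix_(i, j) N (delta_mx j 0) i 0) => z.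
rewrite -[N z]/(g z) {1}[z]cV_sum_delta linear_sum; apply/colP => i.
rewrite summxE !mxE; apply: eq_bigr => j _.
by rewrite linearZ !mxE mulrC.
Qed.

(** In coordinates where N is lower triangular, take the weighted sum of the
moduli of the coordinates with the weights h^i. The diagonal entries contract by
[cabs_euler]; an entry below the diagonal gains at least one factor h, so for
small h the strictly lower part costs at most half of the decay 2 d of the
diagonal. *)
Lemma hurwitz_seminorm r (N : 'cV[R[i]]_r -> 'cV[R[i]]_r) : linear N ->
  (forall l, spectrum N l -> complex.Re l < 0) ->
  exists p C d e0, [/\ seminorm p, forall z, rnorm z <= C * p z, 0 < d, 0 < e0 &
    forall e z, 0 < e -> e <= e0 -> p (z + e%:C *: N z) <= (1 - d * e) * p z].
Proof.
move=> /linear_cV_matrix[A NA] sN.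
have {}sN l : spectrum (fun z : 'cV[R[i]]_r => A *m z) l -> complex.Re l < 0.
  by rewrite (_ : (fun z => _) = N); [exact: sN|apply/funext => z; rewrite NA].
have [P Pu tL] := trigonalization A.
have ev i := sN _ (@spectrum_diag r A P i Pu tL).
set L := P *m A *m invmx P in tL ev.
have tLE (j k : 'I_r) : (j < k)%N -> L j k = 0 by move: j k; exact/is_trig_mxP.
have [d d0 dL] : exists2 d, 0 < d & forall i, d <= - complex.Re (L i i) / 4.
  by apply: exists_pos_lower_bound => i; rewrite divr_gt0// oppr_gt0.
pose s j := \sum_i cabs (L i j).
have s0 j : 0 <= s j by rewrite sumr_ge0// => i _; exact: cabs_ge0.
have [h' h'0 h'L] : exists2 h, 0 < h & forall j, h <= d / (s j + 1).
  by apply: exists_pos_lower_bound => j; rewrite divr_gt0// ltr_wpDl.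
(* h <= 1 is for the entries further below the diagonal, which gain h^(i-j) *)
pose h := Num.min h' 1.
have h0 : 0 < h by rewrite lt_min h'0 ltr01.
have h1 : h <= 1 by rewrite ge_min lexx orbT.
have hL j : h * s j <= d.
  apply: (@le_trans _ _ (h * (s j + 1))); first by rewrite ler_wpM2l ?lerDl ?ler01// ltW.
  by rewrite -ler_pdivlMr ?ltr_wpDl// (le_trans _ (h'L j))// ge_min lexx.
have [e0 e00 e0L] : exists2 e, 0 < e & forall j, e <= - complex.Re (L j j) / (cabs (L j j) ^+ 2 + 1).
  by apply: exists_pos_lower_bound => j; rewrite divr_gt0 ?oppr_gt0// ltr_wpDl// sqr_ge0.
pose w (i : 'I_r) := h ^+ i.
have w0 i : 0 < w i by exact: exprn_gt0.
pose p (z : 'cV[R[i]]_r) := \sum_i w i * cabs ((P *m z) i 0).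
have sp : seminorm p.
  split=> [x y|a x].
    rewrite /p -big_split/=; apply: ler_sum => i _.
    by rewrite -mulrDr ler_wpM2l ?(ltW (w0 i))// mulmxDr mxE cabsD.
  rewrite /p mulr_sumr; apply: eq_bigr => i _.
  by rewrite -scalemxAr mxE cabsM mulrCA.
exists p, (\sum_i rnorm (invmx P *m delta_mx i 0 : 'cV[R[i]]_r) / w i), d, e0; split => //.
  move=> z; rewrite -{1}[z](mulKmx Pu) {1}[P *m z]cV_sum_delta mulmx_sumr.
  apply: le_trans (ler_rnorm_sum _ _ _) _; rewrite mulr_suml; apply: ler_sum => i _.
  rewrite -scalemxAr rnormZ -/(cabs _) mulrC.
  rewrite -mulrA ler_wpM2l ?rnorm_ge0//.
  rewrite ler_pdivlMl// /p (bigD1 i)//= lerDl sumr_ge0// => j _.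
  by rewrite mulr_ge0 ?cabs_ge0// ltW.
move=> e z epos ee0; set y := P *m z.
have Py : P *m (z + e%:C *: N z) = y + e%:C *: (L *m y).
  by rewrite mulmxDr -scalemxAr NA /L /y -!mulmxA mulKmx.
rewrite /p Py -/y mulr_sumr.
apply: (@le_trans _ _ (\sum_i \sum_j (if j == i then w i * (cabs (1 + e%:C * L i i) * cabs (y i 0)) else
    if (j < i)%N then e * (w i * cabs (L i j) * cabs (y j 0)) else 0))).
  apply: ler_sum => i _; rewrite (bigD1 i)//= eqxx.
  rewrite [X in _ <= _ + X](_ : _ = \sum_(j < r | j != i)
      w i * (if (j < i)%N then e * (cabs (L i j) * cabs (y j 0)) else 0)); last first.
    apply: eq_bigr => j /negbTE ->; case: ifP; rewrite ?mulr0// => _; ring.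
  have yE : (y + e%:C *: (L *m y)) i 0 = y i 0 + e%:C * \sum_j L i j * y j 0.
    by rewrite [LHS]mxE; congr (_ + _); rewrite [LHS]mxE; congr (_ * _); rewrite [LHS]mxE.
  rewrite -mulr_sumr -mulrDr ler_wpM2l ?(ltW (w0 i))// yE (bigD1 i)//= mulrDr addrA.
  rewrite mulrA -{1}[y i 0]mul1r -mulrDl.
  apply: le_trans (cabsD _ _) _; rewrite cabsM lerD2l mulr_sumr.
  apply: le_trans (cabs_sum _ _ _) _; apply: ler_sum => j ji.
  rewrite !cabsM cabs_real gtr0_norm//; case: ltnP => [//|ij].
  rewrite tLE; first by rewrite cabs0 mul0r mulr0.
  by rewrite ltn_neqAle ij andbT eq_sym.
rewrite exchange_big/=; apply: ler_sum => j _.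
rewrite (bigD1 j)//= eqxx.
have m_le : cabs (1 + e%:C * L j j) <= 1 - 2 * d * e.
  have he : e * cabs (L j j) ^+ 2 <= - complex.Re (L j j).
    apply: (@le_trans _ _ (e * (cabs (L j j) ^+ 2 + 1))).
      by rewrite ler_wpM2l ?lerDl ?ler01// ltW.
    rewrite -ler_pdivlMr; first exact: le_trans (e0L j).
    by rewrite ltr_wpDl// sqr_ge0.
  apply: le_trans (cabs_euler (ev j) epos he) _.
  have := dL j; rewrite -(ler_pM2l epos); lra.
have sum_le : \sum_(i < r | i != j)
    (if j == i then w i * (cabs (1 + e%:C * L i i) * cabs (y i 0)) else
     if (j < i)%N then e * (w i * cabs (L i j) * cabs (y j 0)) else 0) <=
    e * d * (w j * cabs (y j 0)).
  apply: (@le_trans _ _ (\sum_i e * (h * w j * cabs (L i j) * cabs (y j 0)))); last first.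
    rewrite (eq_bigr (fun i => (e * (w j * cabs (y j 0)) * h) * cabs (L i j))); last first.
      by move=> i _; ring.
    rewrite -mulr_sumr -/(s j) -mulrA.
    have -> : e * d * (w j * cabs (y j 0)) = e * (w j * cabs (y j 0)) * d by ring.
    by rewrite ler_wpM2l ?hL// !mulr_ge0 ?cabs_ge0// ltW.
  rewrite [leLHS]big_mkcond/=; apply: ler_sum => i _.
  have rhs0 : 0 <= e * (h * w j * cabs (L i j) * cabs (y j 0)).
    by rewrite !mulr_ge0 ?cabs_ge0// ltW.
  case: eqVneq => //= ij; case: ltnP => // ji.
  rewrite ler_wpM2l ?(ltW epos)// ler_wpM2r ?cabs_ge0// ler_wpM2r ?cabs_ge0//.
  by rewrite /w -exprS ler_wiXn2l// ltW.
apply: le_trans (lerD (lexx _) sum_le) _.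
have -> : w j * (cabs (1 + e%:C * L j j) * cabs (y j 0)) =
  cabs (1 + e%:C * L j j) * (w j * cabs (y j 0)) by ring.
have wy0 : 0 <= w j * cabs (y j 0) by rewrite mulr_ge0 ?cabs_ge0// ltW.
rewrite -mulrDl ler_wpM2r//; lra.
Qed.

End hurwitz_matrices.

(** * Operators with decaying powers *)

Section power_bounded.
Context {R : realType}.

(** The sum of rho^-k |T^k x| over k <= m with q < rho < 1: applying T shifts the
sum by one index, which gives the factor rho, and the term k = m + 1 that
appears is at most the term k = 0 that disappears once M rho^(m+1) <= 1. Here
rho is the square root of q. *)
Lemma adapted_seminorm (X : normedModType R[i]) (T : bop X X) (M q : R) :
  0 <= M -> 0 < q < 1 -> (forall n x, rnorm (iter n T x) <= M * q ^+ n * rnorm x) ->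
  exists p C rho, [/\ seminorm p, forall x, rnorm x <= p x, forall x, p x <= C * rnorm x,
    0 <= rho < 1 & forall x, p (T x) <= rho * p x].
Proof.
move=> M0 /andP[q0 q1] HT; pose rho := Num.sqrt q.
have rho0 : 0 < rho by rewrite sqrtr_gt0.
have rhoq : rho ^+ 2 = q by rewrite sqr_sqrtr// ltW.
have rho1 : rho < 1 by rewrite -sqrtr1 ltr_sqrt.
have [m Mm] : exists m, M * rho ^+ m.+1 <= 1.
  have M1 : 0 < (M + 1)^-1 by rewrite invr_gt0 ltr_wpDl.
  have rhoN : `|rho| < 1 by rewrite gtr0_norm.
  have /cvgrPdist_lt /(_ _ M1)[m _ Hm] := cvg_expr rhoN.
  exists m; have := Hm m.+1 (leqnSn m).
  rewrite /= sub0r normrN gtr0_norm ?exprn_gt0// => hm.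
  apply: (@le_trans _ _ (M * (M + 1)^-1)); first by rewrite ler_wpM2l// ltW.
  by rewrite ler_pdivrMr ?ltr_wpDl// mul1r lerDl.
pose p x := \sum_(k < m.+1) rho ^- k * rnorm (iter k T x).
have itl k a x y : iter k T (a *: x + y) = a *: iter k T x + iter k T y.
  by elim: k => //= k ->; rewrite linearP.
have rk k : 0 < rho ^- k by rewrite invr_gt0 exprn_gt0.
have iT k (x : X) : iter k T (T x) = iter k.+1 T x by rewrite iterSr.
exists p, (\sum_(k < m.+1) rho ^- k * (M * q ^+ k)), rho; split.
- split=> [x y|a x].
    rewrite /p -big_split/=; apply: ler_sum => k _; rewrite -mulrDr ler_wpM2l ?(ltW (rk k))//.
    by have := itl k 1 x y; rewrite !scale1r => ->; exact: ler_rnormD.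
  rewrite /p mulr_sumr; apply: eq_bigr => k _.
  have -> : iter k T (a *: x) = a *: iter k T x.
    have i0 : iter k T 0 = 0 by elim: (nat_of_ord k) => //= j ->; rewrite linear0.
    by rewrite -[a *: x]addr0 itl i0 addr0.
  by rewrite rnormZ mulrCA.
- move=> x; rewrite /p big_ord_recl/= expr0 invr1 mul1r lerDl sumr_ge0// => k _.
  by rewrite mulr_ge0 ?rnorm_ge0// ltW.
- move=> x; rewrite /p mulr_suml; apply: ler_sum => k _.
  by rewrite -mulrA ler_wpM2l// ltW.
- by rewrite ltW.
- move=> x; rewrite /p (eq_bigr (fun k : 'I_m.+1 => rho ^- k * rnorm (iter k.+1 T x))); last first.
    by move=> k _; rewrite iT.
  rewrite big_ord_recr/= [X in _ <= _ * X]big_ord_recl/= mulrDr addrC; apply: lerD.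
    rewrite expr0 invr1 mul1r; have := HT m.+1 x => /= h.
    rewrite ler_pdivrMl ?exprn_gt0// mulrA -exprSr; apply: le_trans h _.
    rewrite ler_wpM2r ?rnorm_ge0// -rhoq -exprM mulnC exprM expr2 mulrA.
    by rewrite ler_piMl// exprn_ge0// ltW.
  rewrite mulr_sumr; apply: ler_sum => k _; rewrite /bump/= add1n mulrA ler_wpM2r ?rnorm_ge0//.
  by rewrite exprS invfM mulrA divff ?gt_eqF// mul1r.
Qed.

(** The Neumann series of (I - T)^-1 converges. *)
Lemma neumann_resolvent (X : completeNormedModType R[i]) (T : bop X X) (M q : R) :
  0 <= M -> 0 < q < 1 -> (forall n x, rnorm (iter n T x) <= M * q ^+ n * rnorm x) ->
  resolvent_set T 1.
Proof.
move=> M0 /andP[q0 q1] HT.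
have qN : `|q| < 1 by rewrite gtr0_norm.
have q1' : 0 < 1 - q by rewrite subr_gt0.
pose s n x := \sum_(k < n) iter k T x.
have sd n k x : rnorm (s (n + k)%N x - s n x) <= M * rnorm x / (1 - q) * (q ^+ n - q ^+ (n + k)).
  elim: k => [|k IH]; first by rewrite addn0 !subrr rnorm0 mulr0.
  apply: le_trans (ler_rnorm_distD (s (n + k)%N x) _ _) _.
  rewrite addnS {1}/s big_ord_recr/= -/(s _ x) addrAC subrr add0r.
  have := HT (n + k)%N x; rewrite [q ^+ _.+1]exprS.
  set a := q ^+ (n + k); set b := q ^+ n in IH *.
  have -> : M * a * rnorm x = M * rnorm x / (1 - q) * (a - q * a).
    by field; rewrite gt_eqF.
  move: IH; rewrite -/a; set c := M * rnorm x / (1 - q).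
  move=> h1 h2; have := lerD h2 h1; congr (_ <= _); ring.
have c0 (x : X) : 0 <= M * rnorm x / (1 - q) by rewrite !mulr_ge0 ?rnorm_ge0// invr_ge0 ltW.
have /choice[L HL] : forall x : X, exists l : X, s n x @[n --> \oo] --> l.
  move=> x; apply: rnorm_complete => e e0.
  have e1 : 0 < e / (M * rnorm x / (1 - q) + 1) by rewrite divr_gt0// ltr_wpDl.
  have /cvgrPdist_lt /(_ _ e1)[N _ HN] := cvg_expr qN.
  exists N => n Nn; rewrite -(subnKC Nn); apply: le_lt_trans (sd _ _ _) _.
  have := HN N (leqnn N); rewrite /= sub0r normrN gtr0_norm ?exprn_gt0//.
  rewrite ltr_pdivlMr ?ltr_wpDl// => h; apply: le_lt_trans h; rewrite mulrC.
  apply: ler_pM => //; last by rewrite lerDl.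
  by rewrite subr_ge0 ler_wiXn2l ?ltW// leq_addr.
  by rewrite gerBl exprn_ge0// ltW.
have sl n a x y : s n (a *: x + y) = a *: s n x + s n y.
  rewrite /s scaler_sumr -big_split/=; apply: eq_bigr => k _.
  by elim: (nat_of_ord k) => //= j ->; rewrite linearP.
have Lb : L \in bounded_op.
  apply/asboolP; split.
    move=> a x y; apply: rnorm_cvg_unique (HL _) _.
    apply: cvg_seq_ext (fun n => esym (sl n a x y)) _.
    by apply: cvgD => //; apply: cvgZr.
  exists (M / (1 - q)) => x; apply: cvg_rnorm_le (HL x) _ => n.
  have := sd 0%N n x; rewrite add0n {2}/s big_ord0 subr0 => h; apply: le_trans h _.
  have -> : M / (1 - q) * rnorm x = M * rnorm x / (1 - q) by rewrite mulrAC.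
  rewrite -[leRHS]mulr1; apply: ler_wpM2l; first exact: c0.
  by rewrite expr0 gerBl exprn_ge0// ltW.
have Tn0 x : x - iter n T x @[n --> \oo] --> x.
  rewrite -[X in _ --> X]subr0; apply: cvgB; first exact: cvg_cst.
  apply: (@rnorm_cvg_squeeze _ _ (fun n => M * q ^+ n * rnorm x)).
    by move=> n; rewrite subr0.
  rewrite -[0 in X in _ --> X](mul0r (rnorm x)); apply: cvgM; last exact: cvg_cst.
  rewrite -[0 in X in _ --> X](mulr0 M); apply: cvgM; first exact: cvg_cst.
  exact: cvg_expr.
have Ts n x : T (s n x) = s n.+1 x - x.
  by rewrite /s linear_sum [in RHS]big_ord_recl/= addrAC subrr add0r.
have sT n x : s n (T x) = s n.+1 x - x.
  rewrite /s [in RHS]big_ord_recl/= addrAC subrr add0r; apply: eq_bigr => k _.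
  by rewrite -iterSr.
exists (Bop Lb); split=> x /=; rewrite scale1r.
  apply: rnorm_cvg_unique (HL _) _; apply: cvg_seq_ext (Tn0 x) => n.
  have -> : s n (x - T x) = s n x - s n (T x).
    by rewrite addrC -scaleN1r sl scaleN1r addrC.
  by rewrite sT {2}/s big_ord_recr/= -/(s n x) opprB addrCA opprD addNKr.
have h : s n x - T (s n x) @[n --> \oo] --> L x - T (L x).
  by apply: cvgB => //; exact: bop_cvg.
apply: rnorm_cvg_unique h _; apply: cvg_seq_ext (Tn0 x) => n.
by rewrite Ts {2}/s big_ord_recr/= -/(s n x) opprB addrCA opprD addNKr.
Qed.

End power_bounded.

(** * Coupled recursions *)

Section coupled_recursion.
Context {R : realType}.

(** The weighted sum b P + Z decays when b is large enough for the decay of P to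
absorb the coupling a P, and then e small enough for the decay d e of Z to absorb
b e^2 k Z. The first choice is free of e, and this is where the e^2 matters: a
coupling of order e from Z into P would compete with the decay d e. *)
Lemma coupled_decay (rho h k a d : R) : 0 <= rho < 1 -> 0 <= h -> 0 <= k -> 0 <= a -> 0 < d ->
  exists e0 C, [/\ 0 < e0, 0 <= C & forall e, 0 < e -> e <= e0 ->
    exists2 kappa, 0 < kappa < 1 & forall P Z : nat -> R,
      (forall n, 0 <= P n) -> (forall n, 0 <= Z n) ->
      (forall n, P n.+1 <= (rho + e * h) * P n + e ^+ 2 * k * Z n) ->
      (forall n, Z n.+1 <= (1 - d * e) * Z n + a * P n) ->
      forall n, P n + Z n <= C * kappa ^+ n * (P 0%N + Z 0%N)].
Proof.
move=> /andP[rho0 rho1] h0 k0 a0 d0.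
(* b >= 1 makes b P + Z dominate P + Z *)
pose b := 4 * a / (1 - rho) + 1.
have r1 : 0 < 1 - rho by rewrite subr_gt0.
have b1 : 1 <= b by rewrite lerDr divr_ge0 ?mulr_ge0// ltW.
have b0 : 0 < b by exact: lt_le_trans b1.
have ab : 4 * a <= b * (1 - rho).
  by rewrite [leRHS]mulrDl divfK ?gt_eqF// lerDl mul1r ltW.
pose e1 := (1 - rho) / (4 * (h + 1)).
pose e2 := d / (2 * b * (k + 1)).
pose e3 := (2 * d)^-1.
have e10 : 0 < e1 by rewrite divr_gt0// mulr_gt0// ltr_wpDl.
have e20 : 0 < e2 by rewrite divr_gt0// !mulr_gt0// ltr_wpDl.
have e30 : 0 < e3 by rewrite invr_gt0 mulr_gt0.
exists (Num.min e1 (Num.min e2 e3)), b; split; [by rewrite !lt_min e10 e20|exact: ltW|].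
move=> e epos; rewrite !le_min => /and3P[ee1 ee2 ee3].
have he : e * h <= (1 - rho) / 4.
  have : e * (4 * (h + 1)) <= 1 - rho by rewrite -ler_pdivlMr// mulr_gt0// ltr_wpDl.
  by move: (ltW epos); nra.
have ke : b * (e ^+ 2 * k) <= d * e / 2.
  have : e * (2 * b * (k + 1)) <= d by rewrite -ler_pdivlMr// !mulr_gt0// ltr_wpDl.
  move=> hh; have : e * (b * k) <= d / 2 by have := mulr_gt0 epos b0; move: hh; nra.
  by rewrite -(ler_pM2l epos); rewrite expr2; lra.
have de : d * e <= 1 / 2.
  have : e * (2 * d) <= 1 by rewrite -ler_pdivlMr ?mulr_gt0// div1r.
  by lra.
have de0 : 0 < d * e by exact: mulr_gt0.
pose kappa := Num.max (1 - d * e / 2) ((1 + rho) / 2).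
have k1 : kappa < 1 by rewrite gt_max; apply/andP; split; lra.
have kk0 : 0 < kappa by rewrite lt_max; apply/orP; left; lra.
exists kappa; first by rewrite kk0.
move=> P Z P0 Z0 HP HZ n.
have V m : b * P m + Z m <= kappa ^+ m * (b * P 0%N + Z 0%N).
  elim: m => [|m IH]; first by rewrite expr0 mul1r.
  rewrite exprS -mulrA; apply: (@le_trans _ _ (kappa * (b * P m + Z m))); last first.
    by rewrite ler_wpM2l// ltW.
  have hP := HP m; have hZ := HZ m.
  apply: (@le_trans _ _ (b * ((rho + e * h) * P m + e ^+ 2 * k * Z m) +
     ((1 - d * e) * Z m + a * P m))); first by rewrite lerD// ler_wpM2l// ltW.
  have kz : (1 - d * e / 2) * Z m <= kappa * Z m by rewrite ler_wpM2r// le_max lexx.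
  have kp : (1 + rho) / 2 * (b * P m) <= kappa * (b * P m).
    by apply: ler_wpM2r; [rewrite mulr_ge0// ltW|rewrite le_max lexx orbT].
  have t1 : b * (e ^+ 2 * k) * Z m <= d * e / 2 * Z m by rewrite ler_wpM2r.
  have t2 : a * P m <= b * (1 - rho) / 4 * P m by rewrite ler_wpM2r//; lra.
  have t3 : (e * h) * (b * P m) <= (1 - rho) / 4 * (b * P m).
    by rewrite ler_wpM2r// mulr_ge0// ltW.
  by move: kz kp t1 t2 t3; set kap := kappa; lra.
apply: (@le_trans _ _ (b * P n + Z n)).
  by rewrite lerD2r ler_peMl.
apply: le_trans (V n) _; rewrite [b * _]mulrC -mulrA mulrCA ler_wpM2l ?exprn_ge0 ?(ltW kk0)//.
by rewrite [leRHS]mulrC mulrDl mulrC lerD2l ler_peMr.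
Qed.

End coupled_recursion.

(** * Linear maps of the sampled system *)

Section linear_in_the_signals.
Context {R : realType} {tau : R} {X U0 Ud0 Y0 : completeNormedModType R[i]}.
Variable S : periodic_system tau X U0 Ud0 Y0.

Lemma period_stateB x x' u u' w w' :
  period_state S (x - x') (u - u') (w - w') = period_state S x u w - period_state S x' u' w'.
Proof.
have := period_state_linear S (-1) x' x u' u w' w.
by rewrite !scaleN1r !(addrC (- _)).
Qed.

Lemma period_outputB x x' u u' w w' :
  period_output S (x - x') (u - u') (w - w') = period_output S x u w - period_output S x' u' w'.
Proof.
have := period_output_linear S (-1) x' x u' u w' w.
by rewrite !scaleN1r !(addrC (- _)).
Qed.

Lemma period_stateD x x' u u' w w' :
  period_state S (x + x') (u + u') (w + w') = period_state S x u w + period_state S x' u' w'.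
Proof. by have := period_state_linear S 1 x x' u u' w w'; rewrite !scale1r. Qed.

Lemma period_outputD x x' u u' w w' :
  period_output S (x + x') (u + u') (w + w') = period_output S x u w + period_output S x' u' w'.
Proof. by have := period_output_linear S 1 x x' u u' w w'; rewrite !scale1r. Qed.

Lemma period_state_free x : period_state S x 0 0 = evol S tau 0 x.
Proof. by rewrite /period_state forced_source0// addr0. Qed.

Lemma linear_period_output : linear (fun x => period_output S x 0 0).
Proof. by move=> a x y; rewrite -period_output_linear !scaler0 !addr0. Qed.

Lemma free_output_bounded :
  (fun x => period_output S x 0 0) \in @bounded_op R X (L2 tau Y0).
Proof.
apply/asboolP; split; first exact: linear_period_output.
by have [M _ HM] := period_output_bounded S; exists M.
Qed.

Definition free_output : bop X (L2 tau Y0) := Bop free_output_bounded.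

Lemma period_output_split x u w : period_output S x u w = free_output x + period_output S 0 u w.
Proof. by have := period_outputD x 0 0 u 0 w; rewrite addr0 !add0r. Qed.

End linear_in_the_signals.

Section linear_in_the_control.
Context {R : realType} {tau : R} {X U0 Ud0 Y0 : completeNormedModType R[i]}.
Variable S : periodic_system tau X U0 Ud0 Y0.

Lemma linear_opP : linear (opP S).
Proof. by move=> a u v; rewrite opP_linear. Qed.

Lemma linear_periodic_state : linear (fun u => periodic_state S u 0).
Proof.
by move=> a u v; have := periodic_state_linear S a u v 0 0; rewrite scaler0 addr0.
Qed.

Lemma linear_controlled_output : linear (fun u => period_output S 0 u 0).
Proof. by move=> a u v; rewrite -period_output_linear !scaler0 !addr0. Qed.

End linear_in_the_control.

Section injective_matrix.
Context {R : realType}.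

Lemma injective_linear_cV r (N : 'cV[R[i]]_r -> 'cV[R[i]]_r) : linear N ->
  (forall z, N z = 0 -> z = 0) -> forall y, exists z, N z = y.
Proof.
move=> /linear_cV_matrix[A NA] inj y.
have uA : A \in unitmx.
  rewrite unitmxE unitfE -det_tr; apply/negP => /det0P[v v0 vA].
  have : N v^T = 0 by rewrite NA -[A]trmxK -trmx_mul vA trmx0.
  by move=> /inj vT; move: v0; rewrite -[v]trmxK vT trmx0 eqxx.
by exists (invmx A *m y); rewrite NA mulKVmx.
Qed.

End injective_matrix.

(** * Regulation from stability *)

Section regulation.
Context {R : realType} {tau : R} {X U0 Ud0 Y0 : completeNormedModType R[i]}.
Variable S : periodic_system tau X U0 Ud0 Y0.
Variables (YN : vsubspace (L2 tau Y0)) (r : nat) (QN : bop (L2 tau Y0) (vsub YN)).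
Variables (G20 : bop (vsub YN) 'cV[R[i]]_r) (K : bop 'cV[R[i]]_r (L2 tau U0)).
Hypothesis tau0 : 0 < tau.
Hypothesis G20i : boundedly_invertible G20.
Hypothesis res1 : resolvent_set (evol S tau 0) 1.

Let c := Controller (idop 'cV[R[i]]_r) (compop G20 QN) K.

Hypothesis stable : closed_loop_exponentially_stable S c.

Lemma G20_eq0 y : G20 y = 0 -> y = 0.
Proof.
have [G [G1 G2]] := G20i; move=> h.
by rewrite -[y]G1 h bop0.
Qed.

Lemma expR_decay (a C : R) : 0 < a -> C * expR (- a * n%:R) @[n --> \oo] --> 0.
Proof.
move=> a0; rewrite -[0 in X in _ --> X](mulr0 C); apply: cvgM; first exact: cvg_cst.
have q1 : `|expR (- a)| < 1 by rewrite ger0_norm ?expR_ge0// expR_lt1 oppr_lt0.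
apply: cvg_seq_ext (cvg_expr q1) => n.
by rewrite expRM_natr.
Qed.

(** The stability of the closed loop, read at the sampling times. *)
Lemma closed_loop_decay x0 z0 z : closed_loop S c 0 0 x0 z0 z ->
  z n @[n --> \oo] --> 0 /\ closed_loop_state S c x0 0 z (n%:R * tau) @[n --> \oo] --> 0.
Proof.
have [M0 [M1 [a0 [a1 [M0p M1p a0p a1p H]]]]] := stable.
move=> /H[Hx Hz]; split.
  apply: (@rnorm_cvg_squeeze _ _ (fun n => M1 * (rnorm x0 + rnorm z0) * expR (- a1 * n%:R))).
    by move=> n; rewrite subr0 mulrAC; exact: Hz.
  exact: expR_decay.
apply: (@rnorm_cvg_squeeze _ _ (fun n => M0 * (rnorm x0 + rnorm z0) * expR (- (a0 * tau) * n%:R))).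
  move=> n; rewrite subr0 mulrAC; apply: le_trans (Hx _ _) _.
    by rewrite mulr_ge0// ltW.
  by have -> : - a0 * (n%:R * tau) = - (a0 * tau) * n%:R by ring.
by apply: expR_decay; exact: mulr_gt0.
Qed.

(** With z_n = v and x_n the periodic state for the control K v, the error has
Q_N e = 0, so the controller rests and (x_n, z_n) is a constant trajectory of the
closed loop without external signals. A constant that decays is 0. *)
Lemma gain_injective v : QN (opP S (K v)) = 0 -> v = 0.
Proof.
move=> Qv; pose xi := periodic_state S (K v) 0.
have cl : closed_loop S c 0 0 xi v (fun=> v).
split=> // n. rewrite regulation_errorE// subr0.
 have -> : closed_loop_state S c xi 0 (fun=> v) (n%:R * tau) = xi.
    elim: n => [|n IH]; first by rewrite mul0r closed_loop_state0.
   rewrite (closed_loop_stateS S c tau0 xi 0 (fun=> v) n) IH.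
   exact (period_state_periodic_state res1 (K v) 0).
 rewrite -(opP_period_output S) /=.
 by rewrite Qv bop0 addr0.
have [vcvg _] := closed_loop_decay cl.
exact: rnorm_cvg_unique (cvg_cst v) vcvg.
Qed.

(** Superposition: a trajectory minus the equilibrium (periodic state, zinf) is a
trajectory without external signals, so it decays, and with it the difference
between the error and the error e of the equilibrium. *)
Lemma regulation_of_stability : approximately_regulates S c QN.
Proof.
move=> yref w.
pose N v := G20 (QN (opP S (K v))).
have lN : linear N.
  by move=> a x y; rewrite /N (bopP1 K) (opP_linear S) (bopP1 QN) (bopP1 G20).
have Ninj v : N v = 0 -> v = 0 by move=> /G20_eq0; exact: gain_injective.
(* zinf is the controller state of the equilibrium, xinf below its sampled state *)
have [zinf zinfE] := injective_linear_cV lN Ninj (G20 (QN yref - QN (opPd S w))).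
have QE : QN (opP S (K zinf)) = QN yref - QN (opPd S w).
  by apply: subr0_eq; apply: G20_eq0; rewrite bopB -/(N zinf) zinfE subrr.
exists zinf; split.
  split=> // v Qv; apply/eqP; rewrite -subr_eq0; apply/eqP; apply: gain_injective.
  by rewrite (bopB K) (linear_funB (linear_opP S)) (bopB QN) QE Qv subrr.
move=> x0 z0 z [z00 zS] e.
have Qe : QN e = 0 by rewrite /e (bopB QN) (bopD QN) QE subrK subrr.
rewrite Qe; have -> : e - vsub_val (0 : vsub YN) = e by rewrite subr0.
pose xinf := periodic_state S (K zinf) w.
pose z' n := z n - zinf.
have KB n : opK c (z' n) = K (z n) - K zinf by rewrite -(bopB K).
have x'E n : closed_loop_state S c (x0 - xinf) 0 z' (n%:R * tau) =
    closed_loop_state S c x0 w z (n%:R * tau) - xinf.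
  elim: n => [|n IH]; first by rewrite mul0r !closed_loop_state0.
  rewrite (closed_loop_stateS S c tau0 (x0 - xinf)) (closed_loop_stateS S c tau0 x0) IH KB.
  have hx : period_state S xinf (K zinf) w = xinf := period_state_periodic_state res1 (K zinf) w.
  have := period_stateB S (closed_loop_state S c x0 w z (n%:R * tau)) xinf (K (z n)) (K zinf) w w.
  by rewrite subrr => ->; congr (_ - _); exact: hx.
have e'E n : regulation_error S c 0 (x0 - xinf) 0 z' n = regulation_error S c yref x0 w z n - e.
  rewrite (regulation_errorE S c tau0 (x0 - xinf)) (regulation_errorE S c tau0 x0) x'E KB subr0.
  have := period_outputB S (closed_loop_state S c x0 w z (n%:R * tau)) xinf (K (z n)) (K zinf) w w.
  rewrite subrr => ->; rewrite (period_output_periodic_state S (K zinf) w).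
  by rewrite /e opprB addrA subrK.
have cl : closed_loop S c 0 0 (x0 - xinf) (z0 - zinf) z'.
  split=> [|n]; first by rewrite /z' z00.
  rewrite e'E [G2 c _](bopB (compop G20 QN)) [X in _ - X](_ : _ = 0).
    by rewrite subr0 /z' zS addrAC.
  by rewrite -[LHS]/(G20 (QN e)) Qe bop0.
have [z'0 x'0] := closed_loop_decay cl.
(* the output depends continuously on the sample and on the controller state *)
have lK : linear (fun v => period_output S 0 (K v) 0).
  by move=> a x y; rewrite (bopP1 K) (linear_controlled_output S).
have sK := seminorm_cV (seminorm_rnorm lK).
set CK := (\sum_i _) in sK.
apply: rnorm_cvg; apply/rnorm_cvgP.
apply: (@squeeze_cvgr _ _ _ _ (fun=> 0) (fun n =>
  opnorm (free_output S) * rnorm (closed_loop_state S c (x0 - xinf) 0 z' (n%:R * tau)) +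
  CK * rnorm (z' n))).
- apply: nearW => n; rewrite rnorm_ge0 -e'E regulation_errorE// subr0 period_output_split/=.
  apply: le_trans (ler_rnormD _ _) _; apply: lerD; last exact: sK.
  exact: (ler_opnorm (free_output S)).
- exact: cvg_cst.
- rewrite -[X in _ --> X]addr0; apply: cvgD.
    rewrite -[X in _ --> X](mulr0 (opnorm (free_output S))); apply: cvgM; first exact: cvg_cst.
    exact/cvg0_rnorm.
  rewrite -[X in _ --> X](mulr0 CK); apply: cvgM; first exact: cvg_cst.
  exact/cvg0_rnorm.
Qed.

End regulation.

(** * Stability for small gains *)

Section small_gain.
Context {R : realType} {tau : R} {X U0 Ud0 Y0 : completeNormedModType R[i]}.
Variable S : periodic_system tau X U0 Ud0 Y0.
Variables (r : nat) (G2 : bop (L2 tau Y0) 'cV[R[i]]_r) (K0 : bop 'cV[R[i]]_r (L2 tau U0)).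
Hypothesis tau0 : 0 < tau.
Hypothesis stableS : exponentially_stable S.
Hypothesis hurwitz : forall l : R[i], spectrum (fun v => G2 (opP S (K0 v))) l -> complex.Re l < 0.

(** The powers of T = U(tau, 0) are the operators U(n tau, 0). *)
Lemma monodromy_powers : exists M q, [/\ 0 <= M, 0 < q < 1 &
  forall n x, rnorm (iter n (evol S tau 0) x) <= M * q ^+ n * rnorm x].
Proof.
have [M [om [M0 om0 HM]]] := stableS.
have e1 : expR (- om * tau) < 1 by rewrite expR_lt1 mulNr oppr_lt0 mulr_gt0.
exists M, (expR (- om * tau)); split; rewrite ?(ltW M0) ?expR_gt0//.
move=> n x; have -> : iter n (evol S tau 0) x = evol S (n%:R * tau) 0 x.
  elim: n => [|n IH]; first by rewrite mul0r evol_refl.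
  rewrite iterS IH -(evol_periodic_nat S n (ltW tau0)) addr0.
  rewrite evol_compE ?mulr_ge0 ?(ltW tau0)//; last by rewrite lerDl ltW.
  by rewrite -natr1 mulrDl mul1r.
apply: le_trans (ler_opnorm _ _) _; rewrite ler_wpM2r ?rnorm_ge0//.
have := HM (n%:R * tau) 0; rewrite subr0 => /(_ _)/le_trans; apply.
  by rewrite mulr_ge0// ltW.
by rewrite [_ * tau]mulrC mulrA expRM_natr.
Qed.

Lemma stable_resolvent : resolvent_set (evol S tau 0) 1.
Proof.
have [M [q [M0 q01 HM]]] := monodromy_powers.
exact: neumann_resolvent M0 q01 HM.
Qed.

Let c (e : R) := Controller (idop 'cV[R[i]]_r) G2 (e%:C *: K0).

(** Bounded for each of the r unit vectors, hence for all of C^r. *)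
Lemma forced_gain_bounded (K : bop 'cV[R[i]]_r (L2 tau U0)) :
  exists2 C, 0 <= C & forall s v, 0 <= s <= tau ->
  rnorm (forced S s (source S (L2_val (K v)) (L2_val (0 : L2 tau Ud0)))) <= C * rnorm v.
Proof.
pose F i s := forced S s (source S (L2_val (K (delta_mx i 0))) (L2_val (0 : L2 tau Ud0))).
have /choice[C HC] : forall i : 'I_r, exists C, 0 <= C /\ forall s, 0 <= s <= tau -> rnorm (F i s) <= C.
  move=> i; have [C C0 HC] := forced_bounded S (source_integrable S (K (delta_mx i 0)) 0).
  by exists C.
exists (\sum_i C i); first by rewrite sumr_ge0// => i _; have [] := HC i.
move=> s v s0t; have /andP[_ st] := s0t.
have lf : linear (fun v => forced S s (source S (L2_val (K v)) (L2_val (0 : L2 tau Ud0)))).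
  move=> a x y; have := forced_source_linear S a (K x) (K y) 0 0 st.
  by rewrite scaler0 addr0 linearP.
apply: le_trans (seminorm_cV (seminorm_rnorm lf) v) _.
rewrite ler_wpM2r ?rnorm_ge0//; apply: ler_sum => i _.
by have [_] := HC i; apply.
Qed.

Lemma period_index_itv t : 0 <= t ->
  (period_index tau t)%:R * tau <= t < (period_index tau t).+1%:R * tau.
Proof.
move=> t0; have f0 : 0 <= Num.floor (t / tau) by rewrite floor_ge0 divr_ge0// ltW.
have nE : (period_index tau t)%:R = (Num.floor (t / tau))%:~R :> R.
  by rewrite /period_index pmulrn gez0_abs.
rewrite -natr1 nE -ler_pdivlMr// -ltr_pdivrMr// floor_le_tmp/=.
by rewrite -intrD1 floorD1_gt.
Qed.

(** The algebra of the passage from x to xi = x - e H z, with t = T xi, h = H z,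
m = H N z and g = H G xi: the term e H z cancels, and what z feeds into xi is of
second order in e. *)
Lemma shifted_state_step (V : lmodType R[i]) (t h m g : V) (e : R) :
  (t + e%:C *: h) - e%:C *: ((h + e%:C *: m) + g) = t - e%:C *: g - (e * e)%:C *: m.
Proof.
rewrite !scalerDr scalerA -rmorphM !opprD !addrA addrK.
by rewrite addrAC.
Qed.

(** In the variable xi = x - e H z the closed loop is a pair of coupled
recursions to which [coupled_decay] applies, in the norms [adapted_seminorm] for
xi and [hurwitz_seminorm] for z. *)
Lemma small_gain_stability : exists2 e0, 0 < e0 & forall e, 0 < e -> e <= e0 ->
  closed_loop_exponentially_stable S (c e).
Proof.
have res1 := stable_resolvent.
have [M [q [M0 q01 HT]]] := monodromy_powers.
have [px [Cx [rho [spx px1 pxC rho01 pxT]]]] := adapted_seminorm M0 q01 HT.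
pose N v := G2 (opP S (K0 v)).
have lN : linear N by move=> a x y; rewrite /N (bopP1 K0) (opP_linear S) (bopP1 G2).
have [pz [Cz [d [e1 [spz pzC d0 e10 pzN]]]]] := hurwitz_seminorm lN hurwitz.
have pz0 z : 0 <= pz z by exact: seminorm_ge0.
have px0 x : 0 <= px x by exact: seminorm_ge0.
have {}pzC z : rnorm z <= `|Cz| * pz z.
  by apply: le_trans (pzC z) _; rewrite ler_wpM2r// ler_norm.
pose Dz := \sum_(i < r) pz (delta_mx i 0).
have Dz0 : 0 <= Dz by rewrite sumr_ge0.
have pzD z : pz z <= Dz * rnorm z by exact: seminorm_cV.
pose H v := periodic_state S (K0 v) 0.
have lH : linear H by move=> a v v'; rewrite /H (bopP1 K0) (linear_periodic_state S).
have spH : seminorm (fun v => px (H v)).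
  split=> [x y|a x]; first by rewrite (linear_funD lH); exact: spx.1.
  by rewrite (linear_funZ lH) spx.2.
(* constants: hz bounds H, a bounds G, Dz * dn * |Cz| bounds N *)
pose hz := (\sum_(i < r) px (H (delta_mx i 0))) * `|Cz|.
have hz0 : 0 <= hz by rewrite mulr_ge0// sumr_ge0.
have pxH v : px (H v) <= hz * pz v.
  by apply: le_trans (seminorm_cV spH v) _; rewrite /hz -mulrA ler_wpM2l ?sumr_ge0.
clearbody Dz hz.
pose G := compop G2 (free_output S).
pose a := Dz * opnorm G.
have a0 : 0 <= a by rewrite mulr_ge0// opnorm_ge0.
have pzG x : pz (G x) <= a * px x.
  apply: le_trans (pzD _) _; rewrite /a -mulrA ler_wpM2l//.
  by apply: le_trans (ler_opnorm _ _) _; rewrite ler_wpM2l ?opnorm_ge0.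
clearbody a.
pose dn := \sum_(i < r) rnorm (N (delta_mx i 0)).
have dn0 : 0 <= dn by rewrite sumr_ge0// => i _; exact: rnorm_ge0.
have pzNb z : pz (N z) <= Dz * dn * `|Cz| * pz z.
  apply: le_trans (pzD _) _; rewrite -!mulrA ler_wpM2l//.
  apply: le_trans (seminorm_cV (seminorm_rnorm lN) z) _.
  by rewrite ler_wpM2l.
clearbody dn.
pose k := hz * (Dz * dn * `|Cz|).
have k0 : 0 <= k by rewrite mulr_ge0// mulr_ge0// mulr_ge0.
have pxHN z : px (H (N z)) <= k * pz z.
  by apply: le_trans (pxH _) _; rewrite /k -mulrA; exact: ler_wpM2l hz0 _ _ (pzNb z).
have pxHG x : px (H (G x)) <= hz * a * px x.
  by apply: le_trans (pxH _) _; rewrite -mulrA; exact: ler_wpM2l hz0 _ _ (pzG x).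
clearbody k.
have h0 : 0 <= hz * a by rewrite mulr_ge0.
have [e2 [C [e20 C0 dec]]] := coupled_decay rho01 h0 k0 a0 d0.
exists (Num.min e1 e2) => [|e epos]; first by rewrite lt_min e10.
rewrite le_min => /andP[ee1 ee2].
have [kappa /andP[kap0 kap1] {}dec] := dec e epos ee2.
(* bounds on the state inside one period, by its sample and the controller state *)
have [ME ME0 HME] := evol_bounded S tau.
have [CF CF0 HCF] := forced_gain_bounded (e%:C *: K0).
pose B := `|Cx| + e * (hz * Dz) + Dz.
have B0 : 0 <= B.
  by rewrite addr_ge0// addr_ge0 ?normr_ge0// mulr_ge0 ?(ltW epos)// mulr_ge0.
pose A1 := `|Cz| * (C * B).
pose A2 := (1 + e * hz) * (C * B).
have A10 : 0 <= A1 by rewrite !mulr_ge0.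
have A20 : 0 <= A2 by rewrite !mulr_ge0// addr_ge0// mulr_ge0// ltW.
have alpha0 : 0 < - ln kappa by rewrite oppr_gt0 ln_lt0// kap0.
have kapE n : kappa ^+ n = expR (- - ln kappa * n%:R).
  by rewrite opprK expRM_natr lnK// posrE.
have main x0 z0 z : closed_loop S (c e) 0 0 x0 z0 z -> forall n,
    rnorm (z n) <= A1 * kappa ^+ n * (rnorm x0 + rnorm z0) /\
    rnorm (closed_loop_state S (c e) x0 0 z (n%:R * tau)) <= A2 * kappa ^+ n * (rnorm x0 + rnorm z0).
  move=> [z00 zS].
  pose x n := closed_loop_state S (c e) x0 0 z (n%:R * tau).
  pose xi n := x n - e%:C *: H (z n).
  have xE n : x n = xi n + e%:C *: H (z n) by rewrite /xi subrK.
  have HeE v : periodic_state S (e%:C *: K0 v) 0 = e%:C *: H v.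
    exact: (linear_funZ (linear_periodic_state S)).
  have xS n : x n.+1 = evol S tau 0 (xi n) + e%:C *: H (z n).
    rewrite /x closed_loop_stateS// -/(x n) xE /=.
    have := period_stateD S (xi n) (e%:C *: H (z n)) 0 (e%:C *: K0 (z n)) 0 0.
    rewrite add0r addr0 => ->; rewrite period_state_free -HeE.
    by rewrite (period_state_periodic_state res1).
  have zE n : z n.+1 = (z n + e%:C *: N (z n)) + G (xi n).
    rewrite zS regulation_errorE// subr0 -/(x n) xE /=.
    have := period_outputD S (xi n) (e%:C *: H (z n)) 0 (e%:C *: K0 (z n)) 0 0.
    rewrite add0r addr0 => ->; rewrite -HeE -(opP_period_output S).
    rewrite (linear_funZ (linear_opP S)) (bopD G2) (bopZ G2).
    by rewrite -addrA; congr (_ + _); rewrite addrC.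
  have xiS n : xi n.+1 = evol S tau 0 (xi n) - e%:C *: H (G (xi n)) - (e ^+ 2)%:C *: H (N (z n)).
    rewrite {1}/xi xS zE !(linear_funD lH) (linear_funZ lH) expr2.
    exact: shifted_state_step.
  pose P n := px (xi n); pose Z n := pz (z n).
  have cabse : cabs e%:C = e by rewrite cabs_real gtr0_norm.
  have HP n : P n.+1 <= (rho + e * (hz * a)) * P n + e ^+ 2 * k * Z n.
    rewrite /P xiS; apply: le_trans (spx.1 _ _) _; apply: lerD.
      apply: le_trans (spx.1 _ _) _; rewrite mulrDl; apply: lerD; first exact: pxT.
      rewrite (seminormN _ spx) spx.2 cabse -mulrA.
      exact: ler_wpM2l (ltW epos) _ _ (pxHG (xi n)).
    rewrite (seminormN _ spx) spx.2 cabs_real ger0_norm ?sqr_ge0// -mulrA.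
    exact: ler_wpM2l (sqr_ge0 e) _ _ (pxHN (z n)).
  have HZ n : Z n.+1 <= (1 - d * e) * Z n + a * P n.
    rewrite /Z zE; apply: le_trans (spz.1 _ _) _; apply: lerD; last exact: pzG.
    exact: pzN.
  have decn := dec P Z (fun n => px0 _) (fun n => pz0 _) HP HZ.
  have P0Z0 : P 0%N + Z 0%N <= B * (rnorm x0 + rnorm z0).
    rewrite /P /Z /xi /x mul0r closed_loop_state0 z00 /B.
    have t1 : px (x0 - e%:C *: H z0) <= `|Cx| * rnorm x0 + e * (hz * Dz) * rnorm z0.
      apply: le_trans (spx.1 _ _) _; apply: lerD.
        by apply: le_trans (pxC _) _; rewrite ler_wpM2r ?rnorm_ge0// ler_norm.
      rewrite (seminormN _ spx) spx.2 cabse -mulrA; apply: ler_wpM2l; first exact: ltW.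
      by apply: le_trans (pxH _) _; rewrite -mulrA ler_wpM2l.
    have t2 := pzD z0.
    have t3 : 0 <= `|Cx| * rnorm z0 by rewrite mulr_ge0 ?rnorm_ge0.
    have t4 : 0 <= e * (hz * Dz) * rnorm x0 by rewrite !mulr_ge0 ?rnorm_ge0// ltW.
    have t5 : 0 <= Dz * rnorm x0 by rewrite mulr_ge0 ?rnorm_ge0.
    rewrite !mulrDl !mulrDr; move: t1 t2 t3 t4 t5; lra.
  have {}decn n : P n + Z n <= C * B * kappa ^+ n * (rnorm x0 + rnorm z0).
    apply: le_trans (decn n) _.
    have -> : C * B * kappa ^+ n * (rnorm x0 + rnorm z0) = C * kappa ^+ n * (B * (rnorm x0 + rnorm z0)) by ring.
    by rewrite ler_wpM2l// mulr_ge0// exprn_ge0// ltW.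
  move=> n; split.
    apply: le_trans (pzC _) _; rewrite /A1 -!mulrA ler_wpM2l//.
    apply: (@le_trans _ _ (P n + Z n)); first by rewrite -/(Z n) lerDr; exact: px0.
    by apply: le_trans (decn n) _; rewrite !mulrA.
  apply: (@le_trans _ _ ((1 + e * hz) * (P n + Z n))).
    apply: le_trans (px1 _) _; rewrite -/(x n) xE; apply: le_trans (spx.1 _ _) _.
    rewrite spx.2 cabse; have := pxH (z n); rewrite -(ler_pM2l epos) -/(P n) -/(Z n).
    have : 0 <= e * hz * P n := mulr_ge0 (mulr_ge0 (ltW epos) hz0) (px0 _).
    have : 0 <= Z n := pz0 _.
    move=> Zn0 Pn0 /(lerD (lexx (P n)))/le_trans; apply.
    have -> : (1 + e * hz) * (P n + Z n) = P n + e * (hz * Z n) + (Z n + e * hz * P n) by ring.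
    by rewrite lerDl addr_ge0.
  rewrite /A2 -!(mulrA (1 + _)) ler_wpM2l//.
  by rewrite addr_ge0// mulr_ge0// ltW.
clearbody A1 A2.
(* t < (n + 1) tau, so kappa^n <= kappa^(t / tau) / kappa *)
pose A3 := (ME * A2 + CF * A1) * kappa^-1.
have A40 : 0 <= ME * A2 + CF * A1 := addr_ge0 (mulr_ge0 ME0 A20) (mulr_ge0 CF0 A10).
have A30 : 0 <= A3 by rewrite mulr_ge0// invr_ge0 ltW.
exists (A3 + 1), (A1 + 1), (- ln kappa / tau), (- ln kappa); split => //.
- by rewrite ltr_wpDl.
- by rewrite ltr_wpDl.
- exact: divr_gt0.
move=> x0 z0 z /main{}main.
have s0 : 0 <= rnorm x0 + rnorm z0 by rewrite addr_ge0 ?rnorm_ge0.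
split=> [t t0|n]; last first.
  have [zn _] := main n; apply: le_trans zn _; rewrite -kapE ler_wpM2r//.
  by rewrite ler_wpM2r ?lerDl// exprn_ge0// ltW.
have := period_index_itv t0; set n := period_index tau t => /andP[nt tn].
pose s := t - n%:R * tau.
have s0t : 0 <= s <= tau.
  by rewrite subr_ge0 nt lerBlDr ltW//; move: tn; rewrite -natr1 mulrDl mul1r addrC.
have -> : t = n%:R * tau + s by rewrite /s addrC subrK.
rewrite closed_loop_stateE//; have [zn xn] := main n.
apply: le_trans (ler_rnormD _ _) _.
have [s00 stau] := andP s0t.
have h1 := HME 0 s (lexx _) s00 stau (closed_loop_state S (c e) x0 0 z (n%:R * tau)).
have h2 := HCF s (z n) s0t.
apply: (@le_trans _ _ ((ME * A2 + CF * A1) * kappa ^+ n * (rnorm x0 + rnorm z0))).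
  apply: le_trans (lerD h1 h2) _; rewrite !mulrDl; apply: lerD.
    by rewrite -!mulrA ler_wpM2l// !mulrA.
  by rewrite -!mulrA ler_wpM2l// !mulrA.
rewrite ler_wpM2r//.
have -> : n%:R * tau + s = t by rewrite /s addrC subrK.
apply: (@le_trans _ _ (A3 * expR (- (- ln kappa / tau) * t))); last first.
  by rewrite ler_wpM2r ?expR_ge0// lerDl.
rewrite /A3 -mulrA ler_wpM2l//.
rewrite -ler_pdivrMl ?invr_gt0// invrK -exprS kapE ler_expR opprK.
rewrite !mulNr opprK -mulrA.
have tn' : tau^-1 * t <= n.+1%:R by rewrite ler_pdivrMl// mulrC ltW.
by rewrite ler_nM2l// -oppr_gt0.
Qed.

End small_gain.

Theorem theorem3p5 (R : realType) (tau : R)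
    (X U0 Ud0 Y0 : completeNormedModType R[i])
    (S : periodic_system tau X U0 Ud0 Y0)
    (YN : vsubspace (L2 tau Y0)) (r : nat)
    (QN : bop (L2 tau Y0) (vsub YN))
    (G20 : bop (vsub YN) 'cV[R[i]]_r)
    (K0 : bop 'cV[R[i]]_r (L2 tau U0)) :
  0 < tau ->
  is_hilbert U0 -> is_hilbert Ud0 -> is_hilbert Y0 ->
  exponentially_stable S ->
  has_dim (vsub YN) r ->
  (forall y : L2 tau Y0, y \in YN -> exists u : L2 tau U0, opP S u = y) ->
  (forall y : vsub YN, QN (vsub_val y) = y) ->
  boundedly_invertible G20 ->
  (forall l : R[i],
     spectrum (fun v => compop G20 QN (opP S (K0 v))) l -> complex.Re l < 0) ->
  exists2 eps0 : R, 0 < eps0 & forall eps : R, 0 < eps -> eps <= eps0 ->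
    let c := Controller (idop 'cV[R[i]]_r) (compop G20 QN) (eps%:C *: K0) in
    closed_loop_exponentially_stable S c /\
    approximately_regulates S c QN /\
    (forall S' : periodic_system tau X U0 Ud0 Y0,
       closed_loop_exponentially_stable S' c ->
       resolvent_set (evol S' tau 0) 1 ->
       approximately_regulates S' c QN).
Proof.
move=> tau0 _ _ _ stableS _ _ _ G20i hurwitz.
have [e0 e00 He] := small_gain_stability tau0 stableS hurwitz.
exists e0 => // e epos ee0 c.
have stable := He e epos ee0; split=> //; split.
  apply: regulation_of_stability => //; exact: stable_resolvent.
by move=> S' stable' res'; exact: regulation_of_stability.
Qed.
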